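(* Let $k$ be a field and let $m\geq 2$ and $n\geq 3$ be integers. Let $\Lambda'_m(n,n-1)$ be the $k$-algebra given by the quiver with vertices $1',2',\ldots,m',2,3,\ldots,n$ and arrows $i'\to 2$ for $1\leq i\leq m$ and $j\to j+1$ for $2\leq j\leq n-1$, with relations all paths of length $n-1$. Then $\Lambda'_m(n,n-1)$ is piecewise hereditary of type $\mathbb{T}_{2^{m+1},n-2}$.
   Context: For a finite-dimensional $k$-algebra $A$, $\mathrm{mod}\,A$ is the category of finite-dimensional right $A$-modules and $\mathcal{D}^b(\mathrm{mod}\,A)$ its bounded derived category. $A$ is called piecewise hereditary if there is a hereditary abelian category $\mathcal{H}$ such that $\mathcal{D}^b(\mathrm{mod}\,A)$ is triangle equivalent to $\mathcal{D}^b(\mathcal{H})$; $\mathcal{H}$ (well defined up to derived equivalence) is called the type of $A$. If $\mathcal{H}=\mathrm{mod}\,H$ for a finite-dimensional hereditary algebra $H=kT$, the path algebra of a quiver $T$, then one also says that $A$ is of type $T$. For a sequence of positive integers $(p_1,\ldots,p_r)$, $\mathbb{T}_{p_1,\ldots,p_r}$ denotes the star quiver with one central vertex and $r$ linearly oriented arms starting at the central vertex and having $p_1-1,\ldots,p_r-1$ arrows, respectively. The symbol $\mathbb{T}_{2^{m+1},n-2}$ means $\mathbb{T}_{2,\ldots,2,n-2}$ with $m+1$ entries equal to $2$. *)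

(* Defs.v *)
From HB Require Import structures.
From mathcomp Require Import all_boot all_order all_algebra.
From mathcomp Require Import finmap.
From mathcomp Require Import boolp.
From mathcomp Require Import monalg.
From mathcomp Require Import zify.

Set Implicit Arguments.
Unset Strict Implicit.
Unset Printing Implicit Defensive.

Import GRing.Theory.
Local Open Scope ring_scope.

Record quiver := Quiver {
  vertex : finType;
  arrow : finType;
  src : arrow -> vertex;
  tgt : arrow -> vertex;
  vertex_gt0 : (0 < #|vertex|)%N }.

Fixpoint walk (Q : quiver) (v : vertex Q) (s : seq (arrow Q)) : bool :=
  if s is a :: s' then (src a == v) && walk (tgt a) s' else true.

(* A path is its source with its list of arrows, so that the trivial path at v
   is (v, [::]). *)
Definition qpath (Q : quiver) :=
  {p : vertex Q * seq (arrow Q) | walk p.1 p.2}.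
HB.instance Definition _ Q := SubChoice.on (qpath Q).

Section Paths.
Variable Q : quiver.
Implicit Types (p q r : qpath Q) (v : vertex Q).

Definition pstart p : vertex Q := (val p).1.
Definition parrows p : seq (arrow Q) := (val p).2.
Definition pend p : vertex Q := last (pstart p) (map (@tgt Q) (parrows p)).
Definition plength p : nat := size (parrows p).

Definition trivp v : qpath Q := exist _ (v, [::]) isT.

(* Composition "first p, then q"; None when the paths do not meet. *)
Definition pcat p q : option (qpath Q) :=
  if pend p == pstart q then insub (pstart p, parrows p ++ parrows q)
  else None.

Lemma walk_cat v s t :
  walk v (s ++ t) = walk v s && walk (last v (map (@tgt Q) s)) t.
Proof. by elim: s v => //= a s IH v; rewrite IH andbA. Qed.

Lemma val_pcat p q : omap val (pcat p q) =
  if pend p == pstart q then Some (pstart p, parrows p ++ parrows q) else None.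
Proof.
rewrite /pcat; case: eqP => // e.
have h : walk (pstart p) (parrows p ++ parrows q).
  by rewrite walk_cat (valP p) -/(pend p) e (valP q).
by rewrite insubT.
Qed.

Lemma pcat_trivl p : pcat (trivp (pstart p)) p = Some p.
Proof.
apply: (inj_omap val_inj); rewrite val_pcat /pend /= eqxx.
by case: p => [[]].
Qed.

Lemma pcat_trivr p : pcat p (trivp (pend p)) = Some p.
Proof.
apply: (inj_omap val_inj); rewrite val_pcat /= eqxx /= cats0.
by case: p => [[]].
Qed.

Lemma pcat_trivl0 v p : v != pstart p -> pcat (trivp v) p = None.
Proof. by rewrite /pcat /pend /= => /negPf ->. Qed.

Lemma pcat_trivr0 v p : v != pend p -> pcat p (trivp v) = None.
Proof. by rewrite /pcat eq_sym => /negPf ->. Qed.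

Lemma pcat_some p q r : pcat p q = Some r ->
  [/\ pend p = pstart q, pstart r = pstart p, pend r = pend q
    & parrows r = parrows p ++ parrows q].
Proof.
move=> e; have := val_pcat p q; rewrite e /=; case: eqP => // pq [er].
have rs : pstart r = pstart p by exact: (congr1 fst er).
have ra : parrows r = parrows p ++ parrows q by exact: (congr1 snd er).
split=> //; rewrite /pend ra rs map_cat last_cat.
by rewrite -/(pend p) pq.
Qed.

Lemma pcat_none p q : pcat p q = None -> pend p != pstart q.
Proof. by move=> e; have := val_pcat p q; rewrite e /=; case: eqP. Qed.

Lemma pcatA p q r :
  obind (pcat^~ r) (pcat p q) = obind (pcat p) (pcat q r).
Proof.
case pq: (pcat p q) => [x|]; case qr: (pcat q r) => [y|] //=.
- have [e1 xs xe xa] := pcat_some pq; have [e2 ys ye ya] := pcat_some qr.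
  apply: (inj_omap val_inj); rewrite !val_pcat xe e2 ys e1 !eqxx.
  by rewrite xs xa ya catA.
- have [e1 xs xe xa] := pcat_some pq; have := pcat_none qr.
  by rewrite /pcat xe => /negPf ->.
- have [e2 ys ye ya] := pcat_some qr; have := pcat_none pq.
  by rewrite /pcat ys => /negPf ->.
Qed.

End Paths.

Definition path_algebra (k : fieldType) (Q : quiver) : Type := {malg k[qpath Q]}.
HB.instance Definition _ k Q := GRing.Zmodule.on (path_algebra k Q).

(* Sealed: unfolding fgscale makes unification blow up. *)
HB.lock Definition kQ_scale (k : fieldType) (Q : quiver) (a : k)
  (x : path_algebra k Q) : path_algebra k Q := fgscale a x.

Section PathAlgebraLmodule.
Variables (k : fieldType) (Q : quiver).
Local Notation kQ := (path_algebra k Q).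

Lemma mcoeff_scale a (x : kQ) p : (kQ_scale a x)@_p = a * x@_p.
Proof. by rewrite kQ_scale.unlock fgscaleE. Qed.

Lemma kQ_scaleA a b (x : kQ) : kQ_scale a (kQ_scale b x) = kQ_scale (a * b) x.
Proof. by apply/malgP => p; rewrite !mcoeff_scale mulrA. Qed.

Lemma kQ_scale1 : left_id 1 (@kQ_scale k Q).
Proof. by move=> x; apply/malgP => p; rewrite mcoeff_scale mul1r. Qed.

Lemma kQ_scaleDr : right_distributive (@kQ_scale k Q) +%R.
Proof.
by move=> a x y; apply/malgP => p; rewrite !(mcoeffD, mcoeff_scale) mulrDr.
Qed.

Lemma kQ_scaleDl (x : kQ) : {morph (@kQ_scale k Q)^~ x : a b / a + b}.
Proof.
by move=> a b; apply/malgP => p; rewrite !(mcoeffD, mcoeff_scale) mulrDl.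
Qed.

HB.instance Definition _ := GRing.Zmodule_isLmodule.Build k kQ
  kQ_scaleA kQ_scale1 kQ_scaleDr kQ_scaleDl.

Lemma mcoeff_kQZ a (x : kQ) p : (a *: x)@_p = a * x@_p.
Proof. exact: mcoeff_scale. Qed.

Lemma msupp_kQZ_le a (x : kQ) : (msupp (a *: x) `<=` msupp x)%fset.
Proof.
apply/fsubsetP=> p; rewrite -!mcoeff_neq0 mcoeff_kQZ.
by apply: contraTneq => ->; rewrite mulr0 negbK.
Qed.

End PathAlgebraLmodule.

HB.lock Definition path_elt (k : fieldType) (Q : quiver) (p : qpath Q)
  : path_algebra k Q := << p >>.
Canonical path_elt_unlockable := Unlockable path_elt.unlock.

Definition path_mul (k : fieldType) (Q : quiver) (p q : qpath Q)
  : path_algebra k Q := oapp (@path_elt k Q) 0 (pcat p q).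

HB.lock Definition kQ_one (k : fieldType) (Q : quiver) : path_algebra k Q :=
  \sum_(v : vertex Q) @path_elt k Q (trivp v).
Canonical kQ_one_unlockable := Unlockable kQ_one.unlock.

HB.lock Definition kQ_mul (k : fieldType) (Q : quiver) (x y : path_algebra k Q)
  : path_algebra k Q :=
  \sum_(p <- msupp x) \sum_(q <- msupp y) (x@_p * y@_q) *: @path_mul k Q p q.
Canonical kQ_mul_unlockable := Unlockable kQ_mul.unlock.

Section PathAlgebra.
Variables (k : fieldType) (Q : quiver).
Local Notation kQ := (path_algebra k Q).
Local Notation path_elt := (@path_elt k Q).
Local Notation path_mul := (@path_mul k Q).
Implicit Types (p q r : qpath Q) (x y z : kQ).

Local Notation kQ_one := (@kQ_one k Q).
Local Notation kQ_mul := (@kQ_mul k Q).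

Lemma kQ_basis x : x = \sum_(p <- msupp x) x@_p *: path_elt p.
Proof.
rewrite [LHS]monalgE; apply: eq_bigr => p _; apply/malgP => q.
by rewrite path_elt.unlock mcoeffU mcoeff_kQZ mcoeffU mulr_natr.
Qed.

Lemma kQ_mulw (d1 d2 : {fset qpath Q}) x y :
  (msupp x `<=` d1)%fset -> (msupp y `<=` d2)%fset ->
  kQ_mul x y = \sum_(p <- d1) \sum_(q <- d2) (x@_p * y@_q) *: path_mul p q.
Proof.
move=> le1 le2; rewrite kQ_mul.unlock (big_fset_incl _ le1) /=.
  apply/eq_bigr=> p _; apply/big_fset_incl => // q _ /mcoeff_outdom ->.
  by rewrite mulr0 scale0r.
move=> p _ /mcoeff_outdom e; rewrite big1 // => q _.
by rewrite e mul0r scale0r.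
Qed.

Lemma kQ_mulDl : left_distributive kQ_mul +%R.
Proof.
move=> x y z; set d := (msupp x `|` msupp y)%fset.
rewrite (@kQ_mulw d (msupp z) (x + y)) ?msuppD_le //.
rewrite (@kQ_mulw d (msupp z) x) ?fsubsetUl // (@kQ_mulw d (msupp z) y) ?fsubsetUr //.
rewrite -big_split /=; apply: eq_bigr => p _.
rewrite -big_split /=; apply: eq_bigr => q _.
by rewrite mcoeffD mulrDl scalerDl.
Qed.

Lemma kQ_mulDr : right_distributive kQ_mul +%R.
Proof.
move=> z x y; set d := (msupp x `|` msupp y)%fset.
rewrite (@kQ_mulw (msupp z) d _ (x + y)) ?msuppD_le //.
rewrite (@kQ_mulw (msupp z) d _ x) ?fsubsetUl // (@kQ_mulw (msupp z) d _ y) ?fsubsetUr //.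
rewrite -big_split /=; apply: eq_bigr => p _.
rewrite -big_split /=; apply: eq_bigr => q _.
by rewrite mcoeffD mulrDr scalerDl.
Qed.

Lemma kQ_mulZl (a : k) x y : kQ_mul (a *: x) y = a *: kQ_mul x y.
Proof.
rewrite (@kQ_mulw (msupp x) (msupp y)) ?msupp_kQZ_le //.
rewrite kQ_mul.unlock scaler_sumr; apply: eq_bigr => p _.
rewrite scaler_sumr; apply: eq_bigr => q _.
by rewrite mcoeff_kQZ scalerA mulrA.
Qed.

Lemma kQ_mulZr (a : k) x y : kQ_mul x (a *: y) = a *: kQ_mul x y.
Proof.
rewrite (@kQ_mulw (msupp x) (msupp y)) ?msupp_kQZ_le //.
rewrite kQ_mul.unlock scaler_sumr; apply: eq_bigr => p _.
rewrite scaler_sumr; apply: eq_bigr => q _.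
by rewrite mcoeff_kQZ scalerA mulrCA.
Qed.

Lemma kQ_mul0l x : kQ_mul 0 x = 0.
Proof. by have := kQ_mulZl 0 0 x; rewrite !scale0r. Qed.

Lemma kQ_mul0r x : kQ_mul x 0 = 0.
Proof. by have := kQ_mulZr 0 x 0; rewrite !scale0r. Qed.

Lemma kQ_mul_suml I (s : seq I) (P : pred I) (F : I -> kQ) y :
  kQ_mul (\sum_(i <- s | P i) F i) y = \sum_(i <- s | P i) kQ_mul (F i) y.
Proof.
by apply: (big_morph (kQ_mul^~ y)) => [a b|]; rewrite ?kQ_mulDl ?kQ_mul0l.
Qed.

Lemma kQ_mul_sumr I (s : seq I) (P : pred I) (F : I -> kQ) y :
  kQ_mul y (\sum_(i <- s | P i) F i) = \sum_(i <- s | P i) kQ_mul y (F i).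
Proof.
by apply: (big_morph (kQ_mul y)) => [a b|]; rewrite ?kQ_mulDr ?kQ_mul0r.
Qed.

Lemma kQ_mulU p q : kQ_mul (path_elt p) (path_elt q) = path_mul p q.
Proof.
rewrite (@kQ_mulw [fset p]%fset [fset q]%fset) ?path_elt.unlock ?msuppU_le //.
by rewrite !big_seq_fset1 !mcoeffUU mulr1 scale1r.
Qed.

Lemma kQ_ind (P : kQ -> Prop) : P 0 -> (forall x y, P x -> P y -> P (x + y)) ->
  (forall a p, P (a *: path_elt p)) -> forall x, P x.
Proof. by move=> P0 PD PU x; rewrite (kQ_basis x); apply: big_ind. Qed.

Lemma kQ_mulA : associative kQ_mul.
Proof.
move=> x y z; elim/kQ_ind: x => [|x1 x2 IH1 IH2|a p].
- by rewrite !kQ_mul0l.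
- by rewrite (kQ_mulDl x1 x2) IH1 IH2 (kQ_mulDl x1 x2) kQ_mulDl.
rewrite 3!(kQ_mulZl a); congr (_ *: _).
elim/kQ_ind: y => [|y1 y2 IH1 IH2|b q].
- by rewrite kQ_mul0l !kQ_mul0r kQ_mul0l.
- by rewrite (kQ_mulDl y1 y2) kQ_mulDr IH1 IH2 (kQ_mulDr _ y1 y2) kQ_mulDl.
rewrite (kQ_mulZl b) 2!(kQ_mulZr b) (kQ_mulZl b); congr (_ *: _).
elim/kQ_ind: z => [|z1 z2 IH1 IH2|c r].
- by rewrite !kQ_mul0r.
- by rewrite 2!(kQ_mulDr _ z1 z2) kQ_mulDr IH1 IH2.
rewrite 3!(kQ_mulZr c); congr (_ *: _).
rewrite !kQ_mulU /path_mul; have := pcatA p q r.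
case: (pcat p q) => [u|]; case: (pcat q r) => [w|] //= e.
- by rewrite !kQ_mulU /path_mul e.
- by rewrite kQ_mulU kQ_mul0r /path_mul e.
- by rewrite kQ_mulU kQ_mul0l /path_mul -e.
- by rewrite kQ_mul0l kQ_mul0r.
Qed.

Lemma kQ_mul1l : left_id kQ_one kQ_mul.
Proof.
move=> x; rewrite [in RHS](kQ_basis x) {1}(kQ_basis x) kQ_one.unlock kQ_mul_sumr.
apply: eq_bigr => p _; rewrite kQ_mulZr; congr (_ *: _).
rewrite kQ_mul_suml (bigD1 (pstart p)) //= kQ_mulU /path_mul pcat_trivl /=.
by rewrite big1 ?addr0 // => v hv; rewrite kQ_mulU /path_mul pcat_trivl0.
Qed.

Lemma kQ_mul1r : right_id kQ_one kQ_mul.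
Proof.
move=> x; rewrite [in RHS](kQ_basis x) {1}(kQ_basis x) kQ_one.unlock kQ_mul_suml.
apply: eq_bigr => p _; rewrite kQ_mulZl; congr (_ *: _).
rewrite kQ_mul_sumr (bigD1 (pend p)) //= kQ_mulU /path_mul pcat_trivr /=.
by rewrite big1 ?addr0 // => v hv; rewrite kQ_mulU /path_mul pcat_trivr0.
Qed.

Lemma mcoeff_path_elt p q : (path_elt p)@_q = (p == q)%:R.
Proof. by rewrite path_elt.unlock mcoeffU. Qed.

Lemma kQ_one_coeff v : kQ_one@_(trivp v) = 1.
Proof.
rewrite kQ_one.unlock raddf_sum (bigD1 v isT) big1 => [|w /negPf wv];
  rewrite [LHS]/= ?mcoeff_path_elt ?eqxx ?addr0 //.
by rewrite -val_eqE /= xpair_eqE wv.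
Qed.

Lemma kQ_one_neq0 : kQ_one != 0.
Proof.
have [v _] := card_gt0P (vertex_gt0 Q).
apply/eqP => /(congr1 (mcoeff (trivp v))) /eqP.
by rewrite kQ_one_coeff mcoeff0 oner_eq0.
Qed.

HB.instance Definition _ := GRing.Zmodule_isNzRing.Build kQ
  kQ_mulA kQ_mul1l kQ_mul1r kQ_mulDl kQ_mulDr kQ_one_neq0.
HB.instance Definition _ := GRing.Lmodule_isLalgebra.Build k kQ
  (fun a x y => esym (kQ_mulZl a x y)).
HB.instance Definition _ := GRing.Lalgebra_isAlgebra.Build k kQ
  (fun a x y => esym (kQ_mulZr a x y)).

Lemma path_eltM p q : path_elt p * path_elt q = path_mul p q.
Proof. exact: kQ_mulU. Qed.

End PathAlgebra.

Record bound_quiver := BoundQuiver {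
  bq_quiver :> quiver;
  bq_rel : pred (qpath bq_quiver);
  bq_rel_gt0 : forall p, bq_rel p -> (0 < plength p)%N }.

Definition in_bq_ideal (k : fieldType) (B : bound_quiver)
    (x : path_algebra k B) : Prop :=
  exists s : seq (path_algebra k B * qpath B * path_algebra k B),
    all (fun t => bq_rel t.1.2) s /\
    x = \sum_(t <- s) t.1.1 * path_elt k t.1.2 * t.2.

Definition bq_ideal (k : fieldType) (B : bound_quiver) : {pred path_algebra k B} :=
  fun x => `[< in_bq_ideal x >].

Section BoundAlgebra.
Variables (k : fieldType) (B : bound_quiver).
Local Notation kQ := (path_algebra k B).
Local Notation I := (@bq_ideal k B).
Implicit Types x y z : kQ.

Lemma bq_idealP x : reflect (in_bq_ideal x) (x \in I).
Proof. exact: asboolP. Qed.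

Lemma bq_ideal0 : 0 \in I.
Proof. by apply/bq_idealP; exists [::]; rewrite big_nil. Qed.

Lemma bq_idealD x y : x \in I -> y \in I -> x + y \in I.
Proof.
move=> /bq_idealP[s [hs ->]] /bq_idealP[t [ht ->]]; apply/bq_idealP.
by exists (s ++ t); rewrite all_cat hs ht big_cat.
Qed.

Lemma bq_idealM x z y : z \in I -> x * z * y \in I.
Proof.
move=> /bq_idealP[s [hs ->]]; apply/bq_idealP.
exists [seq (x * t.1.1, t.1.2, t.2 * y) | t <- s]; split; first by rewrite all_map.
rewrite big_map mulr_sumr mulr_suml; apply: eq_bigr => t _.
by rewrite /= !mulrA.
Qed.

Lemma bq_idealMl x z : z \in I -> x * z \in I.
Proof. by move=> /(bq_idealM x 1); rewrite mulr1. Qed.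

Lemma bq_idealMr x z : z \in I -> z * x \in I.
Proof. by move=> /(bq_idealM 1 x); rewrite mul1r. Qed.

Lemma bq_idealZ (a : k) z : z \in I -> a *: z \in I.
Proof. by move=> /(bq_idealMl a%:A); rewrite -scalerAl mul1r. Qed.

Lemma bq_ideal_zmod_closed : zmod_closed I.
Proof.
split=> [|x y hx hy]; first exact: bq_ideal0.
by apply: bq_idealD => //; rewrite -scaleN1r bq_idealZ.
Qed.
HB.instance Definition _ := GRing.isZmodClosed.Build kQ I bq_ideal_zmod_closed.

Lemma mcoeff_path_mul v (p q : qpath B) :
  (path_mul k p q)@_(trivp v) = ((p == trivp v) && (q == trivp v))%:R.
Proof.
have triv (r : qpath B) : (r == trivp v) = (pstart r == v) && (parrows r == [::]).
  by rewrite -val_eqE /=; case: r => [[]].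
rewrite /path_mul !triv; case e: (pcat p q) => [r|] /=.
  have [pq rs _ ra] := pcat_some e; rewrite mcoeff_path_elt triv rs ra.
  move: pq; rewrite /pend; case: (parrows p) => [|b s] /=; last by rewrite !andbF.
  by move=> <-; case: (parrows q) => [|? ?]; rewrite ?andbF ?andbT ?andbb.
rewrite mcoeff0; have := pcat_none e; rewrite /pend.
case: (parrows p) => [|b s] /=; rewrite ?andbF // !andbT.
by case: (pstart p =P v) => //= ->; rewrite eq_sym => /negPf ->.
Qed.

Lemma mcoeff_kQM v x y : (x * y)@_(trivp v) = x@_(trivp v) * y@_(trivp v).
Proof.
elim/kQ_ind: x => [|x1 x2 IH1 IH2|a p].
- by rewrite mul0r mcoeff0 mul0r.
- by rewrite mulrDl mcoeffD IH1 IH2 mcoeffD mulrDl.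
elim/kQ_ind: y => [|y1 y2 IH1 IH2|b q].
- by rewrite mulr0 mcoeff0 mulr0.
- by rewrite mulrDr mcoeffD IH1 IH2 mcoeffD mulrDr.
rewrite -scalerAl -scalerAr path_eltM !mcoeff_kQZ mcoeff_path_mul.
by rewrite !mcoeff_path_elt mulrACA -natrM mulnb mulrA.
Qed.

Lemma bq_ideal1 : 1 \notin I.
Proof.
have [v _] := card_gt0P (vertex_gt0 B).
apply/bq_idealP => -[s [hs]] /(congr1 (mcoeff (trivp v))) /eqP.
rewrite [X in X == _](kQ_one_coeff k v) raddf_sum big1_seq ?oner_eq0 //.
move=> t /= /(allP hs) /bq_rel_gt0 ht; rewrite !mcoeff_kQM mcoeff_path_elt.
case: eqP ht => [->|_ _] //; by rewrite mulr0 mul0r.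
Qed.

End BoundAlgebra.

(* kQ/I, where I is the two-sided ideal generated by the relations. *)
Definition bound_algebra (k : fieldType) (B : bound_quiver) : Type :=
  Quotient.quot (@bq_ideal k B).
HB.instance Definition _ k B := GRing.Zmodule.on (bound_algebra k B).

HB.lock Definition bq_pi (k : fieldType) (B : bound_quiver)
  (x : path_algebra k B) : bound_algebra k B := (\pi x)%qT.

HB.lock Definition bq_repr (k : fieldType) (B : bound_quiver)
  (x : bound_algebra k B) : path_algebra k B := repr x.

Section BoundAlgebraRing.
Variables (k : fieldType) (B : bound_quiver).
Local Notation kQ := (path_algebra k B).
Local Notation kQI := (bound_algebra k B).
Local Notation I := (@bq_ideal k B).
Local Notation pi := (@bq_pi k B).
Local Notation rep := (@bq_repr k B).

Lemma bq_reprK x : pi (rep x) = x.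
Proof. by rewrite bq_pi.unlock bq_repr.unlock reprK. Qed.

Lemma bq_piP (x y : kQ) : (pi x = pi y) <-> (x - y \in I).
Proof.
rewrite bq_pi.unlock Quotient.idealrBE; split => [->|/eqP //]; exact: eqxx.
Qed.

Lemma bq_piD : {morph pi : x y / x + y}.
Proof. by move=> x y; rewrite bq_pi.unlock !piE. Qed.

Definition bqM (x y : kQI) : kQI := pi (rep x * rep y).
Definition bqZ (a : k) (x : kQI) : kQI := pi (a *: rep x).

Lemma bq_rep_pi x : x - rep (pi x) \in I.
Proof. by apply/bq_piP; rewrite bq_reprK. Qed.

Lemma bq_piM x y : bqM (pi x) (pi y) = pi (x * y).
Proof.
apply/esym/bq_piP; rewrite -[_ - _](subrKA (rep (pi x) * y)) -mulrBl -mulrBr.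
by apply: bq_idealD; [apply: bq_idealMr|apply: bq_idealMl]; apply: bq_rep_pi.
Qed.

Lemma bq_piZ a x : bqZ a (pi x) = pi (a *: x).
Proof. by apply/esym/bq_piP; rewrite -scalerBr bq_idealZ ?bq_rep_pi. Qed.

Lemma bqMA : associative bqM.
Proof.
move=> x y z; rewrite -(bq_reprK x) -(bq_reprK y) -(bq_reprK z).
by rewrite !bq_piM mulrA.
Qed.

Lemma bqM1l : left_id (pi 1) bqM.
Proof. by move=> x; rewrite -(bq_reprK x) bq_piM mul1r. Qed.

Lemma bqM1r : right_id (pi 1) bqM.
Proof. by move=> x; rewrite -(bq_reprK x) bq_piM mulr1. Qed.

Lemma bqMDl : left_distributive bqM +%R.
Proof.
move=> x y z; rewrite -(bq_reprK x) -(bq_reprK y) -(bq_reprK z).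
by rewrite -bq_piD !bq_piM mulrDl bq_piD.
Qed.

Lemma bqMDr : right_distributive bqM +%R.
Proof.
move=> x y z; rewrite -(bq_reprK x) -(bq_reprK y) -(bq_reprK z).
by rewrite -bq_piD !bq_piM mulrDr bq_piD.
Qed.

Lemma bq1_neq0 : pi 1 != 0.
Proof.
have <- : pi 0 = 0 by apply: (addrI (pi 0)); rewrite -bq_piD !addr0.
by apply/eqP => /bq_piP; rewrite subr0 (negPf (bq_ideal1 k B)).
Qed.

HB.instance Definition _ := GRing.Zmodule_isNzRing.Build kQI
  bqMA bqM1l bqM1r bqMDl bqMDr bq1_neq0.

Lemma bqZA a b x : bqZ a (bqZ b x) = bqZ (a * b) x.
Proof. by rewrite -(bq_reprK x) !bq_piZ scalerA. Qed.

Lemma bqZ1 : left_id 1 bqZ.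
Proof. by move=> x; rewrite -(bq_reprK x) bq_piZ scale1r. Qed.

Lemma bqZDr : right_distributive bqZ +%R.
Proof.
move=> a x y; rewrite -(bq_reprK x) -(bq_reprK y).
by rewrite -bq_piD !bq_piZ scalerDr bq_piD.
Qed.

Lemma bqZDl x : {morph bqZ^~ x : a b / a + b}.
Proof. by move=> a b; rewrite -(bq_reprK x) !bq_piZ scalerDl bq_piD. Qed.

HB.instance Definition _ := GRing.Zmodule_isLmodule.Build k kQI
  bqZA bqZ1 bqZDr bqZDl.

Lemma bqZAl (a : k) (x y : kQI) : a *: (x * y) = (a *: x) * y.
Proof.
rewrite -(bq_reprK x) -(bq_reprK y).
by rewrite [LHS](congr1 (bqZ a) (bq_piM _ _)) bq_piZ scalerAl
  [in RHS](bq_piZ a (rep x) : a *: pi (rep x) = _) -bq_piM.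
Qed.

Lemma bqZAr (a : k) (x y : kQI) : a *: (x * y) = x * (a *: y).
Proof.
rewrite -(bq_reprK x) -(bq_reprK y).
by rewrite [LHS](congr1 (bqZ a) (bq_piM _ _)) bq_piZ scalerAr
  [in RHS](bq_piZ a (rep y) : a *: pi (rep y) = _) -bq_piM.
Qed.

HB.instance Definition _ := GRing.Lmodule_isLalgebra.Build k kQI bqZAl.
HB.instance Definition _ := GRing.Lalgebra_isAlgebra.Build k kQI bqZAr.

End BoundAlgebraRing.

(* algType does not impose finite dimension. *)
Definition finite_dim_alg (k : fieldType) (A : algType k) : Prop :=
  exists s : seq A, forall x : A,
    exists c : 'I_(size s) -> k, x = \sum_i c i *: s`_i.

Record preadditive := Preadditive {
  obj :> Type;
  hom : obj -> obj -> zmodType;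
  idm : forall X, hom X X;
  comp : forall X Y Z, hom Y Z -> hom X Y -> hom X Z;
  comp1m : forall X Y (f : hom X Y), comp (idm Y) f = f;
  compm1 : forall X Y (f : hom X Y), comp f (idm X) = f;
  compA : forall X Y Z W (h : hom Z W) (g : hom Y Z) (f : hom X Y),
    comp h (comp g f) = comp (comp h g) f;
  compDl : forall X Y Z (g g' : hom Y Z) (f : hom X Y),
    comp (g + g') f = comp g f + comp g' f;
  compDr : forall X Y Z (g : hom Y Z) (f f' : hom X Y),
    comp g (f + f') = comp g f + comp g f' }.

Declare Scope cat_scope.
Delimit Scope cat_scope with cat.
Local Open Scope cat_scope.
Notation "g '∘' f" := (comp g f) (at level 40, left associativity) : cat_scope.

Section Preadditive.
Variable C : preadditive.
Implicit Types X Y Z : C.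

Lemma comp0m X Y Z (f : hom X Y) : (0 : hom Y Z) ∘ f = 0.
Proof. by apply: (addrI ((0 : hom Y Z) ∘ f)); rewrite -compDl !addr0. Qed.

Lemma compm0 X Y Z (g : hom Y Z) : g ∘ (0 : hom X Y) = 0.
Proof. by apply: (addrI (g ∘ (0 : hom X Y))); rewrite -compDr !addr0. Qed.

Lemma compNl X Y Z (g : hom Y Z) (f : hom X Y) : (- g) ∘ f = - (g ∘ f).
Proof. by apply: (addrI (g ∘ f)); rewrite -compDl !subrr comp0m. Qed.

Lemma compNr X Y Z (g : hom Y Z) (f : hom X Y) : g ∘ (- f) = - (g ∘ f).
Proof. by apply: (addrI (g ∘ f)); rewrite -compDr !subrr compm0. Qed.

Definition is_zero X : Prop := idm X = 0.

Definition is_isom X Y (f : hom X Y) : Prop :=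
  exists g : hom Y X, g ∘ f = idm X /\ f ∘ g = idm Y.

Definition is_mono X Y (f : hom X Y) : Prop :=
  forall W (u v : hom W X), f ∘ u = f ∘ v -> u = v.

Definition is_epi X Y (f : hom X Y) : Prop :=
  forall W (u v : hom Y W), u ∘ f = v ∘ f -> u = v.

Definition is_kernel X Y K (f : hom X Y) (i : hom K X) : Prop :=
  f ∘ i = 0 /\
  forall W (u : hom W X), f ∘ u = 0 -> exists! v : hom W K, i ∘ v = u.

Definition is_cokernel X Y K (f : hom X Y) (p : hom Y K) : Prop :=
  p ∘ f = 0 /\
  forall W (u : hom Y W), u ∘ f = 0 -> exists! v : hom K W, v ∘ p = u.

Definition is_biproduct X Y B (iX : hom X B) (iY : hom Y B)
    (pX : hom B X) (pY : hom B Y) : Prop :=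
  [/\ pX ∘ iX = idm X, pY ∘ iY = idm Y, pX ∘ iY = 0, pY ∘ iX = 0
    & iX ∘ pX + iY ∘ pY = idm B].

End Preadditive.

Record is_abelian (C : preadditive) : Prop := IsAbelian {
  ab_zero : exists X : C, is_zero X;
  ab_biproduct : forall X Y : C, exists (B : C) (iX : hom X B) (iY : hom Y B)
    (pX : hom B X) (pY : hom B Y), is_biproduct iX iY pX pY;
  ab_kernel : forall (X Y : C) (f : hom X Y),
    exists (K : C) (i : hom K X), is_kernel f i;
  ab_cokernel : forall (X Y : C) (f : hom X Y),
    exists (K : C) (p : hom Y K), is_cokernel f p;
  ab_mono : forall (X Y : C) (f : hom X Y), is_mono f ->
    exists (Z : C) (g : hom Y Z), is_kernel g f;
  ab_epi : forall (X Y : C) (f : hom X Y), is_epi f ->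
    exists (Z : C) (g : hom Z X), is_cokernel g f }.

Record cpx (C : preadditive) := Cpx {
  cob :> int -> C;
  cdiff : forall n, hom (cob n) (cob (n + 1));
  cdiff2 : forall n, cdiff (n + 1) ∘ cdiff n = 0;
  cbound : exists N : nat, forall n : int, (N < `|n|)%N -> is_zero (cob n) }.
Arguments cdiff {C} c n.

Record cmap (C : preadditive) (X Y : cpx C) := CMap {
  cfun :> forall n, hom (X n) (Y n);
  cfunP : forall n, cfun (n + 1) ∘ cdiff X n = cdiff Y n ∘ cfun n }.

Section Complexes.
Variable C : preadditive.
Implicit Types X Y Z : cpx C.

Fact cid_subproof X n : idm (X (n + 1)) ∘ cdiff X n = cdiff X n ∘ idm (X n).
Proof. by rewrite comp1m compm1. Qed.
Definition cid X : cmap X X := CMap (@cid_subproof X).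

Fact ccomp_subproof X Y Z (g : cmap Y Z) (f : cmap X Y) n :
  (g (n + 1) ∘ f (n + 1)) ∘ cdiff X n = cdiff Z n ∘ (g n ∘ f n).
Proof. by rewrite -compA cfunP !compA cfunP. Qed.
Definition ccomp X Y Z (g : cmap Y Z) (f : cmap X Y) : cmap X Z :=
  CMap (ccomp_subproof g f).

Fact cshift_diff2 X n :
  (- cdiff X (n + 1 + 1)) ∘ (- cdiff X (n + 1)) = 0.
Proof. by rewrite compNl compNr cdiff2 !oppr0. Qed.

Fact cshift_bound X :
  exists N : nat, forall n : int, (N < `|n|)%N -> is_zero (X (n + 1)).
Proof.
by have [N hN] := cbound X; exists N.+1 => n hn; apply: hN; case: n hn => n /=; lia.
Qed.

(* X[1]: X[1]^n = X^(n+1), with differential - d. *)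
Definition cshift X : cpx C :=
  @Cpx C (fun n => X (n + 1)) (fun n => - cdiff X (n + 1))
    (cshift_diff2 X) (cshift_bound X).

Fact cshift_map_subproof X Y (f : cmap X Y) n :
  f (n + 1 + 1) ∘ cdiff (cshift X) n = cdiff (cshift Y) n ∘ f (n + 1).
Proof. by rewrite /= compNl compNr cfunP. Qed.
Definition cshift_map X Y (f : cmap X Y) : cmap (cshift X) (cshift Y) :=
  @CMap C (cshift X) (cshift Y) (fun n => f (n + 1)) (cshift_map_subproof f).

(* h : Z -> H exhibits H as the cohomology of X in degree n + 1, where
   z : Z -> X (n + 1) is the inclusion of the cocycles. *)
Definition is_cohomology X (n : int) (Z H : C)
    (z : hom Z (X (n + 1))) (h : hom Z H) : Prop :=
  is_kernel (cdiff X (n + 1)) z /\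
  exists b : hom (X n) Z, z ∘ b = cdiff X n /\ is_cokernel b h.

(* The induced map e is an isomorphism in every degree. Cohomology objects are
   unique up to a unique isomorphism, so in an abelian category it does not
   matter whether they are quantified universally or chosen. *)
Definition is_qis X Y (f : cmap X Y) : Prop :=
  forall (n : int) (Z H Z' H' : C)
    (z : hom Z (X (n + 1))) (h : hom Z H) (z' : hom Z' (Y (n + 1))) (h' : hom Z' H'),
  is_cohomology z h -> is_cohomology z' h' ->
  forall (g : hom Z Z') (e : hom H H'),
    z' ∘ g = f (n + 1) ∘ z -> e ∘ h = h' ∘ g -> is_isom e.

Lemma is_kernelN (X Y K : C) (f : hom X Y) (i : hom K X) :
  is_kernel (- f) i -> is_kernel f i.
Proof.
case=> fi u; split=> [|W v fv]; first by apply: oppr_inj; rewrite -compNl fi oppr0.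
by apply: u; rewrite compNl fv oppr0.
Qed.

Lemma is_cokernelN (X Y K : C) (f : hom X Y) (p : hom Y K) :
  is_cokernel f p -> is_cokernel (- f) p.
Proof.
case=> pf u; split=> [|W v vf]; first by rewrite compNr pf oppr0.
by apply: u; apply: oppr_inj; rewrite -compNr vf oppr0.
Qed.

Lemma is_cohomology_shift X n (Z H : C) (z : hom Z (cshift X (n + 1))) (h : hom Z H) :
  @is_cohomology (cshift X) n Z H z h -> @is_cohomology X (n + 1) Z H z h.
Proof.
case=> kz [b [zb ch]]; split; first exact: is_kernelN.
by exists (- b); rewrite compNr zb opprK; split => //; apply: is_cokernelN.
Qed.

Lemma is_qis_shift X Y (f : cmap X Y) : is_qis f -> is_qis (cshift_map f).
Proof.
move=> qf n Z H Z' H' z h z' h' hz hz' g e e1 e2.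
by apply: (qf (n + 1) _ _ _ _ z h z' h' _ _ g e) => //; apply: is_cohomology_shift.
Qed.

(* K is the mapping cone of f, with canonical maps i : Y -> K and p : K -> X[1]:
   K^n = X^(n+1) (+) Y^n, with injections s n, i n and projections p n, r n, and
   differential (x, y) |-> (- d x, f x + d y). *)
Definition is_cone X Y K (f : cmap X Y) (i : cmap Y K) (p : cmap K (cshift X)) : Prop :=
  exists (s : forall n, hom (X (n + 1)) (K n)) (r : forall n, hom (K n) (Y n)),
  forall n,
    @is_biproduct C (X (n + 1)) (Y n) (K n) (s n) (i n) (p n) (r n) /\
    cdiff K n = s (n + 1) ∘ (- cdiff X (n + 1)) ∘ p n
              + i (n + 1) ∘ f (n + 1) ∘ p n
              + i (n + 1) ∘ cdiff Y n ∘ r n.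

(* The localization of the category of bounded complexes at the
   quasi-isomorphisms: morphisms are formal composites of chain maps and of
   inverses of quasi-isomorphisms, modulo the congruence deq. *)
Inductive dhom : cpx C -> cpx C -> Type :=
| DMap X Y (f : cmap X Y) : dhom X Y
| DInv X Y (q : cmap X Y) (qP : is_qis q) : dhom Y X
| DComp X Y Z (b : dhom Y Z) (a : dhom X Y) : dhom X Z.

Inductive deq : forall X Y, dhom X Y -> dhom X Y -> Prop :=
| deq_refl X Y (a : dhom X Y) : deq a a
| deq_sym X Y (a b : dhom X Y) : deq a b -> deq b a
| deq_trans X Y (a b c : dhom X Y) : deq a b -> deq b c -> deq a c
| deq_congr X Y Z (b b' : dhom Y Z) (a a' : dhom X Y) :
    deq b b' -> deq a a' -> deq (DComp b a) (DComp b' a')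
| deq_assoc X Y Z W (c : dhom Z W) (b : dhom Y Z) (a : dhom X Y) :
    deq (DComp c (DComp b a)) (DComp (DComp c b) a)
| deq_idl X Y (a : dhom X Y) : deq (DComp (DMap (cid Y)) a) a
| deq_idr X Y (a : dhom X Y) : deq (DComp a (DMap (cid X))) a
| deq_map X Y (f f' : cmap X Y) : (forall n, f n = f' n) -> deq (DMap f) (DMap f')
| deq_comp X Y Z (g : cmap Y Z) (f : cmap X Y) :
    deq (DComp (DMap g) (DMap f)) (DMap (ccomp g f))
| deq_invl X Y (q : cmap X Y) (qP : is_qis q) :
    deq (DComp (DInv qP) (DMap q)) (DMap (cid X))
| deq_invr X Y (q : cmap X Y) (qP : is_qis q) :
    deq (DComp (DMap q) (DInv qP)) (DMap (cid Y)).

Fixpoint dshift_map X Y (a : dhom X Y) : dhom (cshift X) (cshift Y) :=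
  match a with
  | DMap _ _ f => DMap (cshift_map f)
  | DInv _ _ q qP => DInv (is_qis_shift qP)
  | DComp _ _ _ b a => DComp (dshift_map b) (dshift_map a)
  end.

Lemma dshift_map_eq X Y (a b : dhom X Y) :
  deq a b -> deq (dshift_map a) (dshift_map b).
Proof.
elim=> {X Y a b} /=.
- by move=> *; apply: deq_refl.
- by move=> *; apply: deq_sym.
- by move=> X Y a b c _ ab _ bc; apply: deq_trans ab bc.
- by move=> *; apply: deq_congr.
- by move=> *; apply: deq_assoc.
- move=> X Y a; apply: deq_trans (deq_idl _).
  by apply: deq_congr (deq_refl _); apply: deq_map.
- move=> X Y a; apply: deq_trans (deq_idr _).
  by apply: deq_congr; [apply: deq_refl|apply: deq_map].
- by move=> X Y f f' e; apply: deq_map => n /=.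
- by move=> X Y Z g f; apply: deq_trans (deq_comp _ _) _; apply: deq_map.
- move=> X Y q qP; apply: deq_trans (deq_invl _) _; exact: deq_map.
- move=> X Y q qP; apply: deq_trans (deq_invr _) _; exact: deq_map.
Qed.

End Complexes.

(* Morphisms are compared by the equivalence relation heq, which for the derived
   category is coarser than equality. *)
Record category := Category {
  cat_obj :> Type;
  chom : cat_obj -> cat_obj -> Type;
  heq : forall X Y, chom X Y -> chom X Y -> Prop;
  idc : forall X, chom X X;
  compc : forall X Y Z, chom Y Z -> chom X Y -> chom X Z;
  heq_refl : forall X Y (a : chom X Y), heq a a;
  heq_sym : forall X Y (a b : chom X Y), heq a b -> heq b a;
  heq_trans : forall X Y (a b c : chom X Y), heq a b -> heq b c -> heq a c;
  compc_congr : forall X Y Z (b b' : chom Y Z) (a a' : chom X Y),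
    heq b b' -> heq a a' -> heq (compc b a) (compc b' a');
  compcA : forall X Y Z W (c : chom Z W) (b : chom Y Z) (a : chom X Y),
    heq (compc c (compc b a)) (compc (compc c b) a);
  comp1c : forall X Y (a : chom X Y), heq (compc (idc Y) a) a;
  compc1 : forall X Y (a : chom X Y), heq (compc a (idc X)) a }.

Notation "a ≡ b" := (heq a b) (at level 70) : cat_scope.
Notation "b '⊚' a" := (compc b a) (at level 40, left associativity) : cat_scope.

Definition is_iso (D : category) (X Y : D) (a : chom X Y) : Prop :=
  exists b : chom Y X, b ⊚ a ≡ idc X /\ a ⊚ b ≡ idc Y.

Record functor (D E : category) := Functor {
  fobj :> D -> E;
  fmap : forall X Y, chom X Y -> chom (fobj X) (fobj Y);
  fmap_congr : forall X Y (a b : chom X Y), a ≡ b -> fmap a ≡ fmap b;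
  fmap_id : forall X, fmap (idc X) ≡ idc (fobj X);
  fmap_comp : forall X Y Z (b : chom Y Z) (a : chom X Y),
    fmap (b ⊚ a) ≡ fmap b ⊚ fmap a }.

Definition id_functor (D : category) : functor D D :=
  @Functor D D id (fun _ _ a => a) (fun _ _ _ _ e => e)
    (fun X => heq_refl (idc X)) (fun _ _ _ b a => heq_refl (b ⊚ a)).

Section CompFunctor.
Variables (D E F : category) (G : functor E F) (H : functor D E).

Fact comp_functor_id X : fmap G (fmap H (idc X)) ≡ idc (G (H X)).
Proof. by apply: heq_trans (fmap_id G _); apply: fmap_congr (fmap_id H _). Qed.

Fact comp_functor_comp X Y Z (b : chom Y Z) (a : chom X Y) :
  fmap G (fmap H (b ⊚ a)) ≡ fmap G (fmap H b) ⊚ fmap G (fmap H a).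
Proof.
by apply: heq_trans (fmap_comp G _ _); apply: fmap_congr (fmap_comp H _ _).
Qed.

Definition comp_functor : functor D F :=
  @Functor D F (fun X => G (H X)) (fun _ _ a => fmap G (fmap H a))
    (fun _ _ _ _ e => fmap_congr G (fmap_congr H e))
    comp_functor_id comp_functor_comp.

End CompFunctor.

Definition is_nat_iso (D E : category) (F G : functor D E)
    (t : forall X, chom (F X) (G X)) : Prop :=
  (forall X, is_iso (t X)) /\
  (forall X Y (a : chom X Y), t Y ⊚ fmap F a ≡ fmap G a ⊚ t X).

(* The data of a triangulated category. The axioms TR1-TR4 are theorems for the
   derived category below and do not enter the definition of a triangle
   equivalence. Neither does the additive structure: it is determined by the
   underlying category, so that every equivalence is additive. *)
Record tri_category := TriCategory {
  tri_cat :> category;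
  shift : functor tri_cat tri_cat;
  distinguished : forall X Y Z : tri_cat,
    chom X Y -> chom Y Z -> chom Z (shift X) -> Prop }.
Arguments shift {t}.

Definition is_equivalence (D E : category) (F : functor D E) : Prop :=
  exists G : functor E D,
    (exists t, @is_nat_iso D D (comp_functor G F) (id_functor D) t) /\
    (exists t, @is_nat_iso E E (comp_functor F G) (id_functor E) t).

Definition is_triangle_functor (D E : tri_category) (F : functor D E) : Prop :=
  exists t : forall X, chom (F (shift X)) (shift (F X)),
    @is_nat_iso D E (comp_functor F shift) (comp_functor shift F) t /\
    forall (X Y Z : D) (u : chom X Y) (v : chom Y Z) (w : chom Z (shift X)),
      distinguished u v w ->
      distinguished (fmap F u) (fmap F v) (t X ⊚ fmap F w).

Definition triangle_equivalent (D E : tri_category) : Prop :=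
  exists F : functor D E, is_equivalence F /\ is_triangle_functor F.

Section DerivedCategory.
Variable C : preadditive.

Definition derived_cat : category :=
  @Category (cpx C) (@dhom C) (@deq C) (fun X => DMap (cid X)) (@DComp C)
    (@deq_refl C) (@deq_sym C) (@deq_trans C) (@deq_congr C) (@deq_assoc C)
    (@deq_idl C) (@deq_idr C).

Fact derived_shift_id (X : cpx C) :
  deq (dshift_map (DMap (cid X))) (DMap (cid (cshift X))).
Proof. exact: deq_map. Qed.

Definition derived_shift : functor derived_cat derived_cat :=
  @Functor derived_cat derived_cat (@cshift C) (@dshift_map C)
    (@dshift_map_eq C) derived_shift_id
    (fun _ _ _ b a => deq_refl (DComp (dshift_map b) (dshift_map a))).

(* The triangles isomorphic to the image of X' -f-> Y' -> cone f -> X'[1]. *)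
Definition derived_distinguished (X Y Z : derived_cat)
    (u : chom X Y) (v : chom Y Z) (w : chom Z (derived_shift X)) : Prop :=
  exists (X' Y' K : cpx C) (f : cmap X' Y') (i : cmap Y' K)
    (p : cmap K (cshift X')),
  is_cone f i p /\
  exists (a : @chom derived_cat X' X) (b : @chom derived_cat Y' Y)
    (c : @chom derived_cat K Z),
  [/\ is_iso a, is_iso b & is_iso c] /\
  [/\ b ⊚ (DMap f : @chom derived_cat X' Y') ≡ u ⊚ a,
      c ⊚ (DMap i : @chom derived_cat Y' K) ≡ v ⊚ b
    & fmap derived_shift a ⊚ (DMap p : @chom derived_cat K (cshift X')) ≡ w ⊚ c].

Definition Db : tri_category :=
  @TriCategory derived_cat derived_shift derived_distinguished.

(* Ext^i(M, N) = Hom(M, N[i]) vanishes for i >= 2; here X is M placed in degree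
   0 and Y is N[i], that is, N placed in degree -i. A Hom group vanishes when
   any two of its elements are equal. *)
Definition concentrated (n : int) (X : cpx C) : Prop :=
  forall j, j != n -> is_zero (X j).

Definition is_hereditary : Prop :=
  forall (i : nat) (X Y : cpx C), (2 <= i)%N ->
    concentrated 0 X -> concentrated (- i%:Z) Y ->
    forall a b : @chom Db X Y, a ≡ b.

End DerivedCategory.

Section Modules.
Variables (k : fieldType) (A : algType k).

(* mact a is the map m |-> m a, hence the order of the factors in mactM. *)
Record rmodule := RModule {
  mspace :> vectType k;
  mact : A -> 'End(mspace);
  mactP : forall (c : k) (a b : A), mact (c *: a + b) = c *: mact a + mact b;
  mact1 : mact 1 = \1%VF;
  mactM : forall a b : A, mact (a * b) = (mact b \o mact a)%VF }.

Definition is_mod_hom (M N : rmodule) : {pred 'Hom(M, N)} :=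
  fun f => `[< forall a : A, (f \o mact M a = mact N a \o f)%VF >].

Fact is_mod_hom_zmod_closed (M N : rmodule) : zmod_closed (@is_mod_hom M N).
Proof.
split=> [|f g /asboolP hf /asboolP hg]; apply/asboolP => a.
  by rewrite comp_lfun0l comp_lfun0r.
by rewrite comp_lfunDl comp_lfunDr comp_lfunNl comp_lfunNr hf hg.
Qed.
HB.instance Definition _ (M N : rmodule) :=
  GRing.isZmodClosed.Build 'Hom(M, N) (@is_mod_hom M N)
    (@is_mod_hom_zmod_closed M N).

Record mod_hom (M N : rmodule) := ModHom {
  mfun :> 'Hom(M, N);
  mfunP : mfun \in @is_mod_hom M N }.
HB.instance Definition _ M N := [isSub for @mfun M N].
HB.instance Definition _ M N := [Choice of mod_hom M N by <:].
HB.instance Definition _ M N := [SubChoice_isSubZmodule of mod_hom M N by <:].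

Fact mod_id_subproof (M : rmodule) : \1%VF \in @is_mod_hom M M.
Proof. by apply/asboolP => a; rewrite comp_lfun1l comp_lfun1r. Qed.
Definition mod_id M : mod_hom M M := ModHom (mod_id_subproof M).

Fact mod_comp_subproof (M N P : rmodule) (g : mod_hom N P) (f : mod_hom M N) :
  (mfun g \o mfun f)%VF \in @is_mod_hom M P.
Proof.
apply/asboolP => a; have /asboolP hf := mfunP f; have /asboolP hg := mfunP g.
by rewrite -comp_lfunA hf comp_lfunA hg comp_lfunA.
Qed.
Definition mod_comp M N P (g : mod_hom N P) (f : mod_hom M N) : mod_hom M P :=
  ModHom (mod_comp_subproof g f).

Fact mod_comp1m M N (f : mod_hom M N) : mod_comp (mod_id N) f = f.
Proof. by apply: val_inj; rewrite /= comp_lfun1l. Qed.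

Fact mod_compm1 M N (f : mod_hom M N) : mod_comp f (mod_id M) = f.
Proof. by apply: val_inj; rewrite /= comp_lfun1r. Qed.

Fact mod_compA M N P Q (h : mod_hom P Q) (g : mod_hom N P) (f : mod_hom M N) :
  mod_comp h (mod_comp g f) = mod_comp (mod_comp h g) f.
Proof. by apply: val_inj; rewrite /= comp_lfunA. Qed.

Fact mod_compDl M N P (g g' : mod_hom N P) (f : mod_hom M N) :
  mod_comp (g + g') f = mod_comp g f + mod_comp g' f.
Proof. by apply: val_inj; rewrite /= comp_lfunDl. Qed.

Fact mod_compDr M N P (g : mod_hom N P) (f f' : mod_hom M N) :
  mod_comp g (f + f') = mod_comp g f + mod_comp g f'.
Proof. by apply: val_inj; rewrite /= comp_lfunDr. Qed.

Definition mod_cat : preadditive :=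
  @Preadditive rmodule mod_hom mod_id mod_comp
    mod_comp1m mod_compm1 mod_compA mod_compDl mod_compDr.

End Modules.

(* A is piecewise hereditary when some H satisfies this; H is then its type. *)
Definition piecewise_hereditary_of (k : fieldType) (A : algType k)
    (H : preadditive) : Prop :=
  [/\ is_abelian H, is_hereditary H
    & triangle_equivalent (Db (mod_cat A)) (Db H)].

Definition piecewise_hereditary_of_type (k : fieldType) (A : algType k)
    (T : quiver) : Prop :=
  [/\ finite_dim_alg A, finite_dim_alg (path_algebra k T)
    & piecewise_hereditary_of A (mod_cat (path_algebra k T))].

(* The star quiver T_{p_1, ..., p_r}: None is the central vertex, and the
   arrows of the arm i are
   None -> (i, 0) -> (i, 1) -> ... -> (i, p_i - 2);
   an arrow is identified with its target. *)
Section Star.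
Variable p : seq nat.

Definition star_arrow : finType := {i : 'I_(size p) & 'I_(nth 0%N p i).-1}.

Definition star_tgt (a : star_arrow) : option star_arrow := Some a.

Definition star_src (a : star_arrow) : option star_arrow :=
  let: existT i j := a in
  if j == 0%N :> nat then None
  else Some (existT _ i (Ordinal (leq_ltn_trans (leq_pred j) (ltn_ord j)))).

Fact star_gt0 : (0 < #|{: option star_arrow}|)%N.
Proof. by rewrite card_option. Qed.

Definition star : quiver := Quiver star_src star_tgt star_gt0.

End Star.

(* The quiver of Lambda'_m(n, r): inl i is the vertex (i + 1)', inr j is the
   vertex j + 2 (0 <= j <= n - 2); the arrow inl i goes from (i + 1)' to 2, and
   the arrow inr j from j + 2 to j + 3. *)
Section LambdaPrime.
Variables m n : nat.

Definition Lambda'_vertex : finType := ('I_m + 'I_(n - 2).+1)%type.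
Definition Lambda'_arrow : finType := ('I_m + 'I_(n - 2))%type.

Definition Lambda'_src (a : Lambda'_arrow) : Lambda'_vertex :=
  match a with
  | inl i => inl i
  | inr j => inr (widen_ord (leqnSn (n - 2)) j)
  end.

Definition Lambda'_tgt (a : Lambda'_arrow) : Lambda'_vertex :=
  match a with
  | inl _ => inr ord0
  | inr j => inr (lift ord0 j)
  end.

Fact Lambda'_gt0 : (0 < #|Lambda'_vertex|)%N.
Proof. by apply/card_gt0P; exists (inr ord0). Qed.

Definition Lambda'_quiver : quiver := Quiver Lambda'_src Lambda'_tgt Lambda'_gt0.

(* The relations: all paths of length r (for r >= 1). *)
Definition Lambda'_rel (r : nat) (p : qpath Lambda'_quiver) : bool :=
  (0 < plength p)%N && (plength p == r).

Fact Lambda'_rel_gt0 r p : Lambda'_rel r p -> (0 < plength p)%N.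
Proof. by case/andP. Qed.

Definition Lambda'_bound (r : nat) : bound_quiver :=
  BoundQuiver (@Lambda'_rel_gt0 r).

End LambdaPrime.

Definition Lambda' (k : fieldType) (m n r : nat) : algType k :=
  bound_algebra k (Lambda'_bound m n r).

(* Main.v *)
From HB Require Import structures.
From mathcomp Require Import all_boot all_order all_algebra.
From mathcomp Require Import boolp monalg zify.
Require Import Defs.

Set Implicit Arguments.
Unset Strict Implicit.
Unset Printing Implicit Defensive.

Import GRing.Theory.
Local Open Scope ring_scope.
Local Open Scope cat_scope.

(** Representations of the quiver of Lambda' with its relations are systems
    X_i -> Y_2 -> ... -> Y_n, with 1 <= i <= m, in which the composites
    X_i -> Y_n vanish. For 2 <= j < n let W_j be the homotopy fibre of
    Y_j -> Y_n. As X_i -> Y_n is zero, X_i maps to W_2, and so does Y_n[-1] by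
    the triangle of the fibre. This gives a system of the shape of a star: m + 1
    sources X_1, ..., X_m, Y_n[-1] pointing to W_2, and one arm
    W_2 -> ... -> W_(n-1). Nothing is lost, because Y_j is the cone of
    Y_n[-1] -> W_j. Reflecting at the m + 1 sources reverses their arrows and
    produces the star of type T_(2^(m+1), n-2), with its arms leaving the center.

    Both steps and their inverses are functors of the same kind, which send a
    complex X of representations to the mapping cone of X (s v) -> X (t v), for
    two maps s, t of vertices. Such a cone functor preserves quasi-isomorphisms
    and mapping cones (cone_qis, cone_triangle), so it acts on derived
    categories, and as a triangle functor, with no need for resolutions. The
    composite of two of them is joined to the shift by a natural chain map that
    is a quasi-isomorphism (unit_qis, counit_qis) as soon as a list of boolean
    conditions on vertices holds, and this makes them equivalences
    (equivalence_up_to_shift, cone_triangle_equivalence). The two steps are then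
    instances, composed in line_source_equivalence.

    Modules are exchanged for representations as follows. In both algebras there
    is up to scalars at most one nonzero path between two vertices
    (lambda_thin, star_thin, both by thin_quiver); for such an algebra modules
    are equivalent to representations of the relation telling between which
    vertices there is one (th_equivalence). An equivalence of additive categories
    induces a triangle equivalence and transports being abelian and being
    hereditary (add_equivalence_triangle, abelian_transfer, hereditary_transfer).

    Finally, the representations of a rooted tree form a hereditary category. A
    representation with injective structure maps has the lifting property of
    projectives (mono_rep_lift). Free representations have injective structure
    maps, and so have their subrepresentations, whence a resolution by two such
    representations (resolution). Every morphism of the derived category out of
    a two-term resolution is a chain map (two_term_strict), and there is none
    but zero into a complex concentrated in a degree below - 1
    (forest_hereditary). *)

(** * Categories with morphisms up to an equivalence *)

Section CategoryCalculus.

Lemma compc_congl (D : category) (X Y Z : D) (b b' : chom Y Z) (a : chom X Y) :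
  b ≡ b' -> b ⊚ a ≡ b' ⊚ a.
Proof. by move=> e; apply: compc_congr (heq_refl a). Qed.

Lemma compc_congrr (D : category) (X Y Z : D) (b : chom Y Z) (a a' : chom X Y) :
  a ≡ a' -> b ⊚ a ≡ b ⊚ a'.
Proof. by move=> e; apply: compc_congr (heq_refl b) e. Qed.

Lemma compcAr (D : category) (X Y Z W : D) (c : chom Z W) (b : chom Y Z)
  (a : chom X Y) : (c ⊚ b) ⊚ a ≡ c ⊚ (b ⊚ a).
Proof. exact: heq_sym (compcA c b a). Qed.

Lemma is_iso_id (D : category) (X : D) : is_iso (idc X).
Proof. by exists (idc X); split; apply: comp1c. Qed.

Lemma is_iso_comp (D : category) (X Y Z : D) (b : chom Y Z) (a : chom X Y) :
  is_iso b -> is_iso a -> is_iso (b ⊚ a).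
Proof.
move=> [b' [b1 b2]] [a' [a1 a2]]; exists (a' ⊚ b'); split.
  apply: heq_trans (compcAr _ _ _) _; apply: heq_trans a1.
  apply: compc_congrr; apply: heq_trans (compcA _ _ _) _.
  by apply: heq_trans (compc_congl _ b1) (comp1c _).
apply: heq_trans (compcAr _ _ _) _; apply: heq_trans b2.
apply: compc_congrr; apply: heq_trans (compcA _ _ _) _.
by apply: heq_trans (compc_congl _ a2) (comp1c _).
Qed.

Lemma is_iso_fmap (D E : category) (F : functor D E) (X Y : D) (a : chom X Y) :
  is_iso a -> is_iso (fmap F a).
Proof.
move=> [b [ba ab]]; exists (fmap F b); split.
  apply: heq_trans (heq_sym (fmap_comp F _ _)) _.
  by apply: heq_trans (fmap_congr F ba) (fmap_id F _).
apply: heq_trans (heq_sym (fmap_comp F _ _)) _.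
by apply: heq_trans (fmap_congr F ab) (fmap_id F _).
Qed.

(** Inverting the sides t and s of a commutative square. This is how naturality
    passes to the inverse of a natural isomorphism, and to the formal inverses
    of quasi-isomorphisms. *)
Lemma iso_square (D : category) (X Y X' Y' : D) (t : chom X X') (s : chom Y Y')
  (t' : chom X' X) (s' : chom Y' Y) (a : chom X Y) (a' : chom X' Y') :
  t ⊚ t' ≡ idc X' -> s' ⊚ s ≡ idc Y -> s ⊚ a ≡ a' ⊚ t -> s' ⊚ a' ≡ a ⊚ t'.
Proof.
move=> tt' ss e.
apply: (heq_trans (b := s' ⊚ (a' ⊚ (t ⊚ t')))).
  apply: compc_congrr; apply: heq_sym; apply: heq_trans (compc1 _).
  exact: compc_congrr.
apply: (heq_trans (b := s' ⊚ ((s ⊚ a) ⊚ t'))).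
  apply: compc_congrr; apply: heq_trans (compcA _ _ _) _.
  exact: compc_congl (heq_sym e).
apply: (heq_trans (b := ((s' ⊚ s) ⊚ a) ⊚ t')).
  apply: heq_trans (compcA _ _ _) _; apply: compc_congl; exact: compcA.
by apply: compc_congl; apply: heq_trans (compc_congl _ ss) (comp1c _).
Qed.

Definition niso (D E : category) (F G : functor D E) : Prop :=
  exists t, @is_nat_iso D E F G t.

Lemma niso_refl (D E : category) (F : functor D E) : niso F F.
Proof.
exists (fun X => idc (F X)); split=> [X|X Y a]; first exact: is_iso_id.
exact: heq_trans (comp1c _) (heq_sym (compc1 _)).
Qed.

Lemma niso_sym (D E : category) (F G : functor D E) : niso F G -> niso G F.
Proof.
case=> t [ti tn].
pose s X := sval (constructive_indefinite_description (ti X)).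
have sP X : s X ⊚ t X ≡ idc (F X) /\ t X ⊚ s X ≡ idc (G X).
  by rewrite /s; case: constructive_indefinite_description.
exists s; split=> [X|X Y a].
  by exists (t X); case: (sP X).
have [_ e1] := sP X; have [e2 _] := sP Y.
exact: iso_square e1 e2 (tn _ _ a).
Qed.

Lemma niso_trans (D E : category) (F G H : functor D E) :
  niso F G -> niso G H -> niso F H.
Proof.
case=> t [ti tn] [s [si sn]]; exists (fun X => s X ⊚ t X); split=> [X|X Y a].
  exact: is_iso_comp.
apply: heq_trans (compcAr _ _ _) _.
apply: heq_trans (compc_congrr _ (tn _ _ a)) _.
apply: heq_trans (compcA _ _ _) _.
apply: heq_trans (compc_congl _ (sn _ _ a)) _.
exact: compcAr.
Qed.

Lemma niso_compl (D E H : category) (K : functor E H) (F G : functor D E) :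
  niso F G -> niso (comp_functor K F) (comp_functor K G).
Proof.
case=> t [ti tn]; exists (fun X => fmap K (t X)); split=> [X|X Y a].
  exact: (is_iso_fmap K (ti X)).
apply: heq_trans (heq_sym (fmap_comp K _ _)) _.
apply: heq_trans (fmap_congr K (tn _ _ a)) _.
exact: (fmap_comp K).
Qed.

Lemma niso_compr (D E H : category) (F G : functor E H) (K : functor D E) :
  niso F G -> niso (comp_functor F K) (comp_functor G K).
Proof.
case=> t [ti tn]; exists (fun X => t (K X)); split=> [X|X Y a] /=.
  exact: ti.
exact: tn.
Qed.

Lemma niso_assoc (D E H L : category) (F : functor H L) (G : functor E H)
  (K : functor D E) :
  niso (comp_functor F (comp_functor G K)) (comp_functor (comp_functor F G) K).
Proof. exact: (niso_refl (comp_functor F (comp_functor G K))). Qed.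

(** The left and the right inverse may be given by different functors: R is
    isomorphic to LFR, hence to L. This avoids comparing the two functors
    obtained from one round trip by undoing a shift before or after it. *)
Lemma equivalence_of_inverses (D E : category) (F : functor D E)
  (L R : functor E D) :
  niso (comp_functor L F) (id_functor D) ->
  niso (comp_functor F R) (id_functor E) -> is_equivalence F.
Proof.
move=> LF FR; exists R; split=> //.
have LR : niso R L.
  apply: (@niso_trans _ _ _ (comp_functor (comp_functor L F) R)).
    exact: niso_sym (niso_compr R LF).
  exact: (niso_compl L FR).
exact: niso_trans (niso_compr F LR) LF.
Qed.

Lemma is_equivalence_comp (D E H : category) (F' : functor E H) (F : functor D E) :
  is_equivalence F' -> is_equivalence F -> is_equivalence (comp_functor F' F).
Proof.
move=> [G' [g1 g2]] [G [h1 h2]]; exists (comp_functor G G'); split.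
  apply: niso_trans h1.
  exact: (niso_compl G (niso_compr F g1)).
apply: niso_trans g2.
exact: (niso_compl F' (niso_compr G' h2)).
Qed.

Lemma niso_faithful (D E : category) (F : functor D E) (G : functor E D) (X Y : D)
  (a b : chom X Y) :
  niso (comp_functor G F) (id_functor D) -> fmap F a ≡ fmap F b -> a ≡ b.
Proof.
case=> t [ti tn] e.
have [s [_ ts]] := ti X.
suff h c : c ≡ (t Y ⊚ fmap G (fmap F c)) ⊚ s.
  apply: heq_trans (h a) _; apply: heq_trans _ (heq_sym (h b)).
  by apply: compc_congl; apply: compc_congrr; apply: fmap_congr.
apply: heq_sym; apply: heq_trans (compc_congl _ (tn _ _ c)) _.
apply: heq_trans (compcAr _ _ _) _.
by apply: heq_trans (compc_congrr _ ts) (compc1 _).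
Qed.

End CategoryCalculus.

(** * Functors of complexes on derived categories *)

Section DerivedFunctors.
Variables C D : preadditive.

(** Preserving quasi-isomorphisms is what lets a functor of complexes act on
    their formal inverses, so that no resolution is needed to derive it. *)
Record cpx_functor := CpxFunctor {
  cfobj :> cpx C -> cpx D;
  cfmap : forall X Y, cmap X Y -> cmap (cfobj X) (cfobj Y);
  cfmap_congr : forall X Y (f g : cmap X Y),
    (forall n, f n = g n) -> forall n, cfmap f n = cfmap g n;
  cfmap_id : forall X n, cfmap (cid X) n = idm (cfobj X n);
  cfmap_comp : forall X Y Z (g : cmap Y Z) (f : cmap X Y) n,
    cfmap (ccomp g f) n = cfmap g n ∘ cfmap f n;
  cfmap_qis : forall X Y (f : cmap X Y), is_qis f -> is_qis (cfmap f) }.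

Variable F : cpx_functor.

Fixpoint lift_map X Y (a : @dhom C X Y) : @dhom D (F X) (F Y) :=
  match a with
  | DMap _ _ f => DMap (cfmap F f)
  | DInv _ _ q qP => DInv (cfmap_qis (c:=F) qP)
  | DComp _ _ _ b a => DComp (lift_map b) (lift_map a)
  end.

Fact lift_id X : deq (lift_map (DMap (cid X))) (DMap (cid (F X))).
Proof. by apply: deq_map => n; rewrite cfmap_id. Qed.

Lemma lift_map_congr X Y (a b : @dhom C X Y) :
  deq a b -> deq (lift_map a) (lift_map b).
Proof.
elim=> {X Y a b} /=.
- by move=> *; apply: deq_refl.
- by move=> *; apply: deq_sym.
- by move=> X Y a b c _ ab _ bc; apply: deq_trans ab bc.
- by move=> *; apply: deq_congr.
- by move=> *; apply: deq_assoc.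
- move=> X Y a; apply: deq_trans (deq_idl _).
  exact: deq_congr (lift_id _) (deq_refl _).
- move=> X Y a; apply: deq_trans (deq_idr _).
  exact: deq_congr (deq_refl _) (lift_id _).
- by move=> X Y f f' e; apply: deq_map; apply: cfmap_congr.
- move=> X Y Z g f; apply: deq_trans (deq_comp _ _) _; apply: deq_map => n.
  by rewrite cfmap_comp.
- by move=> X Y q qP; apply: deq_trans (deq_invl _) (deq_sym (lift_id _)).
- by move=> X Y q qP; apply: deq_trans (deq_invr _) (deq_sym (lift_id _)).
Qed.

Definition lift : functor (derived_cat C) (derived_cat D) :=
  @Functor (derived_cat C) (derived_cat D) F lift_map lift_map_congr
    lift_id
    (fun _ _ _ b a => deq_refl (DComp (lift_map b) (lift_map a))).

End DerivedFunctors.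

Section Naturality.
Variable C : preadditive.

Lemma qis_iso (X Y : derived_cat C) (q : cmap X Y) (qP : is_qis q) :
  is_iso (DMap q : @chom (derived_cat C) X Y).
Proof. by exists (DInv qP); split; [apply: deq_invl|apply: deq_invr]. Qed.

Lemma cmap_iso (X Y : derived_cat C) (f : cmap X Y) (g : cmap Y X) :
  (forall n, g n ∘ f n = idm (X n)) -> (forall n, f n ∘ g n = idm (Y n)) ->
  is_iso (DMap f : @chom (derived_cat C) X Y).
Proof.
by move=> gf fg; exists (DMap g); split; apply: deq_trans (deq_comp _ _) _;
  apply: deq_map.
Qed.

(** Every morphism of the derived category is a composite of chain maps and
    inverses of such, so naturality need only be checked on chain maps. *)
Lemma derived_naturality (E : category) (F G : functor (derived_cat C) E)
  (t : forall X, chom (F X) (G X)) :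
  (forall X Y (f : cmap X Y), t Y ⊚ fmap F (DMap f : @chom (derived_cat C) X Y)
     ≡ fmap G (DMap f : @chom (derived_cat C) X Y) ⊚ t X) ->
  forall X Y (a : @chom (derived_cat C) X Y), t Y ⊚ fmap F a ≡ fmap G a ⊚ t X.
Proof.
move=> tn X Y; elim=> {X Y} [X Y f|X Y q qP|X Y Z b IHb a IHa]; first exact: tn.
  pose i := DMap q : @chom (derived_cat C) X Y.
  pose j := DInv qP : @chom (derived_cat C) Y X.
  have ji : j ⊚ i ≡ idc (X : derived_cat C) := deq_invl qP.
  have ij : i ⊚ j ≡ idc (Y : derived_cat C) := deq_invr qP.
  apply: heq_sym; apply: (@iso_square _ _ _ _ _ (fmap F i) (fmap G i)).
  - apply: heq_trans (heq_sym (fmap_comp F _ _)) _.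
    exact: heq_trans (fmap_congr F ij) (fmap_id F _).
  - apply: heq_trans (heq_sym (fmap_comp G _ _)) _.
    exact: heq_trans (fmap_congr G ji) (fmap_id G _).
  - exact: heq_sym (tn _ _ q).
pose a' := a : @chom (derived_cat C) X Y; pose b' := b : @chom (derived_cat C) Y Z.
apply: heq_trans (compc_congrr _ (fmap_comp F b' a')) _.
apply: heq_trans (compcA _ _ _) _.
apply: heq_trans (compc_congl _ IHb) _.
apply: heq_trans (compcAr _ _ _) _.
apply: heq_trans (compc_congrr _ IHa) _.
apply: heq_trans (compcA _ _ _) _.
exact: compc_congl (heq_sym (fmap_comp G b' a')).
Qed.

Lemma niso_derived (E : category) (F G : functor (derived_cat C) E)
  (t : forall X, chom (F X) (G X)) : (forall X, is_iso (t X)) ->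
  (forall X Y (f : cmap X Y), t Y ⊚ fmap F (DMap f : @chom (derived_cat C) X Y)
     ≡ fmap G (DMap f : @chom (derived_cat C) X Y) ⊚ t X) -> niso F G.
Proof. by move=> ti tn; exists t; split=> //; apply: derived_naturality. Qed.

End Naturality.

Section Triangles.

Lemma derived_distinguished_congr (C : preadditive) (X Y Z : Db C) (u : chom X Y)
  (v : chom Y Z) (w w' : chom Z (shift X)) :
  w ≡ w' -> distinguished u v w -> distinguished u v w'.
Proof.
move=> e [X' [Y' [K [f [i [p [fip [a [b [c [abc [e1 e2 e3]]]]]]]]]]]].
exists X', Y', K, f, i, p; split=> //; exists a, b, c; split=> //; split=> //.
exact: heq_trans e3 (compc_congl c e).
Qed.

Lemma triangle_equivalent_trans (C D E : preadditive) :
  triangle_equivalent (Db C) (Db D) -> triangle_equivalent (Db D) (Db E) ->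
  triangle_equivalent (Db C) (Db E).
Proof.
move=> [F [eF [t [[ti tn] tF]]]] [G [eG [s [[si sn] sG]]]].
exists (comp_functor G F); split; first exact: is_equivalence_comp.
exists (fun X => s (F X) ⊚ fmap G (t X)); split; first split.
- by move=> X; apply: is_iso_comp (si _) (is_iso_fmap G (ti X)).
- move=> X Y a.
  change ((s (F Y) ⊚ fmap G (t Y)) ⊚ fmap G (fmap F (fmap shift a))
    ≡ fmap shift (fmap G (fmap F a)) ⊚ (s (F X) ⊚ fmap G (t X))).
  apply: heq_trans (compcAr _ _ _) _.
  apply: heq_trans (compc_congrr _ (heq_sym (fmap_comp G _ _))) _.
  apply: heq_trans (compc_congrr _ (fmap_congr G (tn _ _ a))) _.
  apply: heq_trans (compc_congrr _ (fmap_comp G _ _)) _.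
  apply: heq_trans (compcA _ _ _) _.
  apply: heq_trans (compc_congl _ (sn _ _ (fmap F a))) _.
  exact: compcAr.
move=> X Y Z u v w uvw.
apply: derived_distinguished_congr (sG _ _ _ _ _ _ (tF _ _ _ _ _ _ uvw)).
apply: heq_trans (compc_congrr _ (fmap_comp G _ _)) _.
exact: compcA.
Qed.

(** Distinguished triangles are by definition isomorphic to those of cones, so
    only cones have to be followed. *)
Lemma lift_triangle (C D : preadditive) (F : cpx_functor C D)
  (t : forall X, cmap (F (cshift X)) (cshift (F X)))
  (t' : forall X, cmap (cshift (F X)) (F (cshift X))) :
  (forall X n, t' X n ∘ t X n = idm _) -> (forall X n, t X n ∘ t' X n = idm _) ->
  (forall X Y (f : cmap X Y) n,
     t Y n ∘ cfmap F (cshift_map f) n = cshift_map (cfmap F f) n ∘ t X n) ->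
  (forall X Y K (f : cmap X Y) (i : cmap Y K) (p : cmap K (cshift X)),
     is_cone f i p ->
     is_cone (cfmap F f) (cfmap F i) (ccomp (t X) (cfmap F p))) ->
  @is_triangle_functor (Db C) (Db D) (lift F).
Proof.
move=> t't tt' tn Fcone.
pose T X := DMap (t X) : @chom (Db D) (lift F (cshift X)) (cshift (F X)).
have Tn X Y (a : @chom (Db C) X Y) :
    T Y ⊚ fmap (lift F) (fmap (derived_shift C) a)
    ≡ fmap (derived_shift D) (fmap (lift F) a) ⊚ T X.
  apply: (@derived_naturality C (Db D) (comp_functor (lift F) (derived_shift C))
    (comp_functor (derived_shift D) (lift F)) T) => X' Y' f.
  apply: deq_trans (deq_comp _ _) _; apply: deq_sym.
  apply: deq_trans (deq_comp _ _) _; apply: deq_map => n /=.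
  exact: esym (tn _ _ f n).
exists T; split.
  by split=> // X; apply: (cmap_iso (g := t' X)).
move=> X Y Z u v w [X' [Y' [K [f [i [p [fip [a [b [c [[ai bi ci] [e1 e2 e3]]]]]]]]]]]].
exists (F X'), (F Y'), (F K), (cfmap F f), (cfmap F i), (ccomp (t X') (cfmap F p)).
split; first exact: Fcone.
exists (fmap (lift F) a), (fmap (lift F) b), (fmap (lift F) c).
split; first by split; apply: is_iso_fmap.
split.
- exact: (lift_map_congr F e1).
- exact: (lift_map_congr F e2).
apply: (heq_trans (b := fmap (derived_shift D) (fmap (lift F) a) ⊚
    (T X' ⊚ (DMap (cfmap F p) : @chom (Db D) (F K) (F (cshift X')))))).
  by apply: compc_congrr; apply: deq_sym; apply: deq_comp.
apply: heq_trans (compcA _ _ _) _.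
apply: heq_trans (compc_congl _ (heq_sym (Tn _ _ a))) _.
apply: heq_trans (compcAr _ _ _) _.
apply: (heq_trans (b := T X ⊚ (fmap (lift F) w ⊚ fmap (lift F) c))).
  by apply: compc_congrr; exact: (lift_map_congr F e3).
exact: compcA.
Qed.

End Triangles.

(** * The inverse of the shift *)

Section Unshift.
Variable C : preadditive.
Implicit Types X Y : cpx C.

(** The degrees n - 1 + 1, n + 1 - 1 and n are equal but not convertible, so the
    inverse of the shift needs differentials between any two consecutive degrees
    and identity maps between equal ones. *)
Definition diff_to X (a b : int) (e : a + 1 = b) : hom (X a) (X b) :=
  let: erefl := e in cdiff X a.
Definition icast X (a b : int) (e : a = b) : hom (X a) (X b) :=
  let: erefl := e in idm (X a).

Lemma diff_to2 X (a b c : int) (e : a + 1 = b) (e' : b + 1 = c) :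
  diff_to X e' ∘ diff_to X e = 0.
Proof. by case: b / e e' => e'; case: c / e' => /=; apply: cdiff2. Qed.

Lemma cmap_diff_to X Y (f : cmap X Y) (a b : int) (e : a + 1 = b) :
  f b ∘ diff_to X e = diff_to Y e ∘ f a.
Proof. by case: b / e; apply: cfunP. Qed.

Lemma icastK X (a b : int) (e : a = b) (e' : b = a) :
  icast X e' ∘ icast X e = idm (X a).
Proof. by case: b / e e' => e'; rewrite (eq_irrelevance e' erefl) /= comp1m. Qed.

Lemma icast_nat X Y (f : forall n, hom (X n) (Y n)) (a b : int) (e : a = b) :
  icast Y e ∘ f a = f b ∘ icast X e.
Proof. by case: b / e => /=; rewrite comp1m compm1. Qed.

Lemma icast_diff X (a b a' b' : int) (e : a + 1 = b) (e' : a' + 1 = b')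
  (ea : a = a') (eb : b = b') :
  icast X eb ∘ diff_to X e = diff_to X e' ∘ icast X ea.
Proof.
case: a' / ea e' => e'; case: b / e eb => eb; case: b' / e' eb => eb.
by rewrite (eq_irrelevance eb erefl) /= comp1m compm1.
Qed.

Lemma diff_to_shift X (a b : int) (e : a + 1 = b) (e' : a + 1 + 1 = b + 1) :
  diff_to (cshift X) e = - diff_to X e'.
Proof. by case: b / e e' => e'; rewrite (eq_irrelevance e' erefl). Qed.

Fact unshift_deg (n : int) : n - 1 + 1 = n + 1 - 1.
Proof. by rewrite addrAC. Qed.

Fact unshift_diff2 X n :
  (- diff_to X (unshift_deg (n + 1))) ∘ (- diff_to X (unshift_deg n)) = 0.
Proof. by rewrite compNl compNr opprK diff_to2. Qed.

Fact unshift_bound X :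
  exists N : nat, forall n : int, (N < `|n|)%N -> is_zero (X (n - 1)).
Proof. by have [N hN] := cbound X; exists N.+1 => n hn; apply: hN; lia. Qed.

Definition cunshift X : cpx C :=
  @Cpx C (fun n => X (n - 1)) (fun n => - diff_to X (unshift_deg n))
    (unshift_diff2 X) (unshift_bound X).

Fact cunshift_map_subproof X Y (f : cmap X Y) n :
  f (n + 1 - 1) ∘ cdiff (cunshift X) n = cdiff (cunshift Y) n ∘ f (n - 1).
Proof. by rewrite /= compNl compNr cmap_diff_to. Qed.
Definition cunshift_map X Y (f : cmap X Y) : cmap (cunshift X) (cunshift Y) :=
  @CMap C (cunshift X) (cunshift Y) (fun n => f (n - 1)) (cunshift_map_subproof f).

(** is_qis speaks of the degrees n, n + 1 and n + 1 + 1 literally, whereas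
    unshifting produces other expressions for three consecutive degrees. *)
Lemma is_qis_deg X Y (f : cmap X Y) : is_qis f ->
  forall (a b c : int) (e : a + 1 = b) (e' : b + 1 = c) (Z H Z' H' : C)
    (z : hom Z (X b)) (h : hom Z H) (z' : hom Z' (Y b)) (h' : hom Z' H'),
  is_kernel (diff_to X e') z ->
  (exists u, z ∘ u = diff_to X e /\ is_cokernel u h) ->
  is_kernel (diff_to Y e') z' ->
  (exists u, z' ∘ u = diff_to Y e /\ is_cokernel u h') ->
  forall (g : hom Z Z') (k : hom H H'),
    z' ∘ g = f b ∘ z -> k ∘ h = h' ∘ g -> is_isom k.
Proof.
move=> qf a b c e; case: b / e => e'; case: c / e' => Z H Z' H' z h z' h' /=.
move=> kz cz kz' cz' g k; exact: (qf a Z H Z' H' z h z' h').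
Qed.

Lemma is_qis_unshift X Y (f : cmap X Y) : is_qis f -> is_qis (cunshift_map f).
Proof.
move=> qf n Z H Z' H' z h z' h' [kz [u [zu ch]]] [kz' [u' [zu' ch']]] g k e1 e2.
apply: (is_qis_deg qf (e := unshift_deg n) (e' := unshift_deg (n + 1))
  (z := z) (h := h) (z' := z') (h' := h') _ _ _ _ (g := g)) => //.
- exact: is_kernelN.
- exists (- u); rewrite compNr zu opprK; split=> //; exact: is_cokernelN.
- exact: is_kernelN.
- exists (- u'); rewrite compNr zu' opprK; split=> //; exact: is_cokernelN.
Qed.

Definition unshift_cf : cpx_functor C C :=
  @CpxFunctor C C cunshift cunshift_map (fun _ _ _ _ e n => e (n - 1))
    (fun _ _ => erefl) (fun _ _ _ _ _ _ => erefl) is_qis_unshift.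

Definition derived_unshift : functor (derived_cat C) (derived_cat C) :=
  lift unshift_cf.

Fact shift_unshift_deg (n : int) : n + 1 - 1 = n. Proof. exact: addrK. Qed.
Fact unshift_shift_deg (n : int) : n - 1 + 1 = n. Proof. exact: subrK. Qed.

Fact shift_unshift_subproof X n :
  icast X (shift_unshift_deg (n + 1)) ∘ cdiff (cshift (cunshift X)) n
  = cdiff X n ∘ icast X (shift_unshift_deg n).
Proof. by rewrite /= opprK (icast_diff X _ erefl (shift_unshift_deg n)). Qed.
Definition shift_unshift_map X : cmap (cshift (cunshift X)) X :=
  @CMap C (cshift (cunshift X)) X (fun n => icast X (shift_unshift_deg n))
    (shift_unshift_subproof X).

Fact shift_unshift_inv_subproof X n :
  icast X (esym (shift_unshift_deg (n + 1))) ∘ cdiff X n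
  = cdiff (cshift (cunshift X)) n ∘ icast X (esym (shift_unshift_deg n)).
Proof.
by rewrite /= opprK -(icast_diff X erefl _ _ (esym (shift_unshift_deg (n + 1)))).
Qed.
Definition shift_unshift_inv X : cmap X (cshift (cunshift X)) :=
  @CMap C X (cshift (cunshift X)) (fun n => icast X (esym (shift_unshift_deg n)))
    (shift_unshift_inv_subproof X).

Fact unshift_shift_diff X (n : int) (e : n - 1 + 1 + 1 = n + 1 - 1 + 1) :
  cdiff (cunshift (cshift X)) n = diff_to X e.
Proof. by rewrite -[RHS]opprK -(diff_to_shift X (unshift_deg n)). Qed.

Fact unshift_shift_subproof X n :
  icast X (unshift_shift_deg (n + 1)) ∘ cdiff (cunshift (cshift X)) n
  = cdiff X n ∘ icast X (unshift_shift_deg n).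
Proof.
have e : n - 1 + 1 + 1 = n + 1 - 1 + 1 by rewrite unshift_deg.
rewrite (unshift_shift_diff _ e).
by rewrite (icast_diff X _ erefl (unshift_shift_deg n)).
Qed.
Definition unshift_shift_map X : cmap (cunshift (cshift X)) X :=
  @CMap C (cunshift (cshift X)) X (fun n => icast X (unshift_shift_deg n))
    (unshift_shift_subproof X).

Fact unshift_shift_inv_subproof X n :
  icast X (esym (unshift_shift_deg (n + 1))) ∘ cdiff X n
  = cdiff (cunshift (cshift X)) n ∘ icast X (esym (unshift_shift_deg n)).
Proof.
have e : n - 1 + 1 + 1 = n + 1 - 1 + 1 by rewrite unshift_deg.
rewrite (unshift_shift_diff _ e).
by rewrite -(icast_diff X erefl _ _ (esym (unshift_shift_deg (n + 1)))).
Qed.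
Definition unshift_shift_inv X : cmap X (cunshift (cshift X)) :=
  @CMap C X (cunshift (cshift X)) (fun n => icast X (esym (unshift_shift_deg n)))
    (unshift_shift_inv_subproof X).

Lemma niso_shift_unshift :
  niso (comp_functor (derived_shift C) derived_unshift) (id_functor (derived_cat C)).
Proof.
apply: (@niso_derived C (derived_cat C)
  (comp_functor (derived_shift C) derived_unshift) (id_functor (derived_cat C))
  (fun X => DMap (shift_unshift_map X))) => [X|X Y f].
  by apply: (cmap_iso (g := shift_unshift_inv X)) => n; exact: (icastK X).
apply: deq_trans (deq_comp _ _) _; apply: deq_sym.
apply: deq_trans (deq_comp _ _) _; apply: deq_map => n /=.
by rewrite icast_nat.
Qed.

Lemma niso_unshift_shift :
  niso (comp_functor derived_unshift (derived_shift C)) (id_functor (derived_cat C)).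
Proof.
apply: (@niso_derived C (derived_cat C)
  (comp_functor derived_unshift (derived_shift C)) (id_functor (derived_cat C))
  (fun X => DMap (unshift_shift_map X))) => [X|X Y f].
  by apply: (cmap_iso (g := unshift_shift_inv X)) => n; exact: (icastK X).
apply: deq_trans (deq_comp _ _) _; apply: deq_sym.
apply: deq_trans (deq_comp _ _) _; apply: deq_map => n /=.
by rewrite icast_nat.
Qed.

End Unshift.

(** A functor given by mapping cones is inverse to another such functor only up
    to a shift, because the triangle of a cone has to be rotated to recover its
    first vertex. Since the shift is invertible this is enough. *)
Lemma equivalence_up_to_shift (C D : preadditive) (F : cpx_functor C D)
  (G : cpx_functor D C) :
  niso (derived_shift C) (comp_functor (lift G) (lift F)) ->
  niso (comp_functor (lift F) (lift G)) (derived_shift D) ->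
  is_equivalence (lift F).
Proof.
move=> GF FG.
apply: (equivalence_of_inverses (L := comp_functor (derived_unshift C) (lift G))
  (R := comp_functor (lift G) (derived_unshift D))).
  apply: niso_trans (niso_unshift_shift C).
  apply: niso_trans (niso_sym (niso_assoc _ _ _)) _.
  exact: niso_compl (niso_sym GF).
apply: niso_trans (niso_shift_unshift D).
apply: niso_trans (niso_assoc _ _ _) _.
exact: niso_compr FG.
Qed.

(** * Representations of a shape *)

Lemma lin0 (k : fieldType) (V W : lmodType k) (f : V -> W) : linear f -> f 0 = 0.
Proof. by move=> fl; have := fl (-1) 0 0; rewrite !scaleN1r !addNr. Qed.

Definition mklin (k : fieldType) (V W : vectType k) (f : V -> W) (fl : linear f) :
    'Hom(V, W) :=
  let fL : {linear V -> W} := HB.pack f (GRing.isLinear.Build k V W _ f fl) in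
  linfun fL.

Lemma mklinE (k : fieldType) (V W : vectType k) (f : V -> W) (fl : linear f) x :
  mklin fl x = f x.
Proof. by rewrite /mklin lfunE. Qed.

(** A relation telling between which vertices there is a (then unique) nonzero
    path, up to a scalar. It is not assumed transitive: u below v below w and u
    not below w is a zero relation. *)
Record shape := Shape {
  vtx :> finType;
  below : rel vtx }.

Section Representations.
Variables (k : fieldType) (S : shape).
Notation "u ⊑ v" := (@below S u v) (at level 70).

(** Structure maps are given between all pairs of vertices, which avoids
    composing along paths. At a vertex not below itself rmap_id and rmap_out
    force the space to vanish; such a vertex serves as a zero object of
    indices, so that functors can be given by total maps of vertices. *)
Record rep := Rep {
  rspace :> S -> vectType k;
  rmap : forall u v, rspace u -> rspace v;
  rmap_linear : forall u v, linear (@rmap u v);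
  rmap_id : forall v x, @rmap v v x = x;
  rmap_out : forall u v x, ~~ (u ⊑ v) -> @rmap u v x = 0;
  rmap_comp : forall u v w x, u ⊑ v -> v ⊑ w -> @rmap v w (@rmap u v x) = @rmap u w x }.
Arguments rmap : clear implicits.

HB.instance Definition _ M u v :=
  GRing.isLinear.Build k (rspace M u) (rspace M v) _ (rmap M u v)
    (@rmap_linear M u v).

Lemma rmapM (M : rep) u v w (x : M u) :
  rmap M v w (rmap M u v x) = if (u ⊑ v) && (v ⊑ w) then rmap M u w x else 0.
Proof.
case: (boolP (u ⊑ v)) => [uv|/rmap_out->] /=; last by rewrite raddf0.
by case: (boolP (v ⊑ w)) => [vw|/rmap_out->] //; rewrite rmap_comp.
Qed.

Lemma rspace0 (M : rep) v (x : M v) : ~~ (v ⊑ v) -> x = 0.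
Proof. by move=> /rmap_out h; rewrite -[x]rmap_id h. Qed.

Record rep_hom (M N : rep) := RepHom {
  rfun :> forall v, M v -> N v;
  rfun_linear : forall v, linear (@rfun v);
  rfun_nat : forall u v x, @rfun v (rmap M u v x) = rmap N u v (@rfun u x) }.
Arguments rfun {M N} _ v _.

HB.instance Definition _ M N (f : rep_hom M N) v :=
  GRing.isLinear.Build k (rspace M v) (rspace N v) _ (rfun f v)
    (@rfun_linear M N f v).

Lemma rep_homP (M N : rep) (f g : rep_hom M N) :
  (forall v x, f v x = g v x) -> f = g.
Proof.
case: f g => [f fl fn] [g gl gn] /= e.
have {}e : f = g.
  by apply: functional_extensionality_dep => v; apply/funext => x.
by case: g / e gl gn => gl gn; congr RepHom; apply: Prop_irrelevance.
Qed.

HB.instance Definition _ M N := gen_eqMixin (rep_hom M N).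
HB.instance Definition _ M N := gen_choiceMixin (rep_hom M N).

Fact rep_zero_nat (M N : rep) u v (x : M u) :
  (fun _ => 0 : N v) (rmap M u v x) = rmap N u v 0.
Proof. by rewrite raddf0. Qed.
Fact rep_zero_linear (M N : rep) v : linear (fun _ : M v => 0 : N v).
Proof. by move=> a x y; rewrite scaler0 addr0. Qed.
Definition rep_zero M N : rep_hom M N :=
  @RepHom M N (fun v _ => 0) (@rep_zero_linear M N) (@rep_zero_nat M N).

Section HomGroup.
Variables M N : rep.
Implicit Types f g : rep_hom M N.

Fact rep_opp_linear f v : linear (fun x => - f v x).
Proof. by move=> a x y; rewrite linearP opprD scalerN. Qed.
Fact rep_opp_nat f u v x : - f v (rmap M u v x) = rmap N u v (- f u x).
Proof. by rewrite rfun_nat raddfN. Qed.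
Definition rep_opp f : rep_hom M N := RepHom (rep_opp_linear f) (rep_opp_nat f).

Fact rep_add_linear f g v : linear (fun x => f v x + g v x).
Proof. by move=> a x y; rewrite !linearP scalerDr addrACA. Qed.
Fact rep_add_nat f g u v x :
  f v (rmap M u v x) + g v (rmap M u v x) = rmap N u v (f u x + g u x).
Proof. by rewrite !rfun_nat raddfD. Qed.
Definition rep_add f g : rep_hom M N :=
  RepHom (rep_add_linear f g) (rep_add_nat f g).

Fact rep_addA : associative rep_add.
Proof. by move=> f g h; apply: rep_homP => v x /=; rewrite addrA. Qed.
Fact rep_addC : commutative rep_add.
Proof. by move=> f g; apply: rep_homP => v x /=; rewrite addrC. Qed.
Fact rep_add0 : left_id (rep_zero M N) rep_add.
Proof. by move=> f; apply: rep_homP => v x /=; rewrite add0r. Qed.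
Fact rep_addN : left_inverse (rep_zero M N) rep_opp rep_add.
Proof. by move=> f; apply: rep_homP => v x /=; rewrite addNr. Qed.

HB.instance Definition _ := GRing.isZmodule.Build (rep_hom M N)
  rep_addA rep_addC rep_add0 rep_addN.
End HomGroup.

Fact rep_id_linear (M : rep) v : linear (fun x : M v => x).
Proof. by []. Qed.
Definition rep_id M : rep_hom M M :=
  @RepHom M M (fun _ x => x) (@rep_id_linear M) (fun _ _ _ => erefl).

Fact rep_comp_linear (M N P : rep) (g : rep_hom N P) (f : rep_hom M N) v :
  linear (fun x => g v (f v x)).
Proof. by move=> a x y; rewrite !linearP. Qed.
Fact rep_comp_nat (M N P : rep) (g : rep_hom N P) (f : rep_hom M N) u v x :
  g v (f v (rmap M u v x)) = rmap P u v (g u (f u x)).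
Proof. by rewrite !rfun_nat. Qed.
Definition rep_comp M N P (g : rep_hom N P) (f : rep_hom M N) : rep_hom M P :=
  RepHom (rep_comp_linear g f) (rep_comp_nat g f).

Fact rep_compDr M N P (g : rep_hom N P) (f f' : rep_hom M N) :
  rep_comp g (f + f') = rep_comp g f + rep_comp g f'.
Proof. by apply: rep_homP => v x /=; rewrite raddfD. Qed.

Fact rep_comp1m M N (f : rep_hom M N) : rep_comp (rep_id N) f = f.
Proof. exact: rep_homP. Qed.
Fact rep_compm1 M N (f : rep_hom M N) : rep_comp f (rep_id M) = f.
Proof. exact: rep_homP. Qed.
Fact rep_compA M N P Q (h : rep_hom P Q) (g : rep_hom N P) (f : rep_hom M N) :
  rep_comp h (rep_comp g f) = rep_comp (rep_comp h g) f.
Proof. exact: rep_homP. Qed.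
Fact rep_compDl M N P (g g' : rep_hom N P) (f : rep_hom M N) :
  rep_comp (g + g') f = rep_comp g f + rep_comp g' f.
Proof. exact: rep_homP. Qed.

Definition rep_cat : preadditive :=
  @Preadditive rep rep_hom rep_id rep_comp
    rep_comp1m rep_compm1 rep_compA rep_compDl rep_compDr.

End Representations.
Arguments rmap {k S} _ u v _.
Arguments rfun {k S M N} _ v _.


Section Additivity.
Variables (k : fieldType) (S : shape) (M N : rep k S).

Lemma rmap0 u v : rmap M u v 0 = 0. Proof. exact: raddf0. Qed.
Lemma rmapN u v x : rmap M u v (- x) = - rmap M u v x. Proof. exact: raddfN. Qed.
Lemma rmapD u v x y : rmap M u v (x + y) = rmap M u v x + rmap M u v y.
Proof. exact: raddfD. Qed.
Lemma rmapB u v x y : rmap M u v (x - y) = rmap M u v x - rmap M u v y.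
Proof. exact: raddfB. Qed.

Variable f : rep_hom M N.
Lemma rfun0 v : rfun f v 0 = 0. Proof. exact: raddf0. Qed.
Lemma rfunN v x : rfun f v (- x) = - rfun f v x. Proof. exact: raddfN. Qed.
Lemma rfunD v x y : rfun f v (x + y) = rfun f v x + rfun f v y.
Proof. exact: raddfD. Qed.
Lemma rfunB v x y : rfun f v (x - y) = rfun f v x - rfun f v y.
Proof. exact: raddfB. Qed.

End Additivity.

(** * Representations form an abelian category *)

Section RepAbelian.
Variables (k : fieldType) (S : shape).
Local Notation R := (rep_cat k S).
Implicit Types X Y Z W K : rep k S.

Lemma rep_ext (X Y : R) (f g : hom X Y) : f = g ->
  forall v x, rfun f v x = rfun g v x.
Proof. by move=> ->. Qed.
Arguments rep_ext {X Y f g} _ v x.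

Fact zero_rep_linear : forall u v : S, linear (fun _ : 'rV[k]_0 => 0 : 'rV[k]_0).
Proof. by move=> u v a x y; rewrite scaler0 addr0. Qed.
Definition zero_rep : rep k S.
Proof.
refine (@Rep k S (fun _ => 'rV[k]_0) (fun _ _ _ => 0) zero_rep_linear _ _ _);
  by move=> *; rewrite ?thinmx0.
Defined.

Lemma is_zero_repP (X : R) : is_zero X <-> forall v (x : rspace X v), x = 0.
Proof.
split=> [e v x|e]; first exact: (rep_ext e v x).
by apply: rep_homP => v x; rewrite [LHS]e [RHS]e.
Qed.

Lemma zero_rep_zero : @is_zero R zero_rep.
Proof. by apply/is_zero_repP => v x; exact: thinmx0. Qed.

Section Sum.
Variables X Y : rep k S.

Definition sum_map u v (x : X u * Y u) : X v * Y v :=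
  (rmap X u v x.1, rmap Y u v x.2).
Fact sum_linear u v : linear (@sum_map u v).
Proof. by move=> a x y; rewrite /sum_map !linearP. Qed.
Fact sum_id v x : @sum_map v v x = x.
Proof. by case: x => x y; rewrite /sum_map !rmap_id. Qed.
Fact sum_out u v x : ~~ below u v -> @sum_map u v x = 0.
Proof. by move=> h; rewrite /sum_map !rmap_out. Qed.
Fact sum_comp u v w x : below u v -> below v w ->
  @sum_map v w (@sum_map u v x) = @sum_map u w x.
Proof. by move=> h1 h2; rewrite /sum_map !rmap_comp. Qed.

Definition rep_sum : rep k S :=
  @Rep k S (fun v => (X v * Y v)%type) sum_map sum_linear sum_id sum_out sum_comp.

Fact rep_in1_linear v : linear (fun x : X v => (x, 0) : X v * Y v).
Proof.
move=> a x y; apply/eqP; rewrite -pair_eqE /=; apply/andP; split=> //=.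
by rewrite scaler0 addr0.
Qed.
Fact rep_in1_nat u v x : (rmap X u v x, 0) = rmap rep_sum u v (x, 0).
Proof. by rewrite /= /sum_map raddf0. Qed.
Definition rep_in1 : rep_hom X rep_sum := 
  @RepHom k S X rep_sum (fun v x => (x, 0)) rep_in1_linear rep_in1_nat.

Fact rep_in2_linear v : linear (fun y : Y v => (0, y) : X v * Y v).
Proof.
move=> a x y; apply/eqP; rewrite -pair_eqE /=; apply/andP; split=> //=.
by rewrite scaler0 addr0.
Qed.
Fact rep_in2_nat u v y : (0, rmap Y u v y) = rmap rep_sum u v (0, y).
Proof. by rewrite /= /sum_map raddf0. Qed.
Definition rep_in2 : rep_hom Y rep_sum := 
  @RepHom k S Y rep_sum (fun v y => (0, y)) rep_in2_linear rep_in2_nat.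

Fact rep_pr1_linear v : linear (fun x : X v * Y v => x.1). Proof. by []. Qed.
Definition rep_pr1 : rep_hom rep_sum X :=
  @RepHom k S rep_sum X (fun v x => x.1) rep_pr1_linear (fun _ _ _ => erefl).
Fact rep_pr2_linear v : linear (fun x : X v * Y v => x.2). Proof. by []. Qed.
Definition rep_pr2 : rep_hom rep_sum Y :=
  @RepHom k S rep_sum Y (fun v x => x.2) rep_pr2_linear (fun _ _ _ => erefl).

Lemma rep_sum_biproduct : @is_biproduct R X Y rep_sum rep_in1 rep_in2 rep_pr1 rep_pr2.
Proof.
split; try by apply: rep_homP.
by apply: rep_homP => v [x y] /=; congr pair; rewrite /= ?addr0 ?add0r.
Qed.
End Sum.

(** Linearity and naturality of a map defined by choice come for free when it is
    pinned down by an injective map, or as in rep_factor_surj by a surjective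
    one. *)
Lemma rep_factor_inj X Y W (f : rep_hom X Y) (u : rep_hom W Y) :
  (forall v x, f v x = 0 -> x = 0) ->
  (forall v w, exists x, u v w = f v x) ->
  exists g : rep_hom W X, forall v w, f v (g v w) = u v w.
Proof.
move=> finj uf.
pose g v w := sval (constructive_indefinite_description (uf v w)).
have gP v w : f v (g v w) = u v w.
  by rewrite /g; case: constructive_indefinite_description.
have inj v : injective (f v).
  by move=> x y e; apply/eqP; rewrite -subr_eq0; apply/eqP/finj; rewrite raddfB /= e subrr.
have gl v : linear (g v) by move=> a x y; apply: inj; rewrite gP !linearP /= !gP.
have gn v w x : g w (rmap W v w x) = rmap X v w (g v x).
  by apply: inj; rewrite gP !rfun_nat gP.
by exists (RepHom gl gn).
Qed.

Lemma rep_factor_surj X Y W (p : rep_hom X Y) (u : rep_hom X W) :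
  (forall v y, exists x, y = p v x) ->
  (forall v x, p v x = 0 -> u v x = 0) ->
  exists g : rep_hom Y W, forall v x, g v (p v x) = u v x.
Proof.
move=> psurj up.
pose s v y := sval (constructive_indefinite_description (psurj v y)).
have sP v y : p v (s v y) = y.
  by rewrite /s; case: constructive_indefinite_description.
have gP v x : u v (s v (p v x)) = u v x.
  apply/eqP; rewrite -subr_eq0 -raddfB; apply/eqP/up.
  by rewrite raddfB /= sP subrr.
have gl v : linear (fun y => u v (s v y)).
  by move=> a x y; rewrite -linearP -[RHS]gP linearP /= !sP.
have gn v w y : u w (s w (rmap Y v w y)) = rmap W v w (u v (s v y)).
  by rewrite -rfun_nat -[RHS]gP rfun_nat sP.
by exists (RepHom gl gn).
Qed.

Section SubQuotient.
Variables (X : rep k S) (U : forall v, {vspace X v}).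
Hypothesis stable : forall u v x, x \in U u -> rmap X u v x \in U v.

Lemma rep_sub : exists K (i : rep_hom K X),
  (forall v x, i v x = 0 -> x = 0) /\
  (forall v y, y \in U v <-> exists x, y = i v x).
Proof.
pose m u v (x : subvs_of (U u)) : subvs_of (U v) :=
  vsproj (U v) (rmap X u v (vsval x)).
have mE u v x : vsval (m u v x) = rmap X u v (vsval x).
  by rewrite /m vsprojK // stable // subvsP.
have ml u v : linear (m u v).
  by move=> a x y; apply: subvs_inj; rewrite mE !linearP /= !mE.
have m1 v x : m v v x = x by apply: subvs_inj; rewrite mE rmap_id.
have m0 u v x : ~~ below u v -> m u v x = 0.
  by move=> h; apply: subvs_inj; rewrite mE rmap_out // linear0.
have mM u v w x : below u v -> below v w -> m v w (m u v x) = m u w x.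
  by move=> h1 h2; apply: subvs_inj; rewrite !mE rmap_comp.
pose K := @Rep k S (fun v => subvs_of (U v)) m ml m1 m0 mM.
have il v : linear (fun x : K v => vsval x) by move=> a x y; rewrite linearP.
exists K, (@RepHom k S K X _ il mE); split=> v x.
  by move=> e; apply: subvs_inj; rewrite [LHS]e linear0.
split=> [xU|[y ->]]; last exact: subvsP.
by exists (vsproj (U v) x); rewrite /= vsprojK.
Qed.

(** The quotient is realized on the image of the projection along U. *)
Lemma rep_quotient : exists Q (p : rep_hom X Q),
  (forall v y, exists x, y = p v x) /\
  (forall v x, p v x = 0 <-> x \in U v).
Proof.
pose c v : 'End(X v) := (\1 - projv (U v))%VF.
have cE v x : c v x = x - projv (U v) x by rewrite /c add_lfunE opp_lfunE id_lfunE.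
have c0 v x : x \in U v -> c v x = 0 by move=> h; rewrite cE projv_id ?subrr.
have cU v x : x - c v x \in U v by rewrite cE opprB addrC subrK memv_proj.
pose q v (x : X v) : subvs_of (limg (c v)) := vsproj (limg (c v)) (c v x).
have qE v x : vsval (q v x) = c v x by rewrite /q vsprojK // memv_img // memvf.
pose m u v (x : subvs_of (limg (c u))) : subvs_of (limg (c v)) :=
  q v (rmap X u v (vsval x)).
have ql v : linear (q v) by move=> a x y; apply: subvs_inj; rewrite qE !linearP /= !qE.
have qU v x : x \in U v -> q v x = 0.
  by move=> h; apply: subvs_inj; rewrite qE c0 // linear0.
have qm u v x : q v (rmap X u v x) = m u v (q u x).
  apply: subvs_inj; rewrite /m !qE; apply/eqP; rewrite -subr_eq0 -!raddfB; apply/eqP.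
  by apply: c0; apply: stable; rewrite cU.
have qs v y : exists x, y = q v x.
  have /memv_imgP[x _ e] := subvsP y.
  by exists x; apply: subvs_inj; rewrite qE.
have ml u v : linear (m u v) by move=> a x y; rewrite /m linearP /= ql.
have m1 v x : m v v x = x by have [y ->] := qs v x; rewrite -qm rmap_id.
have m0 u v x : ~~ below u v -> m u v x = 0.
  by move=> h; have [y ->] := qs u x; rewrite -qm rmap_out // qU // mem0v.
have mM u v w x : below u v -> below v w -> m v w (m u v x) = m u w x.
  by move=> h1 h2; have [y ->] := qs u x; rewrite -!qm rmap_comp.
pose Q := @Rep k S (fun v => subvs_of (limg (c v))) m ml m1 m0 mM.
exists Q, (@RepHom k S X Q _ ql qm); split=> // v x; split; last exact: qU.
move=> e; have e0 : c v x = 0 by rewrite -qE [q v x]e linear0.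
by have := cU v x; rewrite e0 subr0.
Qed.
End SubQuotient.

Lemma elt_kernel (X Y K : R) (f : hom X Y) (i : hom K X) :
  (forall v x, rfun i v x = 0 -> x = 0) ->
  (forall v x, rfun f v x = 0 <-> exists y, x = rfun i v y) -> is_kernel f i.
Proof.
move=> inj im; split.
  by apply: rep_homP => v x; apply/im; exists x.
move=> W u fu.
have [|g gP] := rep_factor_inj (f := i) (u := u) inj.
  by move=> v w; apply/im; exact: (rep_ext fu).
exists g; split=> [|g' e]; first exact: rep_homP.
apply: rep_homP => v w; apply/eqP; rewrite -subr_eq0; apply/eqP/inj.
by rewrite raddfB /= gP -(rep_ext e) /= subrr.
Qed.

Lemma elt_cokernel (X Y Q : R) (f : hom X Y) (p : hom Y Q) :
  (forall v y, exists x, y = rfun p v x) ->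
  (forall v y, rfun p v y = 0 <-> exists x, y = rfun f v x) -> is_cokernel f p.
Proof.
move=> surj ker; split.
  by apply: rep_homP => v x; apply/ker; exists x.
move=> W u uf.
have [|g gP] := rep_factor_surj (p := p) (u := u) surj.
  by move=> v x /ker[y ->]; exact: (rep_ext uf).
exists g; split=> [|g' e]; first exact: rep_homP.
apply: rep_homP => v y; have [x ->] := surj v y.
by rewrite gP -(rep_ext e).
Qed.

Lemma rep_kernel (X Y : R) (f : hom X Y) : exists (K : R) (i : hom K X),
  (forall v x, rfun i v x = 0 -> x = 0) /\
  (forall v x, rfun f v x = 0 <-> exists y, x = rfun i v y).
Proof.
pose U v := lker (linfun (rfun f v)).
have UE v x : (x \in U v) = (rfun f v x == 0) by rewrite memv_ker lfunE.
have [|K [i [i1 i2]]] := @rep_sub X U.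
  by move=> u v x; rewrite !UE rfun_nat => /eqP ->; rewrite raddf0.
exists K, i; split=> // v x; rewrite -i2 UE; split=> [->//|/eqP//].
Qed.

Lemma rep_cokernel (X Y : R) (f : hom X Y) : exists (Q : R) (p : hom Y Q),
  (forall v y, exists x, y = rfun p v x) /\
  (forall v y, rfun p v y = 0 <-> exists x, y = rfun f v x).
Proof.
pose U v := limg (linfun (rfun f v)).
have UE v y : y \in U v <-> exists x, y = rfun f v x.
  split=> [/memv_imgP[x _ ->]|[x ->]]; first by exists x; rewrite lfunE.
  by rewrite -[rfun f v x](lfunE (rfun f v)) memv_img // memvf.
have [|Q [p [p1 p2]]] := @rep_quotient Y U.
  by move=> u v x /UE[y ->]; apply/UE; exists (rmap X u v y); rewrite rfun_nat.
by exists Q, p; split=> // v y; rewrite p2.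
Qed.

Lemma rep_mono (X Y : R) (f : hom X Y) : is_mono f -> forall v x, rfun f v x = 0 -> x = 0.
Proof.
move=> fm v x fx; have [K [i [i1 i2]]] := rep_kernel f.
have /i2[y ->] := fx.
have e : i = 0.
  apply: fm; rewrite compm0; apply: rep_homP => w z; apply/i2; by exists z.
by rewrite e.
Qed.

Lemma rep_epi (X Y : R) (f : hom X Y) : is_epi f -> forall v y, exists x, y = rfun f v x.
Proof.
move=> fe v y; have [Q [p [p1 p2]]] := rep_cokernel f.
apply/p2; have -> : p = 0; last by [].
by apply: fe; rewrite comp0m; apply: rep_homP => w z; apply/p2; exists z.
Qed.

Lemma rep_abelian : is_abelian R.
Proof.
split.
- by exists zero_rep; apply: zero_rep_zero.
- move=> X Y; exists (rep_sum X Y), (rep_in1 X Y), (rep_in2 X Y), (rep_pr1 X Y),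
    (rep_pr2 X Y); exact: rep_sum_biproduct.
- move=> X Y f; have [K [i [i1 i2]]] := rep_kernel f.
  by exists K, i; apply: elt_kernel.
- move=> X Y f; have [Q [p [p1 p2]]] := rep_cokernel f.
  by exists Q, p; apply: elt_cokernel.
- move=> X Y f /rep_mono fm; have [Q [p [p1 p2]]] := rep_cokernel f.
  by exists Q, p; apply: elt_kernel.
- move=> X Y f /rep_epi fe; have [K [i [i1 i2]]] := rep_kernel f.
  by exists K, i; apply: elt_cokernel.
Qed.

(** A categorical kernel is compared with the one made of elements, to which it
    is isomorphic. *)
Lemma kernel_elt (X Y K : R) (f : hom X Y) (i : hom K X) : is_kernel f i ->
  (forall v x, rfun i v x = 0 -> x = 0) /\
  (forall v x, rfun f v x = 0 <-> exists y, x = rfun i v y).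
Proof.
move=> [fi ui]; split=> [v x|v x].
  apply: rep_mono => W a b e.
  have [|c [_ cu]] := ui W (i ∘ a); first by rewrite Defs.compA fi comp0m.
  by rewrite -(cu a) // -(cu b).
split=> [fx|[y ->]]; last exact: (rep_ext fi).
have [K' [i' [i1 i2]]] := rep_kernel f.
have [|c [ce _]] := ui K' i'; first by apply: rep_homP => w z; apply/i2; exists z.
have /i2[y ->] := fx; exists (rfun c v y); by rewrite -ce.
Qed.

Lemma cokernel_elt (X Y Q : R) (f : hom X Y) (p : hom Y Q) : is_cokernel f p ->
  (forall v y, exists x, y = rfun p v x) /\
  (forall v y, rfun p v y = 0 <-> exists x, y = rfun f v x).
Proof.
move=> [pf up]; split=> [v x|v y].
  apply: rep_epi => W a b e.
  have [|c [_ cu]] := up W (a ∘ p); first by rewrite -Defs.compA pf compm0.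
  by rewrite -(cu a) // -(cu b).
split=> [py|[x ->]]; last exact: (rep_ext pf).
have [Q' [p' [p1 p2]]] := rep_cokernel f.
have [|c [ce _]] := up Q' p'; first by apply: rep_homP => w z; apply/p2; exists z.
by apply/p2; rewrite -ce /= py raddf0.
Qed.

Lemma rep_isom (X Y : R) (f : hom X Y) :
  (forall v x, rfun f v x = 0 -> x = 0) -> (forall v y, exists x, y = rfun f v x) ->
  is_isom f.
Proof.
move=> inj surj.
have [|g gP] := rep_factor_inj (f := f) (u := rep_id Y) inj.
  by move=> v w; have [x e] := surj v w; exists x.
exists g; split; last exact: rep_homP.
apply: rep_homP => v x; apply/eqP; rewrite -subr_eq0; apply/eqP/inj.
by rewrite raddfB /= gP subrr.
Qed.

(** The two clauses are injectivity and surjectivity of the map on cohomology in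
    degree n + 1, at the vertex v. *)
Definition elt_qis (X Y : cpx R) (f : cmap X Y) : Prop :=
  forall n (v : S),
    (forall x : rspace (X (n + 1)) v, rfun (cdiff X (n + 1)) v x = 0 ->
       (exists y, rfun (f (n + 1)) v x = rfun (cdiff Y n) v y) ->
       exists x', x = rfun (cdiff X n) v x') /\
    (forall y : rspace (Y (n + 1)) v, rfun (cdiff Y (n + 1)) v y = 0 ->
       exists x y', rfun (cdiff X (n + 1)) v x = 0 /\
         y = rfun (f (n + 1)) v x + rfun (cdiff Y n) v y').

Lemma cohomology_exists (X : cpx R) n : exists (Z H : R) (z : hom Z (X (n + 1)))
  (h : hom Z H), is_cohomology z h.
Proof.
have [Z [z [z1 z2]]] := rep_kernel (cdiff X (n + 1)).
have zk : is_kernel (cdiff X (n + 1)) z by apply: elt_kernel.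
have [b [be _]] := zk.2 _ _ (cdiff2 X n).
have [H [h [h1 h2]]] := rep_cokernel b.
by exists Z, H, z, h; split=> //; exists b; split=> //; apply: elt_cokernel.
Qed.

Lemma cohomology_elt (X : cpx R) n (Z H : R) (z : hom Z (X (n + 1))) (h : hom Z H) :
  is_cohomology z h ->
  [/\ (forall v x, rfun (cdiff X (n + 1)) v x = 0 <-> exists y, x = rfun z v y),
    (forall v c, exists y, c = rfun h v y) &
    (forall v y, rfun h v y = 0 <-> exists x, rfun z v y = rfun (cdiff X n) v x)].
Proof.
move=> [/kernel_elt[z1 z2] [b [zb /cokernel_elt[h1 h2]]]]; split=> // v y.
rewrite h2; split=> [[x ->]|[x e]]; first by exists x; rewrite -zb.
exists x; apply/eqP; rewrite -subr_eq0; apply/eqP/z1.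
by rewrite raddfB /= e -zb subrr.
Qed.

Lemma elt_qis_is_qis (X Y : cpx R) (f : cmap X Y) : elt_qis f -> is_qis f.
Proof.
move=> ef n Z H Z' H' z h z' h' cx cy g e zg eh.
have [z1 h1 h2] := cohomology_elt cx; have [z1' h1' h2'] := cohomology_elt cy.
have zgE v y : rfun z' v (rfun g v y) = rfun (f (n + 1)) v (rfun z v y).
  exact: rep_ext zg v y.
have ehE v y : rfun e v (rfun h v y) = rfun h' v (rfun g v y).
  exact: rep_ext eh v y.
apply: rep_isom => v c.
  have [y ->] := h1 v c => ey.
  apply/h2; apply: (ef n v).1; first by apply/z1; exists y.
  have /h2'[x e'] : rfun h' v (rfun g v y) = 0 by rewrite -ehE.
  by exists x; rewrite -e' zgE.
have [y ->] := h1' v c.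
have [|x [y' [dx ey]]] := (ef n v).2 (rfun z' v y); first by apply/z1'; exists y.
have /z1[w ew] := dx; exists (rfun h v w).
rewrite ehE; apply/eqP; rewrite -subr_eq0 -raddfB; apply/eqP/h2'; exists y'.
by rewrite raddfB /= ey zgE -ew addrAC subrr add0r.
Qed.

Lemma is_qis_elt_qis (X Y : cpx R) (f : cmap X Y) : is_qis f -> elt_qis f.
Proof.
move=> qf n v.
have [Z [H [z [h cx]]]] := cohomology_exists X n.
have [Z' [H' [z' [h' cy]]]] := cohomology_exists Y n.
have [z1 h1 h2] := cohomology_elt cx; have [z1' h1' h2'] := cohomology_elt cy.
have [kz [b [zb cb]]] := cx; have [kz' [b' [zb' cb']]] := cy.
have [g [zg _]] : exists! g, z' ∘ g = f (n + 1) ∘ z.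
  by apply: kz'.2; rewrite Defs.compA -cfunP -Defs.compA kz.1 compm0.
have zgE w y : rfun z' w (rfun g w y) = rfun (f (n + 1)) w (rfun z w y).
  exact: rep_ext zg w y.
have zbE w y : rfun z w (rfun b w y) = rfun (cdiff X n) w y.
  exact: rep_ext zb w y.
have [e [eh _]] : exists! e, e ∘ h = h' ∘ g.
  apply: cb.2; apply: rep_homP => w x; apply/h2'; exists (rfun (f n) w x).
  rewrite zgE zbE; exact: (rep_ext (cfunP f n) w x).
have ehE w y : rfun e w (rfun h w y) = rfun h' w (rfun g w y).
  exact: rep_ext eh w y.
have [e' [e'e ee']] := qf n Z H Z' H' z h z' h' cx cy g e zg eh.
have e'eE w c : rfun e' w (rfun e w c) = c by exact: rep_ext e'e w c.
have ee'E w c : rfun e w (rfun e' w c) = c by exact: rep_ext ee' w c.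
split=> [x dx [y fx]|y dy].
  have /z1[c ec] := dx; rewrite ec; apply/h2.
  rewrite -[LHS]e'eE ehE.
  have -> : rfun h' v (rfun g v c) = 0; last exact: raddf0.
  by apply/h2'; exists y; rewrite -fx ec zgE.
have /z1'[c ec] := dy; have [w ew] := h1 v (rfun e' v (rfun h' v c)).
have /h2'[x ex] : rfun h' v (c - rfun g v w) = 0.
  by rewrite raddfB /= -ehE -ew ee'E subrr.
exists (rfun z v w), x; split; first by apply/z1; exists w.
by rewrite -ex raddfB /= zgE ec [RHS]addrC subrK.
Qed.

End RepAbelian.
Arguments rep_ext {k S X Y f g} _ v x.

(** * Cone functors *)

Section ComplexElements.
Variables (k : fieldType) (S : shape).
Local Notation R := (rep_cat k S).

Lemma cdiff2E (X : cpx R) n v (x : rspace (X n) v) :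
  rfun (cdiff X (n + 1)) v (rfun (cdiff X n) v x) = 0.
Proof. exact: (rep_ext (cdiff2 X n) v x). Qed.

Lemma cfunE (X Y : cpx R) (f : cmap X Y) n v (x : rspace (X n) v) :
  rfun (f (n + 1)) v (rfun (cdiff X n) v x) = rfun (cdiff Y n) v (rfun (f n) v x).
Proof. exact: (rep_ext (cfunP f n) v x). Qed.

End ComplexElements.

Section Pullback.
Variables (k : fieldType) (S S' : shape) (s : S' -> S).

(** These conditions make the spaces M (s v), with the structure maps of M cut
    down to the relation of S', a representation of S' for every M. They only
    concern vertices, and so does everything below that makes two cone functors
    mutually inverse. *)
Record pullable : Prop := Pullable {
  pullable_id : forall v, below (s v) (s v) -> below v v;
  pullable_comp : forall u v w, below u v -> below v w -> below (s u) (s w) ->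
    below (s u) (s v) && below (s v) (s w) = below u w }.

Hypothesis s_ok : pullable.

Definition pull_map (M : rep k S) (u v : S') (x : M (s u)) : M (s v) :=
  if below u v then rmap M (s u) (s v) x else 0.

Fact pull_linear M u v : linear (@pull_map M u v).
Proof.
move=> a x y; rewrite /pull_map; case: ifP => _; first by rewrite linearP.
by rewrite scaler0 addr0.
Qed.
Fact pull_id M v x : @pull_map M v v x = x.
Proof.
rewrite /pull_map; case: ifPn => [_|h]; first exact: rmap_id.
by apply/esym/rspace0; apply: contra h; apply: pullable_id.
Qed.
Fact pull_out M u v x : ~~ below u v -> @pull_map M u v x = 0.
Proof. by rewrite /pull_map => /negPf ->. Qed.
Fact pull_comp M u v w x : below u v -> below v w ->
  @pull_map M v w (@pull_map M u v x) = @pull_map M u w x.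
Proof.
move=> uv vw; rewrite /pull_map uv vw rmapM.
case: (boolP (below (s u) (s w))) => [h|/rmap_out->]; last by rewrite !if_same.
by rewrite pullable_comp.
Qed.

Definition pull (M : rep k S) : rep k S' :=
  @Rep k S' (fun v => M (s v)) (@pull_map M) (@pull_linear M) (@pull_id M)
    (@pull_out M) (@pull_comp M).

End Pullback.

(** A composite of structure maps is the structure map between its ends or
    zero, so an equality of composites amounts to an equality of booleans. *)
Lemma rmap_square (k : fieldType) (S : shape) (M : rep k S) (u v v' w : S) x
  (b b' : bool) :
  (below u w -> [&& b, below u v & below v w] = [&& b', below u v' & below v' w]) ->
  (if b then rmap M v w (rmap M u v x) else 0)
  = (if b' then rmap M v' w (rmap M u v' x) else 0).
Proof.
rewrite !rmapM; case: (boolP (below u w)) => [_ /(_ isT)|/rmap_out -> _].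
  by case: b; case: b' => //= h; rewrite ?h // -h.
by rewrite !if_same.
Qed.

Section ConeFunctor.
Variables (k : fieldType) (S S' : shape) (s t : S' -> S).

(** The structure maps M (s v) -> M (t v) form a natural transformation between
    the two pullback functors. The cone functor sends X to the mapping cone of
    this transformation at X; pullback functors are exact. *)
Record cone_pair : Prop := ConePair {
  cone_pull1 : pullable s;
  cone_pull2 : pullable t;
  cone_nat : forall u v, below u v -> below (s u) (t v) ->
    below (s u) (t u) && below (t u) (t v) = below (s u) (s v) && below (s v) (t v) }.

Hypothesis st_ok : cone_pair.
Local Notation R := (rep_cat k S).
Local Notation R' := (rep_cat k S').
Implicit Types X Y K : cpx R.

Definition cone_obj X (n : int) : R' :=
  rep_sum (pull (cone_pull1 st_ok) (X (n + 1))) (pull (cone_pull2 st_ok) (X n)).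

(** The splittings in the definition of a mapping cone do not commute with the
    differentials, and the cone functor has to be applied to them as well. *)
Section Graded.
Variables (M M' N N' : rep k S) (f : rep_hom M N) (g : rep_hom M' N').
Local Notation P M M' :=
  (rep_sum (pull (cone_pull1 st_ok) M) (pull (cone_pull2 st_ok) M')).

Definition gr_fun v (x : P M M' v) : P N N' v := (f (s v) x.1, g (t v) x.2).
Fact gr_linear v : linear (@gr_fun v).
Proof. by move=> a x y; rewrite /gr_fun !linearP. Qed.
Fact gr_nat u v x : gr_fun (rmap (P M M') u v x) = rmap (P N N') u v (gr_fun x).
Proof.
rewrite /gr_fun /= /sum_map /= /pull_map.
by case: ifP => _; rewrite ?rfun_nat ?raddf0.
Qed.
Definition gr_map : rep_hom (P M M') (P N N') := RepHom gr_linear gr_nat.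
End Graded.

Definition cone_diff_fun X n v (x : cone_obj X n v) : cone_obj X (n + 1) v :=
  (- rfun (cdiff X (n + 1)) (s v) x.1,
   rmap (X (n + 1)) (s v) (t v) x.1 + rfun (cdiff X n) (t v) x.2).
Fact cone_diff_linear X n v : linear (@cone_diff_fun X n v).
Proof.
move=> a [x1 x2] [y1 y2]; congr pair; rewrite /=.
  by rewrite linearP opprD scalerN.
by rewrite !linearP /= scalerDr addrACA.
Qed.
Fact cone_diff_nat X n u v x :
  cone_diff_fun (rmap (cone_obj X n) u v x)
  = rmap (cone_obj X (n + 1)) u v (@cone_diff_fun X n u x).
Proof.
rewrite /cone_diff_fun /= /sum_map /= /pull_map.
case: (boolP (below u v)) => uv; last first.
  by rewrite !raddf0 addr0.
rewrite /= !rfun_nat raddfN raddfD /=; congr (_, _ + _).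
apply: (@rmap_square k S _ _ _ _ _ _ true true) => h /=.
by rewrite -(cone_nat st_ok uv h).
Qed.
Definition cone_diff X n : hom (cone_obj X n) (cone_obj X (n + 1)) :=
  RepHom (@cone_diff_linear X n) (@cone_diff_nat X n).

Fact cone_diff2 X n : cone_diff X (n + 1) ∘ cone_diff X n = 0.
Proof.
apply: rep_homP => v [a b]; rewrite /= /cone_diff_fun /=.
rewrite !raddfN raddfD /= !cdiff2E addr0 rfun_nat addNr.
by rewrite !oppr0.
Qed.

Fact cone_bound X :
  exists N : nat, forall n : int, (N < `|n|)%N -> is_zero (cone_obj X n).
Proof.
have [N hN] := cbound X; exists N.+1 => n hn; apply/is_zero_repP => v [a b].
have /is_zero_repP h1 : is_zero (X (n + 1)) by apply: hN; lia.
have /is_zero_repP h2 : is_zero (X n) by apply: hN; lia.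
by congr pair; [apply: h1|apply: h2].
Qed.

Definition cone_cpx X : cpx R' :=
  @Cpx R' (cone_obj X) (cone_diff X) (cone_diff2 X) (cone_bound X).

Fact cone_map_subproof X Y (f : cmap X Y) n :
  (gr_map (f (n + 1 + 1)) (f (n + 1)) : hom (cone_obj X (n + 1)) (cone_obj Y (n + 1)))
    ∘ cdiff (cone_cpx X) n
  = cdiff (cone_cpx Y) n ∘ gr_map (f (n + 1)) (f n).
Proof.
apply: rep_homP => v [a b]; rewrite /= /gr_fun /= /cone_diff_fun /=.
by rewrite raddfN raddfD /= !cfunE rfun_nat.
Qed.
Definition cone_map X Y (f : cmap X Y) : cmap (cone_cpx X) (cone_cpx Y) :=
  @CMap R' (cone_cpx X) (cone_cpx Y) (fun n => gr_map (f (n + 1)) (f n))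
    (cone_map_subproof f).

(** This is the five lemma for the long exact cohomology sequence of a cone,
    chased on elements. *)
Lemma cone_qis X Y (f : cmap X Y) : is_qis f -> is_qis (cone_map f).
Proof.
move=> /is_qis_elt_qis qf; apply: elt_qis_is_qis => n v; split.
  (* (a, b) is a cocycle whose image bounds: a = d a1, and a1 is corrected by a
     cocycle x so that b - E (x - a1) bounds as well. *)
  case=> a b [da dab] [[a' b'] [fa fb]]; rewrite /= in a b da dab a' b' fa fb *.
  have {}da : rfun (cdiff X (n + 1 + 1)) (s v) a = 0 by apply: oppr_inj; rewrite da oppr0.
  have [|a1 ea] := (qf (n + 1) (s v)).1 a da.
    by exists (- a'); rewrite raddfN.
  have [|x [y' [dx ex]]] := (qf n (s v)).2 (rfun (f (n + 1)) (s v) a1 + a').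
    by rewrite raddfD /= -cfunE -ea fa addNr.
  pose a2 := x - a1; have da2 : rfun (cdiff X (n + 1)) (s v) a2 = - a.
    by rewrite raddfB /= dx sub0r -ea.
  pose b0 := b - rmap _ (s v) (t v) a2.
  have key : a' - rfun (f (n + 1)) (s v) a2 = rfun (cdiff Y n) (s v) y'.
    apply: (addrI (rfun (f (n + 1)) (s v) x)); rewrite -ex /a2 raddfB /=.
    by rewrite opprB addrCA [_ + (_ - _)]addrC subrK [RHS]addrC.
  have [||b1 eb] := (qf n (t v)).1 b0.
  - by rewrite /b0 raddfB /= rfun_nat da2 raddfN opprK [LHS]addrC.
  - exists (rmap _ (s v) (t v) y' + b').
    rewrite /b0 raddfB /= [RHS]raddfD /= !rfun_nat -key fb [rmap _ _ _ (_ - _)]raddfB /=.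
    by rewrite [RHS]addrAC.
  exists (a2, b1); rewrite /= /cone_diff_fun /= da2 opprK; congr pair.
  by rewrite -eb [RHS]addrC subrK.
case=> a b [da dab]; rewrite /= in a b da dab *.
have {}da : rfun (cdiff Y (n + 1 + 1)) (s v) a = 0 by apply: oppr_inj; rewrite da oppr0.
have [x [y [dx ea]]] := (qf (n + 1) (s v)).2 a da.
pose Ex := rmap (X (n + 1 + 1)) (s v) (t v) x.
pose Ey := rmap (Y (n + 1)) (s v) (t v) y.
have dEy : rmap _ (s v) (t v) a
    = rfun (f (n + 1 + 1)) (t v) Ex + rfun (cdiff Y (n + 1)) (t v) Ey.
  by rewrite ea raddfD /= !rfun_nat.
have dEy' : rfun (cdiff Y (n + 1)) (t v) Ey + rfun (f (n + 1 + 1)) (t v) Ex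
    = rmap _ (s v) (t v) a by rewrite [RHS]dEy [RHS]addrC.
have [||x' ex'] := (qf (n + 1) (t v)).1 Ex.
- by rewrite /Ex rfun_nat dx raddf0.
- exists (- b - Ey); rewrite raddfB raddfN /=.
  apply: (addIr (rfun (cdiff Y (n + 1)) (t v) Ey)).
  rewrite -dEy subrK; apply: (addIr (rfun (cdiff Y (n + 1)) (t v) b)).
  by rewrite dab addNr.
have [|x'' [y'' [dx'' eb]]] := (qf n (t v)).2 (b + Ey + rfun (f (n + 1)) (t v) x').
  rewrite !raddfD /= -cfunE -ex' -[LHS]addrA dEy'.
  by rewrite [LHS]addrC dab.
exists (x, x'' - x'), (- y, y''); split; rewrite /= /cone_diff_fun /=.
  by rewrite dx oppr0 raddfB /= dx'' sub0r -ex' subrr.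
rewrite /gr_fun /= !raddfN /= !opprK; congr pair; first exact: ea.
rewrite /=.
apply: (addIr (rfun (f (n + 1)) (t v) x' + Ey)).
rewrite [X in b + X]addrC [LHS]addrA eb raddfB /= [- Ey + _]addrC [X in _ = X + _]addrACA -opprD.
by rewrite subrK.
Qed.

End ConeFunctor.

Section ConeTriangle.
Variables (k : fieldType) (S S' : shape) (s t : S' -> S).
Hypothesis st_ok : cone_pair s t.
Local Notation R := (rep_cat k S).
Local Notation R' := (rep_cat k S').
Implicit Types X Y K : cpx R.
Local Notation F := (cone_cpx st_ok).

Lemma rep_oppE (T : shape) (M N : rep_cat k T) (f : hom M N) v x :
  rfun (- f) v x = - rfun f v x.
Proof. by []. Qed.

Lemma rep_addE (T : shape) (M N : rep_cat k T) (f g : hom M N) v x :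
  rfun (f + g) v x = rfun f v x + rfun g v x.
Proof. by []. Qed.

Fact cone_map_congr X Y (f g : cmap X Y) : (forall n, f n = g n) ->
  forall n, cone_map st_ok f n = cone_map st_ok g n.
Proof. by move=> e n; rewrite /= !e. Qed.

Fact cone_map_id X n : cone_map st_ok (cid X) n = idm (F X n).
Proof. by apply: rep_homP => v [a b]. Qed.

Fact cone_map_comp X Y Z (g : cmap Y Z) (f : cmap X Y) n :
  cone_map st_ok (ccomp g f) n = cone_map st_ok g n ∘ cone_map st_ok f n.
Proof. by apply: rep_homP => v [a b]. Qed.

Definition cone_cf : cpx_functor R R' :=
  CpxFunctor cone_map_congr cone_map_id cone_map_comp (@cone_qis k S S' s t st_ok).

Definition cone_shift_fun X n : rep_hom (cone_obj st_ok (cshift X) n) (cone_obj st_ok X (n + 1)) :=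
  gr_map st_ok (- idm (X (n + 1 + 1))) (idm (X (n + 1))).

Fact cone_shift_subproof X n :
  (cone_shift_fun X (n + 1) : hom (F (cshift X) (n + 1)) (cshift (F X) (n + 1)))
    ∘ cdiff (F (cshift X)) n
  = cdiff (cshift (F X)) n ∘ cone_shift_fun X n.
Proof.
apply: rep_homP => v [a b]; rewrite /= /gr_fun /= /cone_diff_fun /=.
by rewrite ?rfunN ?rmapN; congr pair; rewrite /= ?opprK // opprD opprK.
Qed.
Definition cone_shift X : cmap (F (cshift X)) (cshift (F X)) :=
  @CMap R' (F (cshift X)) (cshift (F X)) (cone_shift_fun X) (cone_shift_subproof X).

Fact cone_unshift_subproof X n :
  (cone_shift_fun X (n + 1) : hom (cshift (F X) (n + 1)) (F (cshift X) (n + 1)))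
    ∘ cdiff (cshift (F X)) n
  = cdiff (F (cshift X)) n ∘ cone_shift_fun X n.
Proof.
apply: rep_homP => v [a b]; rewrite /= /gr_fun /= /cone_diff_fun /=.
by rewrite ?rfunN ?rmapN; congr pair; rewrite /= ?opprK // opprD.
Qed.
Definition cone_shift_inv X : cmap (cshift (F X)) (F (cshift X)) :=
  @CMap R' (cshift (F X)) (F (cshift X)) (cone_shift_fun X) (cone_unshift_subproof X).

Lemma cone_shiftK X n : (cone_shift_fun X n : hom (F (cshift X) n) (F (cshift X) n))
  ∘ cone_shift_fun X n = idm _.
Proof. by apply: rep_homP => v [a b]; rewrite /= /gr_fun ?rep_oppE /= opprK. Qed.

(** The sign of cone_shift makes the inclusion of X[1] into K change its sign on
    the first summand; with it the matrix of the differential is that of a cone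
    on the nose. *)
Lemma cone_triangle X Y K (f : cmap X Y) (i : cmap Y K) (p : cmap K (cshift X)) :
  is_cone f i p ->
  is_cone (cone_map st_ok f) (cone_map st_ok i)
    (ccomp (cone_shift X) (cone_map st_ok p)).
Proof.
move=> [sK [rK h]].
exists (fun n => gr_map st_ok (- sK (n + 1)) (sK n)),
  (fun n => gr_map st_ok (rK (n + 1)) (rK n)) => n.
have [[b1 b2 b3 b4 b5] dK] := h n.
have [[b1' b2' b3' b4' b5'] dK'] := h (n + 1).
split; first split.
- apply: rep_homP => v [a b] /=; rewrite /gr_fun /= ?rep_oppE /= ?rfunN opprK.
  by congr pair; [exact: (rep_ext b1') | exact: (rep_ext b1)].
- apply: rep_homP => v [a b] /=; rewrite /gr_fun /=.
  by congr pair; [exact: (rep_ext b2') | exact: (rep_ext b2)].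
- apply: rep_homP => v [a b] /=; rewrite /gr_fun /= ?rep_oppE /=.
  congr pair; last exact: (rep_ext b3).
  by rewrite [X in - X](rep_ext b3' _ a) oppr0.
- apply: rep_homP => v [a b] /=; rewrite /gr_fun /= ?rep_oppE ?rfunN /=.
  congr pair; last exact: (rep_ext b4).
  by rewrite [X in - X](rep_ext b4' _ a) oppr0.
- apply: rep_homP => v [a b] /=; rewrite /gr_fun /= ?rep_oppE /= ?rfunN opprK.
  by congr pair; [exact: (rep_ext b5') | exact: (rep_ext b5)].
apply: rep_homP => v [a b].
have ea : rfun (cdiff K (n + 1)) (s v) a =
   - rfun (sK (n + 1 + 1)) _ (rfun (cdiff X (n + 1 + 1)) _ (rfun (p (n + 1)) _ a))
   + rfun (i (n + 1 + 1)) _ (rfun (f (n + 1 + 1)) _ (rfun (p (n + 1)) _ a))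
   + rfun (i (n + 1 + 1)) _ (rfun (cdiff Y (n + 1)) _ (rfun (rK (n + 1)) _ a)).
  by rewrite (rep_ext dK' _ a) !rep_addE /= ?rep_oppE ?rfunN.
have eb : rfun (cdiff K n) (t v) b =
   - rfun (sK (n + 1)) _ (rfun (cdiff X (n + 1)) _ (rfun (p n) _ b))
   + rfun (i (n + 1)) _ (rfun (f (n + 1)) _ (rfun (p n) _ b))
   + rfun (i (n + 1)) _ (rfun (cdiff Y n) _ (rfun (rK n) _ b)).
  by rewrite (rep_ext dK _ b) !rep_addE /= ?rep_oppE ?rfunN.
have ec : a = rfun (sK (n + 1)) (s v) (rfun (p (n + 1)) _ a)
            + rfun (i (n + 1)) _ (rfun (rK (n + 1)) _ a).
  exact: esym (rep_ext b5' _ a).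
rewrite !rep_addE /= /gr_fun /cone_diff_fun /= ?rep_oppE /= ?rfunN /= !opprK.
rewrite ea eb; congr pair; rewrite /=.
  by rewrite !opprD opprK.
have eE : rmap (K (n + 1)) (s v) (t v) a
    = rfun (sK (n + 1)) (t v) (rmap _ (s v) (t v) (rfun (p (n + 1)) (s v) a))
      + rfun (i (n + 1)) (t v) (rmap _ (s v) (t v) (rfun (rK (n + 1)) (s v) a)).
  by rewrite {1}ec rmapD -!rfun_nat.
rewrite eE rmapN !rfunD rfunN opprD opprK.
rewrite addrACA; congr (_ + _); exact: addrA.
Qed.

End ConeTriangle.

(** * Mutually inverse cone functors *)

Lemma rmap_eq (k : fieldType) (S : shape) (M : rep k S) (u v v' w : S) (x : M u) :
  (below u w -> (below u v && below v w) = (below u v' && below v' w)) ->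
  rmap M v w (rmap M u v x) = rmap M v' w (rmap M u v' x).
Proof. exact: (@rmap_square _ _ _ _ _ _ _ x true true). Qed.

Section RoundTrip.
Variables (k : fieldType) (S S' : shape) (s t : S' -> S) (s' t' : S -> S').
Hypothesis (in_ok : cone_pair s t) (out_ok : cone_pair s' t').
Local Notation R := (rep_cat k S).
Implicit Types X Y : cpx R.

(** At a vertex w the round trip of X has the four summands X (a1 w), X (a2 w),
    X (b1 w), X (b2 w), in degrees n + 2, n + 1, n + 1, n. Its differential adds
    to those of X the maps a1 -> a2, b1 -> b2 of the inner cone functor and the
    maps a1 -> b1, a2 -> b2 of the outer one, the latter only if s' w and t' w
    are linked. *)
Local Notation a1 w := (s (s' w)).
Local Notation a2 w := (t (s' w)).
Local Notation b1 w := (s (t' w)).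
Local Notation b2 w := (t (t' w)).
Local Notation linked w := (below (s' w) (t' w)).

Definition round X := cone_cpx out_ok (cone_cpx in_ok X).

(** When X (a1 w) = 0 the remaining summands should form a short exact sequence
    0 -> X w -> X (a2 w) + X (b1 w) -> X (b2 w) -> 0, split at each vertex by
    structure maps: either w is a2 w and the other two vanish, or w is b1 w and
    a2 w is b2 w. The fields say this in a form that covers both cases, as
    equalities between composites of structure maps. *)
Record unit_pair : Prop := UnitPair {
  unit_nat1 : forall u v, below u v -> below u (a2 v) ->
    [&& below (s' u) (s' v), below u (a2 u) & below (a2 u) (a2 v)] = below v (a2 v);
  unit_nat2 : forall u v, below u v -> below u (b1 v) ->
    [&& below (t' u) (t' v), below u (b1 u) & below (b1 u) (b1 v)] = below v (b1 v);
  unit_diff : forall w, below w (b2 w) ->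
    [&& linked w, below w (a2 w) & below (a2 w) (b2 w)]
    = below w (b1 w) && below (b1 w) (b2 w);
  unit_a1 : forall w, ~~ below (a1 w) (a1 w);
  unit_ret : forall w, below w w ->
    below w (a2 w) && below (a2 w) w = ~~ (below w (b1 w) && below (b1 w) w);
  unit_a2a2 : forall w, below (a2 w) (a2 w) -> below (a2 w) w && below w (a2 w)
    = ~~ [&& linked w, below (a2 w) (b2 w) & below (b2 w) (a2 w)];
  unit_b1a2 : forall w, below (b1 w) (a2 w) ->
    below (b1 w) w && below w (a2 w) = below (b1 w) (b2 w) && below (b2 w) (a2 w);
  unit_b1b1 : forall w, below (b1 w) (b1 w) -> below (b1 w) w && below w (b1 w);
  unit_a2b1 : forall w, below (a2 w) (b1 w) -> ~~ (below (a2 w) w && below w (b1 w));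
  unit_b2b2 : forall w, below (b2 w) (b2 w) ->
    [&& linked w, below (b2 w) (a2 w) & below (a2 w) (b2 w)] }.

Section Unit.
Hypothesis ok : unit_pair.
Variable X : cpx R.

(** With this sign the two composites X w -> X (b2 w) cancel. *)
Definition unit_fun n w (x : X (n + 1) w) : round X n w :=
  ((0, - rmap (X (n + 1)) w (a2 w) x), (rmap (X (n + 1)) w (b1 w) x, 0)).
Fact unit_linear n w : linear (@unit_fun n w).
Proof.
move=> c x y; rewrite /unit_fun !rmap_linear opprD -scalerN.
by congr (_, _); congr (_, _); rewrite /= scaler0 addr0.
Qed.
Fact unit_nat n u v x :
  unit_fun (rmap (X (n + 1)) u v x) = rmap (round X n) u v (@unit_fun n u x).
Proof.
rewrite /unit_fun /= /sum_map /= /pull_map /= /sum_map /= /pull_map.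
case: (boolP (below u v)) => uv; last by rewrite (rmap_out _ uv) !rmap0 oppr0.
have e1 : rmap (X (n + 1)) v (a2 v) (rmap (X (n + 1)) u v x) =
  if below (s' u) (s' v)
  then rmap (X (n + 1)) (a2 u) (a2 v) (rmap (X (n + 1)) u (a2 u) x) else 0.
  apply: (@rmap_square k S _ _ _ _ _ x true) => h /=.
  by rewrite uv (unit_nat1 ok uv h).
have e2 : rmap (X (n + 1)) v (b1 v) (rmap (X (n + 1)) u v x) =
  if below (t' u) (t' v)
  then rmap (X (n + 1)) (b1 u) (b1 v) (rmap (X (n + 1)) u (b1 u) x) else 0.
  apply: (@rmap_square k S _ _ _ _ _ x true) => h /=.
  by rewrite uv (unit_nat2 ok uv h).
rewrite e1 e2; do 2![case: ifP => _]; by rewrite ?rmap0 ?rmapN ?oppr0.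
Qed.
Definition unit_hom n : rep_hom (X (n + 1)) (round X n) :=
  RepHom (@unit_linear n) (@unit_nat n).

Fact unit_subproof n :
  (unit_hom (n + 1) : hom (cshift X (n + 1)) (round X (n + 1))) ∘ cdiff (cshift X) n
  = cdiff (round X) n ∘ unit_hom n.
Proof.
apply: rep_homP => w x; rewrite /= /unit_fun /cone_diff_fun /= /cone_diff_fun /=.
rewrite /sum_map /= /pull_map ?rep_oppE !rfun0 !rmapN !rfunN !rfun_nat.
have e : rmap (X (n + 1)) (b1 w) (b2 w) (rmap (X (n + 1)) w (b1 w) x)
  = if linked w then rmap (X (n + 1)) (a2 w) (b2 w) (rmap (X (n + 1)) w (a2 w) x) else 0.
  apply: (@rmap_square k S _ _ _ _ _ x true) => h /=.
  by rewrite (unit_diff ok h).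
rewrite e !rmap0 !oppr0 !add0r !opprK addr0.
congr (_, _); congr (_, _); rewrite /= ?oppr0 ?opprK //; case: ifP => _ /=;
  by rewrite ?add0r ?addNr.
Qed.
Definition unit_map : cmap (cshift X) (round X) :=
  @CMap R (cshift X) (round X) unit_hom unit_subproof.

(* ret is a retraction of unit_fun at the vertex w, and htpy a homotopy from the
   identity to unit_fun after ret. Neither is natural in w, but cohomology is
   computed vertex by vertex. *)
Let ret n w (y : round X n w) : X (n + 1) w :=
  rmap (X (n + 1)) (b1 w) w y.2.1 - rmap (X (n + 1)) (a2 w) w y.1.2.

Let a1_0 n w (x : X n (a1 w)) : x = 0.
Proof. exact: rspace0 (unit_a1 ok w). Qed.

Let retK n w x : ret (@unit_fun n w x) = x.
Proof.
rewrite /ret /= rmapN opprK !rmapM.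
case: (boolP (below w w)) => h; last by rewrite (rspace0 x h) !rmap0 !if_same addr0.
by rewrite (unit_ret ok h); case: ifP => _; rewrite ?addr0 ?add0r rmap_id.
Qed.

Let ret_diff n w (y : round X n w) :
  ret (rfun (cdiff (round X) n) w y) = rfun (cdiff (cshift X) n) w (ret y).
Proof.
case: y => [[y1 y2] [z1 z2]]; rewrite /ret /= /sum_map /= /pull_map.
rewrite (a1_0 y1) !rmap0 if_same sub0r add0r !rmapN opprK rfunB !rfun_nat.
by rewrite opprB [LHS]addrC.
Qed.

Let htpy n w (y : round X (n + 1) w) : round X n w :=
  ((0, rmap (X (n + 1)) (b2 w) (a2 w) y.2.2), (0, 0)).

Let htpyP n w (y : round X (n + 1) w) : rfun (cdiff (round X) (n + 1)) w y = 0 ->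
  y = @unit_fun (n + 1) w (ret y) + rfun (cdiff (round X) n) w (htpy y).
Proof.
case: y => [[y1 y2] [z1 z2]] /(congr1 (fun y => y.2.2)).
rewrite /= in y1 y2 z1 z2 *.
rewrite /ret /htpy /unit_fun /= /cone_diff_fun /= /cone_diff_fun /=.
rewrite /sum_map /= /pull_map.
rewrite (a1_0 y1) !rmap0 !rfun0 if_same !oppr0 !add0r => dy.
have ea : y2 = rmap _ w (a2 w) (rmap _ (a2 w) w y2) + rmap _ (b2 w) (a2 w)
    (if linked w then rmap _ (a2 w) (b2 w) y2 else 0).
  case: (boolP (below (a2 w) (a2 w))) => h; last first.
    by rewrite (rspace0 y2 h) !rmap0 if_same rmap0 addr0.
  rewrite [X in _ = X + _]rmapM (unit_a2a2 ok h); case: (linked w); last first.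
    by rewrite rmap0 addr0 rmap_id.
  by rewrite rmapM andTb; case: (_ && _); rewrite /= ?addr0 ?add0r rmap_id.
have eb : rmap _ w (a2 w) (rmap _ (b1 w) w z1)
    = rmap _ (b2 w) (a2 w) (rmap _ (b1 w) (b2 w) z1).
  exact: rmap_eq (unit_b1a2 ok (w := w)).
congr (_, _); congr (_, _); rewrite /= ?addr0 //.
- rewrite rfun_nat rmapB eb opprB {1}ea -[RHS]addrA; congr (_ + _).
  rewrite -opprD -rmapD; apply: (addIr (rmap (X (n + 1 + 1)) (b2 w) (a2 w)
    (rmap (X (n + 1 + 1)) (b1 w) (b2 w) z1 + rfun (cdiff X (n + 1)) (b2 w) z2))).
  by rewrite addNr -rmapD dy rmap0.
- rewrite rmapB !rmapM.
  have -> : (if below (a2 w) w && below w (b1 w)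
      then rmap (X (n + 1 + 1)) (a2 w) (b1 w) y2 else 0) = 0.
    case: (boolP (below (a2 w) (b1 w))) => h; first by rewrite (negPf (unit_a2b1 ok h)).
    by rewrite (rmap_out _ h) if_same.
  case: (boolP (below (b1 w) (b1 w))) => h; last by rewrite (rspace0 z1 h) !rmap0 if_same subr0.
  by rewrite (unit_b1b1 ok h) rmap_id subr0.
- rewrite add0r; case: (boolP (below (b2 w) (b2 w))) => h; last first.
    by rewrite (rspace0 z2 h) !rmap0 if_same.
  by have /and3P[-> h1 h2] := unit_b2b2 ok h; rewrite rmapM h1 h2 rmap_id.
Qed.

Lemma unit_qis : is_qis unit_map.
Proof.
apply: elt_qis_is_qis => n w; split.
  move=> x dx [y ey]; exists (ret y).
  by rewrite -(retK x) -ret_diff -ey.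
move=> y dy; exists (ret y), (htpy y); split; last exact: htpyP.
by rewrite -ret_diff dy /ret !rmap0 subr0.
Qed.

End Unit.

(** The dual situation: X (b2 w) = 0, and the remaining summands form a split
    sequence 0 -> X (a1 w) -> X (a2 w) + X (b1 w) -> X w -> 0. *)
Record counit_pair : Prop := CounitPair {
  counit_nat1 : forall u v, below u v -> below (a2 u) v ->
    [&& below (s' u) (s' v), below (a2 u) (a2 v) & below (a2 v) v] = below (a2 u) u;
  counit_nat2 : forall u v, below u v -> below (b1 u) v ->
    [&& below (t' u) (t' v), below (b1 u) (b1 v) & below (b1 v) v] = below (b1 u) u;
  counit_diff : forall w, below (a1 w) w -> below (a1 w) (a2 w) && below (a2 w) w
    = [&& linked w, below (a1 w) (b1 w) & below (b1 w) w];
  counit_b2 : forall w, ~~ below (b2 w) (b2 w);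
  counit_sec : forall w, below w w ->
    below w (a2 w) && below (a2 w) w = ~~ (below w (b1 w) && below (b1 w) w);
  counit_a1a1 : forall w, below (a1 w) (a1 w) ->
    [&& linked w, below (a1 w) (b1 w) & below (b1 w) (a1 w)];
  counit_a2a2 : forall w, below (a2 w) (a2 w) -> below (a2 w) w && below w (a2 w);
  counit_b1a2 : forall w, below (b1 w) (a2 w) ->
    below (b1 w) w && below w (a2 w) = below (b1 w) (a1 w) && below (a1 w) (a2 w);
  counit_a2b1 : forall w, below (a2 w) (b1 w) -> ~~ (below (a2 w) w && below w (b1 w));
  counit_b1b1 : forall w, below (b1 w) (b1 w) -> below (b1 w) w && below w (b1 w)
    = ~~ [&& linked w, below (b1 w) (a1 w) & below (a1 w) (b1 w)] }.

Section Counit.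
Hypothesis ok : counit_pair.
Variable X : cpx R.

Definition counit_fun n w (y : round X n w) : X (n + 1) w :=
  rmap (X (n + 1)) (a2 w) w y.1.2 + rmap (X (n + 1)) (b1 w) w y.2.1.
Fact counit_linear n w : linear (@counit_fun n w).
Proof.
by move=> c x y; rewrite /counit_fun /= !rmap_linear scalerDr addrACA.
Qed.
Fact counit_nat n u v y :
  counit_fun (rmap (round X n) u v y) = rmap (X (n + 1)) u v (@counit_fun n u y).
Proof.
case: y => [[y1 y2] [z1 z2]]; rewrite /counit_fun /=.
rewrite /sum_map /= /pull_map /= /sum_map /= /pull_map /=.
rewrite /= in y1 y2 z1 z2 *.
case: (boolP (below u v)) => uv; last by rewrite (rmap_out _ uv) !rmap0 addr0.
rewrite rmapD; congr (_ + _).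
  have -> : rmap (X (n + 1)) u v (rmap (X (n + 1)) (a2 u) u y2) =
    if below (s' u) (s' v)
    then rmap (X (n + 1)) (a2 v) v (rmap (X (n + 1)) (a2 u) (a2 v) y2) else 0.
    apply: (@rmap_square k S _ _ _ _ _ y2 true) => h /=.
    by rewrite uv andbT (counit_nat1 ok uv h).
  by case: ifP => _; rewrite ?rmap0.
have -> : rmap (X (n + 1)) u v (rmap (X (n + 1)) (b1 u) u z1) =
  if below (t' u) (t' v)
  then rmap (X (n + 1)) (b1 v) v (rmap (X (n + 1)) (b1 u) (b1 v) z1) else 0.
  apply: (@rmap_square k S _ _ _ _ _ z1 true) => h /=.
  by rewrite uv andbT (counit_nat2 ok uv h).
by case: ifP => _; rewrite ?rmap0.
Qed.
Definition counit_hom n : rep_hom (round X n) (X (n + 1)) :=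
  RepHom (@counit_linear n) (@counit_nat n).

Fact counit_subproof n :
  (counit_hom (n + 1) : hom (round X (n + 1)) (cshift X (n + 1))) ∘ cdiff (round X) n
  = cdiff (cshift X) n ∘ counit_hom n.
Proof.
apply: rep_homP => w [[y1 y2] [z1 z2]].
rewrite /= /counit_fun /cone_diff_fun /= /cone_diff_fun /=.
rewrite /sum_map /= /pull_map ?rep_oppE.
rewrite /= in y1 y2 z1 z2 *.
have e : rmap (X (n + 1 + 1)) (a2 w) w (rmap (X (n + 1 + 1)) (a1 w) (a2 w) y1)
  = if linked w then rmap _ (b1 w) w (rmap (X (n + 1 + 1)) (a1 w) (b1 w) y1) else 0.
  apply: (@rmap_square k S _ _ _ _ _ y1 true) => h /=.
  by rewrite (counit_diff ok h).
have e' : rmap (X (n + 1 + 1)) (b1 w) w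
    (if linked w then rmap (X (n + 1 + 1)) (a1 w) (b1 w) y1 else 0)
  = rmap (X (n + 1 + 1)) (a2 w) w (rmap (X (n + 1 + 1)) (a1 w) (a2 w) y1).
  by rewrite e; case: ifP => _; rewrite ?rmap0.
rewrite rmapN !rmapD rmapN e' rfunD !rfun_nat !opprD.
by rewrite [LHS]addrACA addNr add0r.
Qed.
Definition counit_map : cmap (round X) (cshift X) :=
  @CMap R (round X) (cshift X) counit_hom counit_subproof.

Let sec n w (x : X (n + 1) w) : round X n w :=
  ((0, rmap (X (n + 1)) w (a2 w) x), (rmap (X (n + 1)) w (b1 w) x, 0)).

Let b2_0 n w (x : X n (b2 w)) : x = 0.
Proof. exact: rspace0 (counit_b2 ok w). Qed.

Let secK n w x : counit_fun (@sec n w x) = x.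
Proof.
rewrite /counit_fun /= !rmapM.
case: (boolP (below w w)) => h; last by rewrite (rspace0 x h) !rmap0 !if_same addr0.
by rewrite (counit_sec ok h); case: (_ && _); rewrite /= ?addr0 ?add0r rmap_id.
Qed.

Let sec_diff n w (x : X (n + 1) w) :
  rfun (cdiff (round X) n) w (sec x) = sec (rfun (cdiff (cshift X) n) w x).
Proof.
rewrite /sec /= /cone_diff_fun /= /cone_diff_fun /= ?rep_oppE /sum_map /= /pull_map.
congr (_, _); congr (_, _); rewrite /= ?rmap0 ?rfun0 ?oppr0 ?rmapN ?rfun_nat ?add0r //.
by rewrite if_same add0r.
Qed.

Let htpy n w (y : round X (n + 1) w) : round X n w :=
  ((rmap (X (n + 1 + 1)) (b1 w) (a1 w) y.2.1, 0), (0, 0)).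

Let htpyP n w (y : round X (n + 1) w) : rfun (cdiff (round X) (n + 1)) w y = 0 ->
  y = sec (counit_fun y) + rfun (cdiff (round X) n) w (htpy y).
Proof.
case: y => [[y1 y2] [z1 z2]] /(congr1 (fun y => y.2.1)).
rewrite /counit_fun /htpy /sec /= /cone_diff_fun /= /cone_diff_fun /=.
rewrite /sum_map /= /pull_map.
rewrite /= in y1 y2 z1 z2 * => dy.
have dz : rfun (cdiff X (n + 1 + 1)) (b1 w) z1
    = if linked w then rmap _ (a1 w) (b1 w) y1 else 0.
  by apply/esym/eqP; rewrite -subr_eq0; apply/eqP.
have ea : rmap (X (n + 1 + 1)) w (a2 w) (rmap (X (n + 1 + 1)) (b1 w) w z1)
    = rmap (X (n + 1 + 1)) (a1 w) (a2 w) (rmap (X (n + 1 + 1)) (b1 w) (a1 w) z1).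
  exact: rmap_eq (counit_b1a2 ok (w := w)).
have eb : z1 = rmap _ w (b1 w) (rmap _ (b1 w) w z1) + (if linked w
    then rmap _ (a1 w) (b1 w) (rmap _ (b1 w) (a1 w) z1) else 0).
  case: (boolP (below (b1 w) (b1 w))) => h; last first.
    by rewrite (rspace0 z1 h) !rmap0 if_same addr0.
  rewrite [X in _ = X + _]rmapM (counit_b1b1 ok h); case: (linked w); last first.
    by rewrite addr0 rmap_id.
  by rewrite rmapM andTb; case: (_ && _); rewrite /= ?addr0 ?add0r rmap_id.
congr (_, _); congr (_, _); rewrite /= ?rfun0 ?rmap0 ?if_same ?addr0 ?add0r ?opprK ?oppr0.
- rewrite rfun_nat dz; case: (boolP (below (a1 w) (a1 w))) => h; last first.
    by rewrite (rspace0 y1 h) !rmap0 if_same rmap0.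
  by have /and3P[-> h1 h2] := counit_a1a1 ok h; rewrite rmapM h1 h2 rmap_id.
- rewrite rmapD ea addrK rmapM.
  case: (boolP (below (a2 w) (a2 w))) => h; last by rewrite (rspace0 y2 h) rmap0 if_same.
  by rewrite (counit_a2a2 ok h) rmap_id.
- rewrite rmapD ?addr0 -[RHS]addrA -eb rmapM.
  case: (boolP (below (a2 w) (b1 w))) => h.
    by rewrite (negPf (counit_a2b1 ok h)) add0r.
  by rewrite (rmap_out _ h) if_same add0r.
- exact: b2_0.
Qed.

Lemma counit_qis : is_qis counit_map.
Proof.
apply: elt_qis_is_qis => n w; split.
  move=> y dy [x ex]; exists (sec x + htpy y).
  by rewrite rfunD sec_diff -ex; exact: htpyP.
move=> x dx; exists (sec x), 0; split; first by rewrite sec_diff dx /sec !rmap0.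
by rewrite rfun0 addr0; exact: esym (secK x).
Qed.

End Counit.

Lemma round_unit : unit_pair ->
  niso (derived_shift R) (comp_functor (lift (cone_cf k out_ok)) (lift (cone_cf k in_ok))).
Proof.
move=> ok.
apply: (@niso_derived R (derived_cat R) (derived_shift R)
  (comp_functor (lift (cone_cf k out_ok)) (lift (cone_cf k in_ok)))
  (fun X => DMap (unit_map ok X))) => [X|X Y f].
  exact: (@qis_iso R (cshift X) (round X) _ (unit_qis (ok := ok) (X := X))).
apply: deq_trans (deq_comp _ _) _; apply: deq_sym.
apply: deq_trans (deq_comp _ _) _; apply: deq_map => n.
apply: rep_homP => w x; rewrite /= /gr_fun /= /unit_fun /= /gr_fun /=.
by rewrite !rfun0 rfunN !rfun_nat.
Qed.

Lemma round_counit : counit_pair ->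
  niso (comp_functor (lift (cone_cf k out_ok)) (lift (cone_cf k in_ok))) (derived_shift R).
Proof.
move=> ok.
apply: (@niso_derived R (derived_cat R)
  (comp_functor (lift (cone_cf k out_ok)) (lift (cone_cf k in_ok))) (derived_shift R)
  (fun X => DMap (counit_map ok X))) => [X|X Y f].
  exact: (@qis_iso R (round X) (cshift X) _ (counit_qis (ok := ok) (X := X))).
apply: deq_trans (deq_comp _ _) _; apply: deq_sym.
apply: deq_trans (deq_comp _ _) _; apply: deq_map => n.
apply: rep_homP => w [[y1 y2] [z1 z2]].
by rewrite /= /gr_fun /= /counit_fun /= rfunD !rfun_nat.
Qed.

End RoundTrip.

Theorem cone_triangle_equivalence (k : fieldType) (S S' : shape)
  (s t : S' -> S) (s' t' : S -> S') (ok : cone_pair s t) (ok' : cone_pair s' t') :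
  unit_pair s t s' t' -> counit_pair s' t' s t ->
  triangle_equivalent (Db (rep_cat k S)) (Db (rep_cat k S')).
Proof.
move=> u c; exists (lift (cone_cf k ok)); split.
  apply: (equivalence_up_to_shift (G := cone_cf k ok')).
    exact: round_unit.
  exact: round_counit.
apply: (@lift_triangle _ _ (cone_cf k ok) (cone_shift ok) (cone_shift_inv ok)).
- by move=> X n; exact: cone_shiftK.
- by move=> X n; exact: cone_shiftK.
- move=> X Y f n; apply: rep_homP => v [a b].
  by rewrite /= /gr_fun /= ?rep_oppE ?rfunN.
- exact: cone_triangle.
Qed.

(** * From Lambda' to the star *)

Section Shapes.
Variables m N : nat.

(** None is a zero vertex. The sources i' are inl i and the line 2, ..., n is
    inr (Some 0), ..., inr (Some (N - 1)), inr None, where N = n - 2; the last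
    vertex n is set apart because the paths from i' to it vanish. *)
Definition line_vtx : finType := option ('I_m + option 'I_N).
Definition line_below (u v : line_vtx) : bool :=
  match u, v with
  | Some (inl i), Some (inl i') => i == i'
  | Some (inl _), Some (inr (Some _)) => true
  | Some (inr (Some j)), Some (inr (Some j')) => (j <= j')%N
  | Some (inr (Some _)), Some (inr None) => true
  | Some (inr None), Some (inr None) => true
  | _, _ => false
  end.
Definition line_shape : shape := Shape line_below.

Definition star_vtx : finType := option (option 'I_m + 'I_N).

(** In both stars the vertices inr j form a linearly oriented arm starting at
    the center inr 0; the neighbours inl i point to the center in this one and
    away from it in source_below. *)
Definition sink_below (u v : star_vtx) : bool :=
  match u, v with
  | Some (inl i), Some (inl i') => i == i'
  | Some (inl _), Some (inr _) => true
  | Some (inr j), Some (inr j') => (j <= j')%N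
  | _, _ => false
  end.
Definition sink_shape : shape := Shape sink_below.

Definition source_below (u v : star_vtx) : bool :=
  match u, v with
  | Some (inl i), Some (inl i') => i == i'
  | Some (inr j), Some (inl _) => j == 0%N :> nat
  | Some (inr j), Some (inr j') => (j <= j')%N
  | _, _ => false
  end.
Definition source_shape : shape := Shape source_below.

(** Writing Y_j for the representation at the vertex j of the line and X_i for it
    at i', the functor given by fib1 and fib2 takes up to a shift the following
    values: at inr j the fibre W_j of Y_j -> Y_n, where j starts at 2, at
    inl (Some i) the space X_i and at inl None the shift Y_n[-1]. The relation X_i -> Y_n = 0 is what makes X_i map to the fibre W_2
    without choosing a homotopy. *)
Definition fib1 (w : star_vtx) : line_vtx :=
  match w with
  | Some (inl (Some i)) => Some (inl i)
  | Some (inr j) => Some (inr (Some j))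
  | _ => None
  end.
Definition fib2 (w : star_vtx) : line_vtx :=
  match w with
  | Some (inl (Some i)) => None
  | Some _ => Some (inr None)
  | None => None
  end.

(** Conversely Y_j is the cone of Y_n[-1] -> W_j, with zero for W_n. *)
Definition cof1 (w : line_vtx) : star_vtx :=
  match w with
  | Some (inr _) => Some (inl None)
  | _ => None
  end.
Definition cof2 (w : line_vtx) : star_vtx :=
  match w with
  | Some (inl i) => Some (inl (Some i))
  | Some (inr (Some j)) => Some (inr j)
  | _ => None
  end.

(* All conditions are boolean statements about at most three vertices. *)
Ltac decide_below :=
  intros; simpl in *;
  repeat match goal with
  | v : option _ |- _ => destruct v
  | v : (_ + _)%type |- _ => destruct v
  end; simpl in *; try done;
  repeat match goal with
  | H : is_true (_ && _) |- _ => move/andP: H => [? ?]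
  | H : is_true (_ == _) |- _ => move/eqP: H => H
  | H : Some _ = Some _ |- _ => case: H => H
  end; subst; rewrite ?eqxx ?leqnn ?leq0n //=; try discriminate; try lia.

Lemma fib_pair : @cone_pair line_shape sink_shape fib1 fib2.
Proof. by split; [split|split|]; decide_below. Qed.

Lemma cof_pair : @cone_pair sink_shape line_shape cof1 cof2.
Proof. by split; [split|split|]; decide_below. Qed.

Lemma fib_cof_unit : @unit_pair line_shape sink_shape fib1 fib2 cof1 cof2.
Proof. by split; decide_below. Qed.

Lemma cof_fib_counit : @counit_pair sink_shape line_shape cof1 cof2 fib1 fib2.
Proof. by split; decide_below. Qed.

Hypothesis N_gt0 : (0 < N)%N.
Definition center : 'I_N := Ordinal N_gt0.

(** The reflection at all sources inl i at once: X_i -> W_2 is replaced by its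
    cone, and X_i is recovered as the fibre of W_2 -> cone. *)
Definition refl1 (w : star_vtx) : star_vtx :=
  match w with
  | Some (inl i) => Some (inl i)
  | _ => None
  end.
Definition refl2 (w : star_vtx) : star_vtx :=
  match w with
  | Some (inl _) => Some (inr center)
  | Some (inr j) => Some (inr j)
  | None => None
  end.

Lemma refl_pair : @cone_pair sink_shape source_shape refl1 refl2.
Proof. by split; [split|split|]; decide_below. Qed.

Lemma corefl_pair : @cone_pair source_shape sink_shape refl2 refl1.
Proof. by split; [split|split|]; decide_below. Qed.

Lemma refl_unit : @unit_pair sink_shape source_shape refl1 refl2 refl2 refl1.
Proof. by split; decide_below. Qed.

Lemma refl_counit : @counit_pair source_shape sink_shape refl2 refl1 refl1 refl2.
Proof. by split; decide_below. Qed.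

End Shapes.

Theorem line_source_equivalence (k : fieldType) (m N : nat) : (0 < N)%N ->
  triangle_equivalent (Db (rep_cat k (line_shape m N)))
    (Db (rep_cat k (source_shape m N))).
Proof.
move=> N_gt0.
have e1 := cone_triangle_equivalence k (fib_pair m N) (cof_pair m N)
    (fib_cof_unit m N) (cof_fib_counit m N).
have e2 := cone_triangle_equivalence k (refl_pair m N_gt0) (corefl_pair m N_gt0)
  (refl_unit m N_gt0) (refl_counit m N_gt0).
exact: triangle_equivalent_trans e1 e2.
Qed.

(** * Additive equivalences *)

Section Opposite.
Variable C : preadditive.

(** Cokernels are kernels in the opposite category, by conversion; this halves
    the proofs below. *)
Definition opposite : preadditive :=
  @Preadditive C (fun X Y => hom Y X) (@idm C) (fun X Y Z g f => f ∘ g)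
    (fun X Y f => compm1 f) (fun X Y f => comp1m f)
    (fun X Y Z W h g f => esym (Defs.compA f g h))
    (fun X Y Z g g' f => compDr f g g') (fun X Y Z g f f' => compDl f f' g).

End Opposite.

Section Isomorphisms.
Variable C : preadditive.
Implicit Types X Y K : C.

Lemma is_isom_id X : is_isom (idm X).
Proof. by exists (idm X); rewrite comp1m. Qed.

Lemma is_isom_comp X Y K (g : hom Y K) (f : hom X Y) :
  is_isom g -> is_isom f -> is_isom (g ∘ f).
Proof.
move=> [g' [g1 g2]] [f' [f1 f2]]; exists (f' ∘ g'); split.
  by rewrite Defs.compA -(Defs.compA f') g1 compm1.
by rewrite Defs.compA -(Defs.compA g) f2 compm1.
Qed.

Lemma kernel_iso X Y K X' Y' K' (f : hom X Y) (i : hom K X) (f' : hom X' Y')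
  (i' : hom K' X') (a : hom X X') (b : hom Y Y') (c : hom K K') :
  is_isom a -> is_isom b -> is_isom c -> f' ∘ a = b ∘ f -> i' ∘ c = a ∘ i ->
  is_kernel f i -> is_kernel f' i'.
Proof.
move=> [a' [a1 a2]] [b' [b1 b2]] [c' [c1 c2]] ef ei [fi ui].
have ef' : b' ∘ f' = f ∘ a'.
  by rewrite -[LHS]compm1 -a2 Defs.compA -(Defs.compA b') ef Defs.compA b1 comp1m.
have ei' : i' = a ∘ i ∘ c' by rewrite -ei -Defs.compA c2 compm1.
split; first by rewrite ei' !Defs.compA ef -(Defs.compA b) fi compm0 comp0m.
move=> W u fu; have [|v [iv vu]] := ui W (a' ∘ u).
  by rewrite Defs.compA -ef' -Defs.compA fu compm0.
exists (c ∘ v); split=> [|w iw].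
  by rewrite Defs.compA ei -Defs.compA iv Defs.compA a2 comp1m.
have -> : v = c' ∘ w; last by rewrite Defs.compA c2 comp1m.
apply: vu; rewrite -iw ei' !Defs.compA a1 comp1m //.
Qed.

End Isomorphisms.

Lemma cokernel_iso (C : preadditive) (X Y Q X' Y' Q' : C) (f : hom X Y)
  (p : hom Y Q) (f' : hom X' Y') (p' : hom Y' Q')
  (a : hom X X') (b : hom Y Y') (c : hom Q Q') :
  is_isom a -> is_isom b -> is_isom c -> f' ∘ a = b ∘ f -> p' ∘ b = c ∘ p ->
  is_cokernel f p -> is_cokernel f' p'.
Proof.
move=> [a' [a1 a2]] [b' [b1 b2]] [c' [c1 c2]] ef ep.
have ef' : b' ∘ f' = f ∘ a'.
  by rewrite -[LHS]compm1 -a2 Defs.compA -(Defs.compA b') ef Defs.compA b1 comp1m.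
have ep' : c' ∘ p' = p ∘ b'.
  by rewrite -[LHS]compm1 -b2 Defs.compA -(Defs.compA c') ep Defs.compA c1 comp1m.
apply: (@kernel_iso (opposite C) Y X Q Y' X' Q' f p f' p' b' a' c').
- by exists b; split.
- by exists a; split.
- by exists c; split.
- exact: ef'.
- exact: ep'.
Qed.

Section AdditiveEquivalence.

Record additive_functor (C D : preadditive) := AdditiveFunctor {
  afobj :> C -> D;
  afmap : forall X Y, hom X Y -> hom (afobj X) (afobj Y);
  afmap1 : forall X, afmap (idm X) = idm (afobj X);
  afmapM : forall X Y Z (g : hom Y Z) (f : hom X Y),
    afmap (g ∘ f) = afmap g ∘ afmap f;
  afmapD : forall X Y (f g : hom X Y), afmap (f + g) = afmap f + afmap g }.
Arguments afmap {C D} _ {X Y} _.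

Record is_add_equivalence (C D : preadditive) (F : additive_functor C D) : Prop :=
  IsAddEquivalence {
  af_full : forall X Y (g : hom (F X) (F Y)), exists f, afmap F f = g;
  af_faithful : forall X Y (f g : hom X Y), afmap F f = afmap F g -> f = g;
  af_ess : forall Y : D, exists (X : C) (a : hom (F X) Y), is_isom a }.

Definition opposite_functor (C D : preadditive) (F : additive_functor C D) :
  additive_functor (opposite C) (opposite D) :=
  @AdditiveFunctor (opposite C) (opposite D) F (fun X Y f => afmap F f)
    (afmap1 F) (fun X Y Z g f => afmapM F f g) (fun X Y f g => afmapD F f g).

Lemma opposite_equivalence (C D : preadditive) (F : additive_functor C D) :
  is_add_equivalence F -> is_add_equivalence (opposite_functor F).
Proof.
case=> full faith ess; split.
- by move=> X Y; apply: full.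
- by move=> X Y; apply: faith.
move=> Y; have [X [a [b [ba ab]]]] := ess Y.
by exists X, b, a.
Qed.

Variables (C D : preadditive) (F : additive_functor C D).

Lemma afmap0 X Y : afmap F (0 : hom X Y) = 0.
Proof. by apply: (addrI (afmap F (0 : hom X Y))); rewrite -afmapD !addr0. Qed.

Lemma afmapN X Y (f : hom X Y) : afmap F (- f) = - afmap F f.
Proof. by apply: (addrI (afmap F f)); rewrite -afmapD !subrr afmap0. Qed.

Lemma afmap_isom X Y (f : hom X Y) : is_isom f -> is_isom (afmap F f).
Proof. by case=> g [gf fg]; exists (afmap F g); rewrite -!afmapM gf fg !afmap1. Qed.

Hypothesis Fe : is_add_equivalence F.

Lemma afmap_isom_inv X Y (f : hom X Y) : is_isom (afmap F f) -> is_isom f.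
Proof.
case=> g' [gf fg]; have [g eg] := af_full Fe g'.
by exists g; split; apply: (af_faithful Fe); rewrite afmapM eg afmap1.
Qed.

Lemma afmap_kernel X Y K (f : hom X Y) (i : hom K X) :
  is_kernel f i <-> is_kernel (afmap F f) (afmap F i).
Proof.
split=> [[fi ui]|[fi ui]].
  split=> [|W u fu]; first by rewrite -afmapM fi afmap0.
  have [W0 [a [b [ba ab]]]] := af_ess Fe W.
  have [u0 eu] := af_full Fe (u ∘ a).
  have [|v [iv vu]] := ui W0 u0.
    by apply: (af_faithful Fe); rewrite afmapM eu Defs.compA fu comp0m afmap0.
  exists (afmap F v ∘ b); split=> [|w iw].
    by rewrite Defs.compA -afmapM iv eu -Defs.compA ab compm1.
  have [w0 ew] := af_full Fe (w ∘ a).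
  have -> : v = w0; last by rewrite ew -Defs.compA ab compm1.
  by apply: vu; apply: (af_faithful Fe); rewrite afmapM ew eu Defs.compA iw.
split=> [|W u fu]; first by apply: (af_faithful Fe); rewrite afmapM fi afmap0.
have [|v [iv vu]] := ui _ (afmap F u); first by rewrite -afmapM fu afmap0.
have [v0 ev] := af_full Fe v; exists v0; split=> [|w iw].
  by apply: (af_faithful Fe); rewrite afmapM ev.
by apply: (af_faithful Fe); rewrite ev; apply: vu; rewrite -afmapM iw.
Qed.

End AdditiveEquivalence.
Arguments afmap {C D} _ {X Y} _.

Lemma afmap_cokernel (C D : preadditive) (F : additive_functor C D) :
  is_add_equivalence F -> forall X Y Q (f : hom X Y) (p : hom Y Q),
  is_cokernel f p <-> is_cokernel (afmap F f) (afmap F p).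
Proof.
move=> Fe X Y Q f p.
exact: (@afmap_kernel _ _ (opposite_functor F) (opposite_equivalence Fe) Y X Q f p).
Qed.

Section Transfer.
Variables (C D : preadditive) (F : additive_functor C D).
Hypothesis Fe : is_add_equivalence F.

Lemma abelian_transfer : is_abelian C -> is_abelian D.
Proof.
move=> ab.
have tr (X Y : D) (f : hom X Y) : exists (X0 Y0 : C) (a : hom (F X0) X)
    (b : hom (F Y0) Y) (f0 : hom X0 Y0),
    [/\ is_isom a, is_isom b & f ∘ a = b ∘ afmap F f0].
  have [X0 [a [a' [a1 a2]]]] := af_ess Fe X; have [Y0 [b [b' [b1 b2]]]] := af_ess Fe Y.
  have [f0 e] := af_full Fe (b' ∘ f ∘ a).
  exists X0, Y0, a, b, f0; split; [by exists a'|by exists b'|].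
  by rewrite e !Defs.compA b2 comp1m.
split.
- have [Z Z0] := ab_zero ab; exists (F Z).
  by rewrite /is_zero -afmap1 Z0 afmap0.
- move=> X Y; have [X0 [a [a' [a1 a2]]]] := af_ess Fe X.
  have [Y0 [b [b' [b1 b2]]]] := af_ess Fe Y.
  have [B [iX [iY [pX [pY [e1 e2 e3 e4 e5]]]]]] := ab_biproduct ab X0 Y0.
  exists (F B), (afmap F iX ∘ a'), (afmap F iY ∘ b'), (a ∘ afmap F pX), (b ∘ afmap F pY).
  split.
  + by rewrite Defs.compA -(Defs.compA a) -afmapM e1 afmap1 compm1.
  + by rewrite Defs.compA -(Defs.compA b) -afmapM e2 afmap1 compm1.
  + by rewrite Defs.compA -(Defs.compA a) -afmapM e3 afmap0 compm0 comp0m.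
  + by rewrite Defs.compA -(Defs.compA b) -afmapM e4 afmap0 compm0 comp0m.
  + rewrite !Defs.compA -(Defs.compA _ a') a1 -(Defs.compA _ b') b1 !compm1.
    by rewrite -!afmapM -afmapD e5 afmap1.
- move=> X Y f; have [X0 [Y0 [a [b [f0 [ia ib e]]]]]] := tr X Y f.
  have [K [i ki]] := ab_kernel ab f0; exists (F K), (a ∘ afmap F i).
  apply: (kernel_iso ia ib (is_isom_id (F K)) e); first by rewrite compm1.
  exact/(afmap_kernel Fe).
- move=> X Y f; have [X0 [Y0 [a [b [f0 [ia ib e]]]]]] := tr X Y f.
  have [Q [p kp]] := ab_cokernel ab f0; have [b' [b1 b2]] := ib.
  exists (F Q), (afmap F p ∘ b').
  apply: (cokernel_iso ia ib (is_isom_id (F Q)) e).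
    by rewrite comp1m -Defs.compA b1 compm1.
  exact/(afmap_cokernel Fe).
- move=> X Y f fm; have [X0 [Y0 [a [b [f0 [ia ib e]]]]]] := tr X Y f.
  have [|Z [g kg]] := ab_mono ab (f := f0).
    move=> W u v uv; apply: (af_faithful Fe).
    have [a' [a1 a2]] := ia.
    rewrite -[LHS]comp1m -[RHS]comp1m -a1 -!Defs.compA; congr (_ ∘ _); apply: fm.
    by rewrite !Defs.compA e -!Defs.compA -!afmapM uv.
  have [b' [b1 b2]] := ib; exists (F Z), (afmap F g ∘ b').
  apply: (kernel_iso ib (is_isom_id (F Z)) ia).
  + by rewrite comp1m -Defs.compA b1 compm1.
  + exact: e.
  exact/(afmap_kernel Fe).
- move=> X Y f fm; have [X0 [Y0 [a [b [f0 [ia ib e]]]]]] := tr X Y f.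
  have [b' [b1 b2]] := ib; have [a' [a1 a2]] := ia.
  have e' : b' ∘ f = afmap F f0 ∘ a'.
    by rewrite -[LHS]compm1 -a2 Defs.compA -(Defs.compA b') e Defs.compA b1 comp1m.
  have [|Z [g kg]] := ab_epi ab (f := f0).
    move=> W u v uv; apply: (af_faithful Fe).
    rewrite -[LHS]compm1 -[RHS]compm1 -b1 !Defs.compA; congr (_ ∘ _); apply: fm.
    by rewrite -!Defs.compA e' !Defs.compA -!afmapM uv.
  exists (F Z), (a ∘ afmap F g).
  apply: (cokernel_iso (is_isom_id (F Z)) ia ib); first by rewrite compm1.
    exact: e.
  exact/(afmap_cokernel Fe).
Qed.

Section Complexes.
Implicit Types X Y : cpx C.

Fact af_cpx_diff2 X n : afmap F (cdiff X (n + 1)) ∘ afmap F (cdiff X n) = 0.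
Proof. by rewrite -afmapM cdiff2 afmap0. Qed.
Fact af_cpx_bound X :
  exists N : nat, forall n : int, (N < `|n|)%N -> is_zero (F (X n)).
Proof.
have [N hN] := cbound X; exists N => n /hN Xn.
by rewrite /is_zero -afmap1 Xn afmap0.
Qed.
Definition af_cpx X : cpx D :=
  @Cpx D (fun n => F (X n)) (fun n => afmap F (cdiff X n)) (af_cpx_diff2 X)
    (af_cpx_bound X).

Fact af_cmap_subproof X Y (f : cmap X Y) n :
  afmap F (f (n + 1)) ∘ cdiff (af_cpx X) n = cdiff (af_cpx Y) n ∘ afmap F (f n).
Proof. by rewrite /= -!afmapM cfunP. Qed.
Definition af_cmap X Y (f : cmap X Y) : cmap (af_cpx X) (af_cpx Y) :=
  @CMap D (af_cpx X) (af_cpx Y) (fun n => afmap F (f n)) (af_cmap_subproof f).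

(** Cohomology objects of F X need not be in the image of F, only isomorphic to
    objects in it. *)
Lemma af_cohomology X n (Z H : D) (z : hom Z (af_cpx X (n + 1))) (h : hom Z H) :
  is_cohomology z h -> exists (Z0 H0 : C) (z0 : hom Z0 (X (n + 1))) (h0 : hom Z0 H0)
    (a : hom (F Z0) Z) (c : hom (F H0) H),
  [/\ is_cohomology z0 h0, is_isom a, is_isom c,
    z ∘ a = afmap F z0 & h ∘ a = c ∘ afmap F h0].
Proof.
move=> [kz [b [zb cb]]].
have [Z0 [a ia]] := af_ess Fe Z; have [H0 [c ic]] := af_ess Fe H.
have [a' [a1 a2]] := ia; have [c' [c1 c2]] := ic.
have [z0 ez] := af_full Fe (z ∘ a).
have [h0 eh] := af_full Fe (c' ∘ h ∘ a).
have [b0 eb] := af_full Fe (a' ∘ b).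
have ia' : is_isom a' by exists a.
have ic' : is_isom c' by exists c.
exists Z0, H0, z0, h0, a, c; split=> //; last by rewrite eh !Defs.compA c2 comp1m.
split.
  apply/(afmap_kernel Fe).
  apply: (kernel_iso (is_isom_id _) (is_isom_id _) ia' _ _ kz).
    by rewrite compm1 comp1m.
  by rewrite ez comp1m -Defs.compA a2 compm1.
exists b0; split.
  by apply: (af_faithful Fe); rewrite afmapM ez eb Defs.compA -(Defs.compA z) a2 compm1.
apply/(afmap_cokernel Fe); apply: (cokernel_iso (is_isom_id _) ia' ic' _ _ cb).
  by rewrite compm1 eb.
by rewrite eh -Defs.compA a2 compm1.
Qed.

Lemma af_qis X Y (f : cmap X Y) : is_qis f -> is_qis (af_cmap f).
Proof.
move=> qf n Z H Z' H' z h z' h' cx cy g e zg eh.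
have [Z0 [H0 [z0 [h0 [a [c [cx0 ia ic ez ehc]]]]]]] := af_cohomology cx.
have [Z1 [H1 [z1 [h1 [a' [c' [cy1 ia' ic' ez' ehc']]]]]]] := af_cohomology cy.
have [v [v1 v2]] := ia'; have [w [w1 w2]] := ic'.
have [g0 eg] := af_full Fe (v ∘ g ∘ a).
have [e0 ee] := af_full Fe (w ∘ e ∘ c).
have ie0 : is_isom e0.
  apply: (qf n _ _ _ _ _ _ _ _ cx0 cy1 g0).
    apply: (af_faithful Fe); rewrite !afmapM -ez' eg !Defs.compA -(Defs.compA z') v2 compm1.
    by rewrite zg -Defs.compA ez.
  apply: (af_faithful Fe); rewrite !afmapM ee eg.
  have -> : afmap F h1 = w ∘ h' ∘ a'.
    by rewrite -Defs.compA ehc' Defs.compA w1 comp1m.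
  rewrite -!Defs.compA; congr (_ ∘ _); rewrite -ehc !Defs.compA eh.
  by rewrite -[in RHS](Defs.compA h') v2 compm1.
have [c1 [c2 c3]] := ic.
have -> : e = (c' ∘ afmap F e0) ∘ c1.
  by rewrite ee !Defs.compA w2 comp1m -Defs.compA c3 compm1.
apply: is_isom_comp; last by exists c.
by apply: is_isom_comp => //; apply: afmap_isom.
Qed.

Definition af_cf : cpx_functor C D :=
  @CpxFunctor C D af_cpx af_cmap
    (fun X Y f g e n => congr1 (afmap F) (e n)) (fun X n => afmap1 F (X n))
    (fun X Y Z g f n => afmapM F (g n) (f n)) af_qis.

Fact af_shift_subproof X n :
  idm (F (X (n + 1 + 1))) ∘ cdiff (af_cpx (cshift X)) n
  = cdiff (cshift (af_cpx X)) n ∘ idm (F (X (n + 1))).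
Proof. by rewrite comp1m compm1 /= afmapN. Qed.
Definition af_shift X : cmap (af_cpx (cshift X)) (cshift (af_cpx X)) :=
  @CMap D (af_cpx (cshift X)) (cshift (af_cpx X)) (fun n => idm (F (X (n + 1))))
    (af_shift_subproof X).
Fact af_shift_inv_subproof X n :
  idm (F (X (n + 1 + 1))) ∘ cdiff (cshift (af_cpx X)) n
  = cdiff (af_cpx (cshift X)) n ∘ idm (F (X (n + 1))).
Proof. by rewrite comp1m compm1 /= afmapN. Qed.
Definition af_shift_inv X : cmap (cshift (af_cpx X)) (af_cpx (cshift X)) :=
  @CMap D (cshift (af_cpx X)) (af_cpx (cshift X)) (fun n => idm (F (X (n + 1))))
    (af_shift_inv_subproof X).

Lemma af_triangle : @is_triangle_functor (Db C) (Db D) (lift af_cf).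
Proof.
apply: (@lift_triangle _ _ af_cf af_shift af_shift_inv).
- by move=> X n; rewrite /= comp1m.
- by move=> X n; rewrite /= comp1m.
- by move=> X Y f n; rewrite /= comp1m compm1.
move=> X Y K f i p [s [r h]].
exists (fun n => afmap F (s n)), (fun n => afmap F (r n)) => n.
have [[b1 b2 b3 b4 b5] dK] := h n.
split; first split; rewrite /= ?comp1m -?afmapM.
- by rewrite b1 afmap1.
- by rewrite b2 afmap1.
- by rewrite b3 afmap0.
- by rewrite b4 afmap0.
- by rewrite -afmapD b5 afmap1.
by rewrite dK !afmapD !afmapM afmapN.
Qed.

End Complexes.
End Transfer.

Section Inverse.
Variables (C D : preadditive) (F : additive_functor C D).
Hypothesis Fe : is_add_equivalence F.

(** The inverse is chosen object by object; its action on morphisms is forced by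
    full faithfulness. *)
Lemma add_inverse : exists (G : additive_functor D C)
    (a : forall Y, hom (F (G Y)) Y) (b : forall Y, hom Y (F (G Y))),
  [/\ forall Y, a Y ∘ b Y = idm Y, forall Y, b Y ∘ a Y = idm (F (G Y)) &
    forall Y Y' (g : hom Y Y'), afmap F (afmap G g) = b Y' ∘ g ∘ a Y].
Proof.
have h Y : exists p : {X : C & (hom (F X) Y * hom Y (F X))%type},
    (projT2 p).1 ∘ (projT2 p).2 = idm Y /\ (projT2 p).2 ∘ (projT2 p).1 = idm _.
  by have [X [a [b [ba ab]]]] := af_ess Fe Y; exists (existT _ X (a, b)).
pose p Y := constructive_indefinite_description (h Y).
pose G Y := projT1 (sval (p Y)).
pose a Y : hom (F (G Y)) Y := (projT2 (sval (p Y))).1.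
pose b Y : hom Y (F (G Y)) := (projT2 (sval (p Y))).2.
have ab Y : a Y ∘ b Y = idm Y by have [] := svalP (p Y).
have ba Y : b Y ∘ a Y = idm (F (G Y)) by have [] := svalP (p Y).
pose gm Y Y' (g : hom Y Y') :=
  sval (constructive_indefinite_description (af_full Fe (b Y' ∘ g ∘ a Y))).
have gmE Y Y' (g : hom Y Y') : afmap F (gm Y Y' g) = b Y' ∘ g ∘ a Y.
  by rewrite /gm; case: constructive_indefinite_description.
have g1 Y : gm Y Y (idm Y) = idm (G Y).
  by apply: (af_faithful Fe); rewrite gmE compm1 ba afmap1.
have gM X Y Z (g : hom Y Z) (f : hom X Y) : gm X Z (g ∘ f) = gm Y Z g ∘ gm X Y f.
  apply: (af_faithful Fe); rewrite afmapM !gmE !Defs.compA; congr (_ ∘ _ ∘ _).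
  by rewrite -!Defs.compA ab compm1.
have gD X Y (f g : hom X Y) : gm X Y (f + g) = gm X Y f + gm X Y g.
  by apply: (af_faithful Fe); rewrite afmapD !gmE compDr compDl.
by exists (@AdditiveFunctor D C G gm g1 gM gD), a, b.
Qed.

End Inverse.

Section EquivalenceTheorems.
Variables (C D : preadditive) (F : additive_functor C D).
Hypothesis Fe : is_add_equivalence F.

Section WithInverse.
Variables (G : additive_functor D C) (a : forall Y, hom (F (G Y)) Y)
  (b : forall Y, hom Y (F (G Y))).
Hypotheses (ab : forall Y, a Y ∘ b Y = idm Y)
  (ba : forall Y, b Y ∘ a Y = idm (F (G Y)))
  (GE : forall Y Y' (g : hom Y Y'), afmap F (afmap G g) = b Y' ∘ g ∘ a Y).

Let ia Y : is_isom (a Y). Proof. by exists (b Y). Qed.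

Let a_nat Y Y' (g : hom Y Y') : a Y' ∘ afmap F (afmap G g) = g ∘ a Y.
Proof. by rewrite GE !Defs.compA ab comp1m. Qed.

Lemma inverse_equivalence : is_add_equivalence G.
Proof.
split.
- move=> Y Y' f; exists (a Y' ∘ afmap F f ∘ b Y); apply: (af_faithful Fe).
  by rewrite GE !Defs.compA ba comp1m -Defs.compA ba compm1.
- move=> Y Y' g g' e.
  rewrite -[g]compm1 -[g']compm1 -(ab Y) !Defs.compA; congr (_ ∘ _).
  by rewrite -!a_nat e.
move=> X; have [a0 e] := af_full Fe (a (F X)).
by exists (F X), a0; apply: (afmap_isom_inv Fe); rewrite e.
Qed.

Let cX X : exists c : hom (G (F X)) X, afmap F c = a (F X).
Proof. exact: (af_full Fe). Qed.
Let c X := sval (constructive_indefinite_description (cX X)).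
Let cE X : afmap F (c X) = a (F X).
Proof. by rewrite /c; case: constructive_indefinite_description. Qed.
Let ic X : is_isom (c X).
Proof. by apply: (afmap_isom_inv Fe); rewrite cE. Qed.
Let c_nat X X' (f : hom X X') : c X' ∘ afmap G (afmap F f) = f ∘ c X.
Proof. by apply: (af_faithful Fe); rewrite !afmapM !cE a_nat. Qed.

Lemma inverse_niso_l :
  niso (comp_functor (lift (af_cf inverse_equivalence)) (lift (af_cf Fe)))
    (id_functor (derived_cat C)).
Proof.
pose t X : cmap (af_cpx G (af_cpx F X)) X :=
  @CMap C (af_cpx G (af_cpx F X)) X (fun n => c (X n)) (fun n => c_nat (cdiff X n)).
apply: (@niso_derived C (derived_cat C)
  (comp_functor (lift (af_cf inverse_equivalence)) (lift (af_cf Fe)))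
  (id_functor (derived_cat C)) (fun X => DMap (t X))) => [X|X Y f].
  pose d n := sval (constructive_indefinite_description (ic (X n))).
  have [dc cd] : (forall n, d n ∘ c (X n) = idm _) /\ (forall n, c (X n) ∘ d n = idm _).
    by split=> n; rewrite /d; case: constructive_indefinite_description => ? [].
  have dn n : d (n + 1) ∘ cdiff X n = cdiff (af_cpx G (af_cpx F X)) n ∘ d n.
    rewrite -[LHS]compm1 -cd Defs.compA -(Defs.compA (d (n + 1))).
    by rewrite -c_nat Defs.compA dc comp1m.
  exact: (cmap_iso (f := t X) (g := @CMap C X (af_cpx G (af_cpx F X)) d dn) dc cd).
apply: deq_trans (deq_comp _ _) _; apply: deq_sym.
apply: deq_trans (deq_comp _ _) _; apply: deq_map => n.
by rewrite /= c_nat.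
Qed.

Lemma inverse_niso_r :
  niso (comp_functor (lift (af_cf Fe)) (lift (af_cf inverse_equivalence)))
    (id_functor (derived_cat D)).
Proof.
pose t X : cmap (af_cpx F (af_cpx G X)) X :=
  @CMap D (af_cpx F (af_cpx G X)) X (fun n => a (X n)) (fun n => a_nat (cdiff X n)).
apply: (@niso_derived D (derived_cat D)
  (comp_functor (lift (af_cf Fe)) (lift (af_cf inverse_equivalence)))
  (id_functor (derived_cat D)) (fun X => DMap (t X))) => [X|X Y f].
  have bn n : b (X (n + 1)) ∘ cdiff X n = cdiff (af_cpx F (af_cpx G X)) n ∘ b (X n).
    by rewrite /= GE -!Defs.compA ab compm1.
  exact: (cmap_iso (f := t X) (g := @CMap D X (af_cpx F (af_cpx G X)) (fun n => b (X n)) bn)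
    (fun n => ba (X n)) (fun n => ab (X n))).
apply: deq_trans (deq_comp _ _) _; apply: deq_sym.
apply: deq_trans (deq_comp _ _) _; apply: deq_map => n.
by rewrite /= a_nat.
Qed.

End WithInverse.

Theorem add_equivalence_triangle :
  triangle_equivalent (Db C) (Db D) /\ triangle_equivalent (Db D) (Db C).
Proof.
have [G [a [b [ab ba GE]]]] := add_inverse Fe.
have l := inverse_niso_l ab ba GE; have r := inverse_niso_r ab ba GE.
split.
  exists (lift (af_cf Fe)); split; last exact: af_triangle.
  by exists (lift (af_cf (inverse_equivalence ab ba GE))); split.
exists (lift (af_cf (inverse_equivalence ab ba GE))); split; last exact: af_triangle.
by exists (lift (af_cf Fe)); split.
Qed.

Theorem hereditary_transfer : is_hereditary C -> is_hereditary D.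
Proof.
move=> hC i X Y i2 cX cY u v.
have [G [a [b [ab ba GE]]]] := add_inverse Fe.
apply: (niso_faithful (inverse_niso_r ab ba GE)).
have Gconc n (Z : cpx D) : concentrated n Z -> concentrated n (af_cpx G Z).
  by move=> cZ j jn; rewrite /is_zero -(afmap1 G) (cZ j jn) afmap0.
exact: hC i2 (Gconc _ _ cX) (Gconc _ _ cY) _ _.
Qed.

End EquivalenceTheorems.

(** * Homotopies *)

Section Homotopy.
Variables (k : fieldType) (S : shape).
Local Notation R := (rep_cat k S).
Implicit Types X Y : cpx R.

Section Cylinder.
Variable X : cpx R.

Definition cyl_obj (n : int) : R := rep_sum (X (n + 1)) (rep_sum (X n) (X n)).

Definition cyl_diff_fun n v (x : cyl_obj n v) : cyl_obj (n + 1) v :=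
  (- rfun (cdiff X (n + 1)) v x.1,
    (x.1 + rfun (cdiff X n) v x.2.1, - x.1 + rfun (cdiff X n) v x.2.2)).
Fact cyl_diff_linear n v : linear (@cyl_diff_fun n v).
Proof.
move=> a x y; rewrite /cyl_diff_fun /= !rfun_linear.
congr (_, (_, _)); rewrite /=.
- by rewrite opprD scalerN.
- by rewrite scalerDr addrACA.
- by rewrite opprD scalerDr scalerN addrACA.
Qed.
Fact cyl_diff_nat n u v x : cyl_diff_fun (rmap (cyl_obj n) u v x)
  = rmap (cyl_obj (n + 1)) u v (@cyl_diff_fun n u x).
Proof.
rewrite /cyl_diff_fun /= /sum_map /= /sum_map /=.
by rewrite rmapN !rmapD rmapN !rfun_nat.
Qed.
Definition cyl_diff n : hom (cyl_obj n) (cyl_obj (n + 1)) :=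
  RepHom (@cyl_diff_linear n) (@cyl_diff_nat n).

Fact cyl_diff2 n : cyl_diff (n + 1) ∘ cyl_diff n = 0.
Proof.
apply: rep_homP => v [a [b c]]; rewrite /= /cyl_diff_fun /=.
by rewrite rfunN !rfunD rfunN !cdiff2E !addr0 !addNr !oppr0.
Qed.

Fact cyl_bound :
  exists N : nat, forall n : int, (N < `|n|)%N -> is_zero (cyl_obj n).
Proof.
have [N hN] := cbound X; exists N.+1 => n hn; apply/is_zero_repP => v [a [b c]].
have /is_zero_repP h1 : is_zero (X (n + 1)) by apply: hN; lia.
have /is_zero_repP h2 : is_zero (X n) by apply: hN; lia.
by congr (_, (_, _)); [apply: h1|apply: h2|apply: h2].
Qed.

Definition cyl : cpx R := @Cpx R cyl_obj cyl_diff cyl_diff2 cyl_bound.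

Definition cyl_end_fun (b : bool) n v (x : X n v) : cyl n v :=
  (0, if b then (x, 0) else (0, x)).
Fact cyl_end_linear b n v : linear (@cyl_end_fun b n v).
Proof.
move=> a x y; rewrite /cyl_end_fun; case: b; congr (_, (_, _));
  by rewrite /= ?scaler0 ?addr0.
Qed.
Fact cyl_end_nat b n u v x :
  cyl_end_fun b (rmap (X n) u v x) = rmap (cyl n) u v (@cyl_end_fun b n u x).
Proof.
by rewrite /cyl_end_fun; case: b; rewrite /= /sum_map /= /sum_map /= !rmap0.
Qed.
Fact cyl_end_subproof b n :
  (RepHom (@cyl_end_linear b (n + 1)) (@cyl_end_nat b (n + 1))
     : hom (X (n + 1)) (cyl (n + 1))) ∘ cdiff X n
  = cdiff cyl n ∘ RepHom (@cyl_end_linear b n) (@cyl_end_nat b n).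
Proof.
apply: rep_homP => v x; rewrite /= /cyl_end_fun /= /cyl_diff_fun /=.
by case: b; rewrite /= !rfun0 !oppr0 !add0r.
Qed.
Definition cyl_end b : cmap X cyl :=
  @CMap R X cyl (fun n => RepHom (@cyl_end_linear b n) (@cyl_end_nat b n))
    (cyl_end_subproof b).

Definition cyl_proj_fun n v (x : cyl n v) : X n v := x.2.1 + x.2.2.
Fact cyl_proj_linear n v : linear (@cyl_proj_fun n v).
Proof. by move=> a x y; rewrite /cyl_proj_fun /= scalerDr addrACA. Qed.
Fact cyl_proj_nat n u v x :
  cyl_proj_fun (rmap (cyl n) u v x) = rmap (X n) u v (@cyl_proj_fun n u x).
Proof. by rewrite /cyl_proj_fun rmapD. Qed.
Fact cyl_proj_subproof n :
  (RepHom (@cyl_proj_linear (n + 1)) (@cyl_proj_nat (n + 1))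
     : hom (cyl (n + 1)) (X (n + 1))) ∘ cdiff cyl n
  = cdiff X n ∘ RepHom (@cyl_proj_linear n) (@cyl_proj_nat n).
Proof.
apply: rep_homP => v x; rewrite /= /cyl_proj_fun /= rfunD.
by rewrite addrACA subrr add0r.
Qed.
Definition cyl_proj : cmap cyl X :=
  @CMap R cyl X (fun n => RepHom (@cyl_proj_linear n) (@cyl_proj_nat n))
    cyl_proj_subproof.

Lemma cyl_proj_qis : is_qis cyl_proj.
Proof.
apply: elt_qis_is_qis => n v; split.
  move=> [a [b c]] /(congr1 (fun x => x.2.1)) /= db [y ey].
  exists (b, (0, y)); rewrite /= /cyl_diff_fun /= rfun0 addr0.
  rewrite /= /cyl_proj_fun /= in ey.
  congr (_, (_, _)) => //; rewrite /=.
    by apply/eqP; rewrite -addr_eq0; apply/eqP.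
  by rewrite -ey addrA addNr add0r.
move=> y dy; exists (rfun (cyl_end true (n + 1)) v y), 0; split.
  by rewrite /= /cyl_end_fun /cyl_diff_fun /= dy !rfun0 !oppr0 !addr0.
by rewrite rfun0 /= /cyl_proj_fun /= !addr0.
Qed.

Lemma cyl_ends : deq (DMap (cyl_end true)) (DMap (cyl_end false)).
Proof.
suff e b : deq (DMap (cyl_end b)) (DInv cyl_proj_qis).
  by apply: deq_trans (e true) (deq_sym (e false)).
apply: deq_trans (deq_sym (deq_idl _)) _.
apply: deq_trans (deq_congr (deq_sym (deq_invl cyl_proj_qis)) (deq_refl _)) _.
apply: deq_trans (deq_sym (deq_assoc _ _ _)) _.
apply: deq_trans (deq_congr (deq_refl _) (deq_comp _ _)) _.
apply: deq_trans (deq_idr _).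
apply: deq_congr (deq_refl _) _; apply: deq_map => n; apply: rep_homP => v x.
by rewrite /= /cyl_proj_fun /=; case: b; rewrite /= ?addr0 ?add0r.
Qed.

End Cylinder.

(** A homotopy is a map out of the cylinder, and the two ends of the cylinder are
    equal in the derived category, being inverted by the same projection. *)
Lemma homotopic_deq X Y (f g : cmap X Y) (h : forall n, hom (X (n + 1)) (Y n)) :
  (forall n v (x : rspace (X (n + 1)) v), rfun (f (n + 1)) v x
     = rfun (g (n + 1)) v x + rfun (cdiff Y n) v (rfun (h n) v x)
       + rfun (h (n + 1)) v (rfun (cdiff X (n + 1)) v x)) ->
  deq (DMap f) (DMap g).
Proof.
move=> fgh.
have cancel (V : zmodType) (p q r s t : V) :
    - p + (q + r + p + s + (- q + t)) = r + (s + t).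
  apply: (addrI p); rewrite addrA subrr add0r addrACA [RHS]addrA; congr (_ + _).
  by rewrite addrAC [q + r]addrC addrK addrC.
pose H n v (x : cyl X n v) : Y n v :=
  rfun (h n) v x.1 + (rfun (f n) v x.2.1 + rfun (g n) v x.2.2).
have Hl n v : linear (@H n v).
  move=> a x y; rewrite /H /= !rfun_linear !scalerDr.
  by rewrite [RHS]addrACA; congr (_ + _); exact: addrACA.
have Hn n u v x : @H n v (rmap (cyl X n) u v x) = rmap (Y n) u v (@H n u x).
  by rewrite /H /= !rmapD !rfun_nat.
have Hd n : (RepHom (@Hl (n + 1)) (@Hn (n + 1)) : hom (cyl X (n + 1)) (Y (n + 1)))
    ∘ cdiff (cyl X) n = cdiff Y n ∘ RepHom (@Hl n) (@Hn n).
  apply: rep_homP => v [a [b c]]; rewrite /= /H /= !rfunD rfunN (fgh n v a) rfunN !cfunE.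
  exact: cancel.
pose Hm := @CMap R (cyl X) Y (fun n => RepHom (@Hl n) (@Hn n)) Hd.
have He b : deq (DComp (DMap Hm) (DMap (cyl_end X b))) (DMap (if b then f else g)).
  apply: deq_trans (deq_comp _ _) _; apply: deq_map => n; apply: rep_homP => v x.
  by rewrite /= /H /=; case: b; rewrite /= !rfun0 add0r ?addr0 ?add0r.
apply: deq_trans (deq_sym (He true)) (deq_trans _ (He false)).
exact: deq_congr (deq_refl _) (cyl_ends X).
Qed.

End Homotopy.

(** * Representations of forests are hereditary *)

Import VectorInternalTheory.

(** The spaces have varying dimensions, so their coordinates are padded to a
    common length; the direct sum lies in the functions with values in the padded
    coordinates. *)
Lemma total_space (k : fieldType) (I : finType) (V : I -> vectType k) :
  exists (D : vectType k) (pr : forall v, D -> V v) (inj : forall v, V v -> D),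
  [/\ forall v, linear (pr v), forall v, linear (inj v),
    forall v x, pr v (inj v x) = x,
    forall u v x, u != v -> pr v (inj u x) = 0 &
    forall d, d = \sum_v inj v (pr v d)].
Proof.
pose n := \max_(v : I) dim (V v).
have dn v : (dim (V v) <= n)%N by exact: (leq_bigmax v).
pose E : vectType k := {ffun I -> 'rV[k]_n}.
pose pad v (x : V v) : 'rV[k]_n := v2r x *m pid_mx (dim (V v)).
pose unpad v (y : 'rV[k]_n) : V v := r2v (y *m pid_mx (dim (V v))).
have padl v : linear (pad v).
  by move=> a x y; rewrite /pad linearD linearZ mulmxDl scalemxAl.
have unpadl v : linear (unpad v).
  by move=> a x y; rewrite /unpad mulmxDl -scalemxAl linearD linearZ.
have padK v x : unpad v (pad v x) = x.
  rewrite /pad /unpad -mulmxA pid_mx_id // pid_mx_1 mulmx1; exact: v2rK.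
pose put v (x : V v) : E := [ffun u => if u == v then pad v x else 0].
have putl v : linear (put v).
  move=> a x y; apply/ffunP => u; rewrite !ffunE; case: eqP => _; rewrite ?ffunE ?padl //.
  by rewrite scaler0 addr0.
pose total (e : E) : E := \sum_v put v (unpad v (e v)).
have totall : linear total.
  move=> a x y; rewrite /total scaler_sumr -big_split; apply: eq_bigr => v _.
  by rewrite !ffunE unpadl putl.
pose D : vectType k := subvs_of (limg (mklin totall)).
have totalE e u : total e u = pad u (unpad u (e u)).
  rewrite /total sum_ffunE (bigD1 u) //= big1 ?addr0 => [|v vu].
    by rewrite ffunE eqxx.
  by rewrite ffunE eq_sym (negPf vu).
have putT v x : total (put v x) = put v x.
  apply/ffunP => u; rewrite totalE !ffunE; case: eqP => [->|_]; first by rewrite padK.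
  have : pad u (unpad u 0) = 0; last by [].
  by rewrite /pad /unpad mul0mx !linear0 mul0mx.
pose inj v (x : V v) : D := vsproj _ (put v x).
have injE v x : vsval (inj v x) = put v x.
  rewrite /inj vsprojK // -putT.
  by have := memv_img (mklin totall) (memvf (put v x)); rewrite mklinE.
pose pr v (d : D) : V v := unpad v (vsval d v).
have prl v : linear (pr v).
  by move=> a x y; rewrite /pr linearP !ffunE unpadl.
have injl v : linear (inj v).
  by move=> a x y; apply: subvs_inj; rewrite linearP /= !injE putl.
exists D, pr, inj; split=> //.
- by move=> v x; rewrite /pr injE ffunE eqxx padK.
- move=> u v x uv; rewrite /pr injE ffunE eq_sym (negPf uv).
  by rewrite /unpad mul0mx linear0.
move=> d; apply: subvs_inj; rewrite raddf_sum /=.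
have /memv_imgP[e _ ee] := subvsP d.
have {}ee : vsval d = total e by rewrite ee mklinE.
rewrite {1}ee /total; apply: eq_bigr => v _; rewrite injE /pr ee totalE.
by rewrite padK.
Qed.

Section Forest.
Variables (k : fieldType) (S : shape).
Local Notation R := (rep_cat k S).

(** The order is that of a forest of rooted trees with edges pointing away from
    the roots: prev v is the only immediate predecessor of v, and what lies
    strictly below v lies below prev v. The rank allows recursion from the roots
    upwards. *)
Record forest (rank : S -> nat) (prev : S -> option S) : Prop := Forest {
  forest_refl : forall u v : S, below u v -> below v v;
  forest_trans : forall u v w : S, below u v -> below v w -> below u w;
  forest_rank : forall u v : S, below u v -> u != v -> (rank u < rank v)%N;
  forest_prev : forall u v : S, below u v -> u != v ->
    exists p, [/\ prev v = Some p, below u p, below p v & (rank p < rank v)%N] }.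

Variables (rank : S -> nat) (prev : S -> option S).
Hypothesis F : forest rank prev.

Definition mono_rep (K : rep k S) : Prop :=
  forall u v x, below u v -> rmap K u v x = 0 -> x = 0.

Section Lifting.
Variables (V P W W' : vectType k).
Variables (e : P -> V) (f : W -> W') (u : V -> W') (g : P -> W).
Hypotheses (el : linear e) (fl : linear f) (ul : linear u) (gl : linear g).

Lemma linear_lift : (forall x, exists y, u x = f y) ->
  exists h : V -> W, linear h /\ forall x, f (h x) = u x.
Proof.
move=> uf.
pose ff := mklin fl.
exists (fun x => (ff^-1)%VF (u x)); split=> [a x y|x]; first by rewrite ul linearP.
rewrite -[LHS](mklinE fl) limg_lfunVK //; have [y ->] := uf x.
by rewrite -[f y](mklinE fl) memv_img // memvf.
Qed.

(** A lift s that ignores g is corrected on the image of e, through a retraction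
    of e; the correction takes values in the kernel of f. *)
Lemma linear_lift_extend : (forall p, e p = 0 -> p = 0) ->
  (forall x, exists y, u x = f y) -> (forall p, f (g p) = u (e p)) ->
  exists h : V -> W, [/\ linear h, forall x, f (h x) = u x & forall p, h (e p) = g p].
Proof.
move=> einj uf fg; have [s [sl fs]] := linear_lift uf.
pose ee := mklin el.
have eB x y : e (x - y) = e x - e y by rewrite -!(mklinE el) linearB.
have fD x y : f (x + y) = f x + f y by rewrite -!(mklinE fl) linearD.
have fB x y : f (x - y) = f x - f y by rewrite -!(mklinE fl) linearB.
have ker0 : lker ee == 0%VS.
  apply/lker0P => x y; rewrite !mklinE => exy.
  by apply/eqP; rewrite -subr_eq0; apply/eqP/einj; rewrite eB exy subrr.
pose r x : P := (ee^-1)%VF x.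
have re p : r (e p) = p.
  by rewrite /r -[RHS](lker0_lfunK ker0 p) mklinE.
have rl : linear r by move=> a x y; rewrite /r linearP.
pose t p := g p - s (e p).
have tl : linear t.
  by move=> a x y; rewrite /t gl el sl opprD addrACA scalerBr.
exists (fun x => s x + t (r x)); split.
- by move=> a x y; rewrite rl sl tl [a *: (s x + _)]scalerDr; exact: addrACA.
- by move=> x; rewrite fD fB !fs fg subrr addr0.
- by move=> p; rewrite re addrC subrK.
Qed.
End Lifting.

(** Representations with injective structure maps have the lifting property of
    projectives: a lift is extended from the predecessor of a vertex to the
    vertex itself by choosing a complement. *)
Lemma mono_rep_lift (K N N' : rep k S) (f : rep_hom N N') (u : rep_hom K N') :
  mono_rep K -> (forall v x, exists y, u v x = f v y) ->
  exists g : rep_hom K N, forall v x, f v (g v x) = u v x.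
Proof.
move=> Kmono uf.
pose good r (g : forall v, K v -> N v) := [/\ forall v, linear (g v),
  forall v x, (rank v < r)%N -> f v (g v x) = u v x &
  forall w v x, below w v -> (rank v < r)%N ->
    g v (rmap K w v x) = rmap N w v (g w x)].
have step r g : good r g -> exists g', good r.+1 g'.
  move=> [gl gf gn].
  have ext v : exists h : K v -> N v, [/\ linear h,
      rank v = r -> forall x, f v (h x) = u v x &
      rank v = r -> forall p, prev v = Some p -> below p v -> (rank p < r)%N ->
        forall x, h (rmap K p v x) = rmap N p v (g p x)].
    case: (eqVneq (rank v) r) => [rv|/eqP nrv]; last by exists (g v); split.
    have [h0 [h0l fh0]] := linear_lift (@rfun_linear _ _ _ _ f v)
       (@rfun_linear _ _ _ _ u v) (uf v).
    case ep: (prev v) => [p|]; last by exists h0; split.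
    case: (boolP (below p v && (rank p < r)%N)) => [/andP[pv pr]|npv]; last first.
      exists h0; split=> // _ p' [<-] pv pr; by rewrite pv pr in npv.
    have gpl : linear (fun x => rmap N p v (g p x)).
      by move=> a x y; rewrite gl rmap_linear.
    have [||h [hl fh hp]] := linear_lift_extend (@rmap_linear _ _ K p v)
      (@rfun_linear _ _ _ _ f v) (@rfun_linear _ _ _ _ u v) gpl _ (uf v) _.
    - by move=> x; apply: Kmono.
    - by move=> x; rewrite rfun_nat gf // -rfun_nat.
    by exists h; split=> // _ p' [<-].
  pose h v := sval (constructive_indefinite_description (ext v)).
  have hP v := svalP (constructive_indefinite_description (ext v)).
  exists (fun v => if rank v == r then h v else g v); split.
  - by move=> v; case: ifP => _; [have [] := hP v|apply: gl].
  - move=> v x; rewrite ltnS leq_eqVlt; case: eqP => [e _|_ /=]; last exact: gf.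
    by have [_ hf _] := hP v; apply: hf.
  move=> w v x wv; rewrite ltnS leq_eqVlt.
  case: (eqVneq w v) wv x => [->|nwv] wv x; first by rewrite !rmap_id.
  have wr := forest_rank F wv nwv.
  case: eqP => [e _|_ /= vr]; last first.
    by rewrite (ltn_eqF (ltn_trans wr vr)); apply: gn.
  rewrite -[rank w == r](_ : false = _); last by rewrite -e (ltn_eqF wr).
  have [p [ep wp pv pr]] := forest_prev F wv nwv.
  rewrite e in pr; have [_ _ hp] := hP v.
  rewrite -(rmap_comp x wp pv) [LHS](hp e p ep pv pr) gn //.
  by rewrite rmap_comp.
have [g [gl gf gn]] : exists g, good (\max_v rank v).+1 g.
  elim: (\max_v rank v).+1 => [|r [g gr]]; last exact: step gr.
  exists (fun v _ => 0); split=> // v a x y; by rewrite scaler0 addr0.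
have all_lt v : (rank v < (\max_v rank v).+1)%N by rewrite ltnS leq_bigmax.
have gnat w v x : g v (rmap K w v x) = rmap N w v (g w x).
  case: (boolP (below w v)) => wv; first exact: gn.
  rewrite !(rmap_out _ wv).
  exact: (lin0 (gl v)).
by exists (RepHom gl gnat) => v x /=; apply: gf.
Qed.

End Forest.

Section Cover.
Variables (k : fieldType) (S : shape) (rank : S -> nat) (prev : S -> option S).
Hypothesis F : forest rank prev.
Local Notation R := (rep_cat k S).

(** The free representation on the spaces of M: at w it consists of the families
    in the direct sum of all M v that are supported on the v below w. *)
Lemma free_cover (M : rep k S) : exists (P : rep k S) (e : rep_hom P M),
  mono_rep P /\ forall v x, exists y, x = e v y.
Proof.
have [D [pr [inj [prl injl prK pr0 Dsum]]]] := total_space M.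
have prD v x y : pr v (x + y) = pr v x + pr v y by have := prl v 1 x y; rewrite !scale1r.
have pr00 v : pr v 0 = 0 by apply: (addrI (pr v 0)); rewrite -prD !addr0.
have prZ v a x : pr v (a *: x) = a *: pr v x.
  by have := prl v a x 0; rewrite pr00 !addr0.
have prsum v (G : forall u, D) (A : pred S) :
    pr v (\sum_(u | A u) G u) = \sum_(u | A u) pr v (G u).
  by apply: (big_morph (pr v)).
pose c w (d : D) : D := \sum_(v | ~~ below v w) inj v (pr v d).
have cl w : linear (c w).
  move=> a x y; rewrite /c scaler_sumr -big_split; apply: eq_bigr => v _.
  by rewrite prl injl.
pose U w := lker (mklin (cl w)).
have UP w d : d \in U w <-> forall v, ~~ below v w -> pr v d = 0.
  rewrite memv_ker mklinE; split=> [/eqP cd v nv|h].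
    have := congr1 (pr v) cd; rewrite pr00 prsum (bigD1 v) //= prK big1 ?addr0 //.
    by move=> u /andP[_ uv]; exact: pr0.
  apply/eqP; rewrite /c big1 // => v nv; rewrite h //.
  exact: (lin0 (injl v)).
pose m u w (x : subvs_of (U u)) : subvs_of (U w) :=
  if below u w then vsproj (U w) (vsval x) else 0.
have UU u w x : below u w -> vsval (x : subvs_of (U u)) \in U w.
  move=> uw; apply/UP => v nv; have /UP := subvsP x; apply.
  by apply: contra nv => vu; exact: (forest_trans F vu uw).
have mE u w x : below u w -> vsval (m u w x) = vsval x.
  by move=> uw; rewrite /m uw vsprojK // UU.
have ml u w : linear (m u w).
  move=> a x y; rewrite /m; case: ifP => uw; last by rewrite scaler0 addr0.
  by rewrite !linearP.
have U0 w (x : subvs_of (U w)) : ~~ below w w -> x = 0.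
  move=> nw; apply: subvs_inj; rewrite linear0 [LHS]Dsum big1 // => v _.
  have /UP -> := subvsP x; first exact: (lin0 (injl v)).
  by apply: contra nw; apply: (forest_refl F).
have m1 w x : m w w x = x.
  case: (boolP (below w w)) => ww; last by rewrite [LHS]U0 // [RHS]U0.
  by apply: subvs_inj; rewrite mE.
have m0 u w x : ~~ below u w -> m u w x = 0 by rewrite /m => /negPf ->.
have mM u v w x : below u v -> below v w -> m v w (m u v x) = m u w x.
  by move=> h1 h2; apply: subvs_inj; rewrite !mE //; exact: (forest_trans F h1 h2).
pose P := @Rep k S (fun w => subvs_of (U w)) m ml m1 m0 mM.
pose e w (x : P w) : M w := \sum_v rmap M v w (pr v (vsval x)).
have el w : linear (e w).
  move=> a x y; rewrite /e scaler_sumr -big_split; apply: eq_bigr => v _.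
  by rewrite linearP /= prl rmap_linear.
have en u w x : e w (rmap P u w x) = rmap M u w (e u x).
  case: (boolP (below u w)) => uw; last first.
    rewrite (rmap_out _ uw) [in RHS](rmap_out _ uw).
    exact: (lin0 (el w)).
  rewrite /e raddf_sum; apply: eq_bigr => v _ /=; rewrite mE // rmapM uw andbT.
  case: (boolP (below v u)) => vu //=.
  by have /UP -> := subvsP x; rewrite ?rmap0.
exists P, (RepHom el en); split.
  move=> u v x uv /= /(congr1 vsval); rewrite mE // linear0 => x0.
  by apply: subvs_inj; rewrite x0 linear0.
move=> w x; case: (boolP (below w w)) => ww; last first.
  by exists 0; rewrite rfun0 (rspace0 x ww).
have xU : inj w x \in U w.
  by apply/UP => v nv; apply: pr0; apply: contra nv => /eqP <-.
exists (vsproj (U w) (inj w x)); rewrite /= /e vsprojK // (bigD1 w) //= prK rmap_id.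
by rewrite big1 ?addr0 // => v vw; rewrite pr0 1?eq_sym // rmap0.
Qed.

End Cover.

Section TwoTerm.
Variables (k : fieldType) (S : shape).
Local Notation R := (rep_cat k S).
Variables (A B : R) (i : hom B A).

(** The complex B -> A in degrees -1 and 0. *)
Definition two_term_obj (n : int) : R :=
  match n with Posz 0 => A | Negz 0 => B | _ => zero_rep k S end.
Definition two_term_diff (n : int) : hom (two_term_obj n) (two_term_obj (n + 1)) :=
  match n with Negz 0 => i | _ => 0 end.

Fact two_term_diff2 n : two_term_diff (n + 1) ∘ two_term_diff n = 0.
Proof. by case: n => [n|[|n]]; [exact: compm0|exact: comp0m|exact: compm0]. Qed.

Lemma two_term_zero n : n != 0 -> n != -1 -> is_zero (two_term_obj n).
Proof. by case: n => [[|n]|[|n]] // _ _; apply: zero_rep_zero. Qed.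

Fact two_term_bound :
  exists N : nat, forall n : int, (N < `|n|)%N -> is_zero (two_term_obj n).
Proof. by exists 1%N => n hn; apply: two_term_zero; lia. Qed.

Definition two_term : cpx R :=
  @Cpx R two_term_obj two_term_diff two_term_diff2 two_term_bound.

End TwoTerm.

Lemma hom_from_zero (C : preadditive) (X Y : C) (f g : hom X Y) : is_zero X -> f = g.
Proof. by move=> X0; rewrite -[f]compm1 -[g]compm1 X0 !compm0. Qed.

Lemma hom_to_zero (C : preadditive) (X Y : C) (f g : hom X Y) : is_zero Y -> f = g.
Proof. by move=> Y0; rewrite -[f]comp1m -[g]comp1m Y0 !comp0m. Qed.

Lemma int_cases (n : int) : [\/ n = 0, n = -1 | (n != 0) && (n != -1)].
Proof.
case: (eqVneq n 0) => [->|n0]; first by constructor 1.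
by case: (eqVneq n (-1)) => [->|n1]; [constructor 2|constructor 3].
Qed.

Section Resolution.
Variables (k : fieldType) (S : shape) (rank : S -> nat) (prev : S -> option S).
Hypothesis F : forest rank prev.
Local Notation R := (rep_cat k S).

(** Subrepresentations inherit injective structure maps, so the kernel of a
    free cover again has the lifting property: this is where the global
    dimension becomes one. *)
Lemma resolution (X : cpx R) : concentrated 0 X ->
  exists (A B : R) (i : hom B A) (e : cmap (two_term i) X),
  [/\ mono_rep A, mono_rep B & is_qis e].
Proof.
move=> cX.
have [A [e0 [Amono e0s]]] := free_cover F (X 0).
have [B [i [inj im]]] := rep_kernel (e0 : hom (A : R) (X 0)).
have Bmono : mono_rep B.
  move=> u v x uv x0; apply: (inj u); apply: (Amono u v _ uv).
  by rewrite -rfun_nat x0 rfun0.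
pose en n : hom (two_term i n) (X n) :=
  match n with Posz 0 => e0 | _ => 0 end.
have ed n : en (n + 1) ∘ cdiff (two_term i) n = cdiff X n ∘ en n.
  have [e|e|] := int_cases n.
  - by apply: hom_to_zero; apply: cX; rewrite e.
  - rewrite e; change (@comp R B A (X 0) e0 i = cdiff X (Negz 0) ∘ 0); rewrite compm0.
    by apply: rep_homP => v x; apply/im; exists x.
  - by case/andP=> n0 n1; apply: hom_from_zero; apply: two_term_zero.
exists A, B, i, (@CMap R (two_term i) X en ed); split=> //.
apply: elt_qis_is_qis => n v.
have zX j (x : X j v) : j != 0 -> x = 0 by move=> j0; have /is_zero_repP h := cX j j0; apply: h.
have zP j (x : two_term i j v) : j != 0 -> j != -1 -> x = 0.
  by move=> j0 j1; have /is_zero_repP h := two_term_zero A B j0 j1; apply: h.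
case: (eqVneq n (-1)) => [->|n1].
  change (-1) with (Negz 0).
  split=> [x _ [y ey]|y _].
    have /im[z ez] : rfun e0 v x = 0.
      by rewrite [LHS]ey (zX _ y) // rfun0.
    by exists z.
  have [z ez] := e0s v y; exists z, 0; split=> //; by rewrite rfun0 addr0.
split=> [x dx _|y _]; last first.
  exists 0, 0; split; first exact: rfun0.
  by rewrite !rfun0 addr0 (zX _ y) //; apply: contra n1 => h; rewrite -subr_eq0 opprK.
exists 0; rewrite rfun0; case: (eqVneq n (-2)) x dx => [->|n2] x dx; last first.
  apply: zP; first by apply: contra n1 => h; rewrite -subr_eq0 opprK.
  by apply: contra n2 => /eqP h; apply/eqP; apply: (addIr 1); rewrite h.
exact: (inj v x dx).
Qed.

End Resolution.

Section Hereditary.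
Variables (k : fieldType) (S : shape) (rank : S -> nat) (prev : S -> option S).
Hypothesis F : forest rank prev.
Local Notation R := (rep_cat k S).

Section MappingPair.
Variables (X Y : cpx R) (q : cmap Y X) (n : int).

(** This is, up to signs, the differential of the mapping cone of q, which is
    exact when q is a quasi-isomorphism. *)
Definition pair_fun v (y : rep_sum (Y (n + 1)) (X n) v) :
    rep_sum (Y (n + 1 + 1)) (X (n + 1)) v :=
  (rfun (cdiff Y (n + 1)) v y.1, rfun (q (n + 1)) v y.1 + rfun (cdiff X n) v y.2).
Fact pair_linear v : linear (@pair_fun v).
Proof.
move=> a x y; rewrite /pair_fun !rfun_linear.
by congr (_, _); rewrite /= scalerDr addrACA.
Qed.
Fact pair_nat u v y :
  pair_fun (rmap (rep_sum (Y (n + 1)) (X n)) u v y)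
  = rmap (rep_sum (Y (n + 1 + 1)) (X (n + 1))) u v (@pair_fun u y).
Proof. by rewrite /pair_fun /= /sum_map /= rmapD !rfun_nat. Qed.
Definition pair_hom : rep_hom (rep_sum (Y (n + 1)) (X n))
    (rep_sum (Y (n + 1 + 1)) (X (n + 1))) := RepHom pair_linear pair_nat.

(** One lift to the mapping cone has two components: g extends the lift of a
    chain map by one degree, and h is the homotopy from w to q g there. *)
Lemma lift_step (K : R) (z : hom K (Y (n + 1 + 1))) (w : hom K (X (n + 1))) :
  mono_rep K ->
  (forall v x, exists y y', rfun z v x = rfun (cdiff Y (n + 1)) v y /\
    rfun w v x = rfun (q (n + 1)) v y + rfun (cdiff X n) v y') ->
  exists (g : hom K (Y (n + 1))) (h : hom K (X n)),
    z = cdiff Y (n + 1) ∘ g /\ w = q (n + 1) ∘ g + cdiff X n ∘ h.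
Proof.
move=> Kmono zw.
have u_lin v : linear (fun x : rspace K v => (rfun z v x, rfun w v x)).
  by move=> a x y; rewrite !rfun_linear.
have u_nat u v x : (rfun z v (rmap K u v x), rfun w v (rmap K u v x))
    = rmap (rep_sum (Y (n + 1 + 1)) (X (n + 1))) u v (rfun z u x, rfun w u x).
  by rewrite !rfun_nat.
pose u : rep_hom K (rep_sum (Y (n + 1 + 1)) (X (n + 1))) :=
  @RepHom k S K (rep_sum (Y (n + 1 + 1)) (X (n + 1)))
    (fun v x => (rfun z v x, rfun w v x)) u_lin u_nat.
have [|g gP] := mono_rep_lift F (f := pair_hom) (u := u) Kmono.
  by move=> v x; have [y [y' [e1 e2]]] := zw v x; exists (y, y'); rewrite /= e1 e2.
exists (rep_comp (rep_pr1 _ _) g), (rep_comp (rep_pr2 _ _) g).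
by split; apply: rep_homP => v x; have [e1 e2] := gP v x; rewrite /= ?e1 ?e2.
Qed.

End MappingPair.

(** Chain maps from two representations with the lifting property factor through
    quasi-isomorphisms up to homotopy: degree 0 first, then degree - 1. *)
Lemma two_term_lift (A B : R) (i : hom B A) (X Y : cpx R) (q : cmap Y X)
  (f : cmap (two_term i) X) : mono_rep A -> mono_rep B -> is_qis q ->
  exists g : cmap (two_term i) Y, deq (DMap (ccomp q g)) (DMap f).
Proof.
move=> Am Bm /is_qis_elt_qis qq.
pose f0 : hom A (X 0) := f 0.
pose f1 : hom B (X (Negz 0)) := f (Negz 0).
have fi v x : rfun f0 v (rfun i v x) = rfun (cdiff X (Negz 0)) v (rfun f1 v x).
  exact: (rep_ext (cfunP f (Negz 0)) v x).
have df v x : rfun (cdiff X 0) v (rfun f0 v x) = 0.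
  by rewrite -[LHS](rep_ext (cfunP f 0) v x) /= rfun0.
have [|g0 [h0 [dg fg]]] := @lift_step X Y q (Negz 0) A 0 f0 Am.
  move=> v x; have [y [y' [dy ey]]] := (qq (Negz 0) v).2 (rfun f0 v x) (df v x).
  by exists y, y'; split; [exact: esym dy|exact: ey].
have dgE v x : rfun (cdiff Y 0) v (rfun g0 v x) = 0 by rewrite -[LHS](rep_ext dg v x).
have fgE v x : rfun f0 v x
    = rfun (q 0) v (rfun g0 v x) + rfun (cdiff X (Negz 0)) v (rfun h0 v x).
  exact: (rep_ext fg v x).
have [|g1 [h1 [dg1 fg1]]] := @lift_step X Y q (Negz 1) B (g0 ∘ i) (f1 - h0 ∘ i) Bm.
  move=> v x; pose p := rfun i v x.
  have qd : rfun (cdiff X (Negz 0)) v (rfun f1 v x - rfun h0 v p)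
      = rfun (q 0) v (rfun g0 v p).
    by rewrite rfunB -fi fgE addrK.
  have [|y1 ey1] := (qq (Negz 0) v).1 (rfun g0 v p) (dgE v p).
    by exists (rfun f1 v x - rfun h0 v p).
  have [|y2 [y' [dy2 ey2]]] := (qq (Negz 1) v).2
      (rfun f1 v x - rfun h0 v p - rfun (q (Negz 0)) v y1).
    rewrite rfunB; apply/eqP; rewrite subr_eq0; apply/eqP.
    apply: etrans qd _; rewrite ey1; exact: (cfunE q).
  exists (y1 + y2), y'; split.
    rewrite rfunD; apply: etrans ey1 _; rewrite -[LHS]addr0.
    by congr (_ + _); exact: esym dy2.
  rewrite rfunD -[RHS]addrA [RHS]addrC; apply/eqP; rewrite -subr_eq; apply/eqP.
  exact: ey2.
have dg1E v x : rfun g0 v (rfun i v x) = rfun (cdiff Y (Negz 0)) v (rfun g1 v x).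
  exact: (rep_ext dg1 v x).
have fg1E v x : rfun f1 v x - rfun h0 v (rfun i v x)
    = rfun (q (Negz 0)) v (rfun g1 v x) + rfun (cdiff X (Negz 1)) v (rfun h1 v x).
  exact: (rep_ext fg1 v x).
pose g n : hom (two_term i n) (Y n) :=
  match n with Posz 0 => g0 | Negz 0 => g1 | _ => 0 end.
have gd n : g (n + 1) ∘ cdiff (two_term i) n = cdiff Y n ∘ g n.
  case: n => [[|n]|[|[|n]]].
  - by apply: rep_homP => v x; exact: esym (dgE v x).
  - by rewrite [cdiff (two_term i) _]/= compm0 [g _]/= compm0.
  - by apply: rep_homP => v x; exact: dg1E.
  - by rewrite [cdiff (two_term i) _]/= compm0 [g (Negz 1)]/= compm0.
  - by rewrite [cdiff (two_term i) _]/= compm0 [g (Negz _)]/= compm0.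
exists (@CMap R (two_term i) Y g gd); apply: deq_sym.
pose h n : hom (two_term i (n + 1)) (X n) :=
  match n with Negz 0 => h0 | Negz 1 => h1 | _ => 0 end.
apply: (@homotopic_deq k S (two_term i) X f _ h) => n v x.
have [e|e|n01] := int_cases (n + 1).
- have {}e : n = Negz 0 by apply: (addIr 1); rewrite e.
  move: x; rewrite e => x /=; rewrite addr0; exact: fgE.
- have {}e : n = Negz 1 by apply: (addIr 1); rewrite e.
  move: x; rewrite e => x; apply/eqP; rewrite -subr_eq; apply/eqP; exact: fg1E.
- have /andP[n0 n1] := n01; have /is_zero_repP z := two_term_zero A B n0 n1.
  by rewrite (z v x) !rfun0 !addr0.
Qed.

(** Hence every morphism of the derived category out of such a complex is a chain
    map, formal inverses being removed one at a time. *)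
Lemma two_term_strict (A B : R) (i : hom B A) (X Y : cpx R) (a : dhom X Y)
  (f : cmap (two_term i) X) : mono_rep A -> mono_rep B ->
  exists g : cmap (two_term i) Y, deq (DComp a (DMap f)) (DMap g).
Proof.
move=> Am Bm; elim: a f => {X Y} [X Y h|X Y q qP|X Y Z b IHb a IHa] f.
- by exists (ccomp h f); apply: deq_comp.
- have [g eg] := two_term_lift f Am Bm qP; exists g.
  apply: deq_trans (deq_congr (deq_refl _) (deq_sym eg)) _.
  apply: deq_trans (deq_congr (deq_refl _) (deq_sym (deq_comp _ _))) _.
  apply: deq_trans (deq_assoc _ _ _) _.
  exact: deq_trans (deq_congr (deq_invl qP) (deq_refl _)) (deq_idl _).
have [g eg] := IHa f; have [g' eg'] := IHb g; exists g'.
apply: deq_trans (deq_sym (deq_assoc _ _ _)) _.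
exact: deq_trans (deq_congr (deq_refl _) eg) eg'.
Qed.

(** A morphism from M to N[j] becomes a chain map from a complex living in degrees
    - 1 and 0 to one living in degree - j, which is zero for j >= 2. *)
Theorem forest_hereditary : is_hereditary R.
Proof.
move=> j X Y j2 cX cY a b.
have [A [B [i [e [Am Bm eq]]]]] := resolution F cX.
have [g eg] := two_term_strict a e Am Bm.
have [g' eg'] := two_term_strict b e Am Bm.
have gg n : g n = g' n.
  have [en|en|/andP[n0 n1]] := int_cases n.
  - by apply: hom_to_zero; apply: cY; rewrite en; lia.
  - by apply: hom_to_zero; apply: cY; rewrite en; lia.
  - by apply: hom_from_zero; apply: two_term_zero.
have ae : deq (DComp a (DMap e)) (DComp b (DMap e)).
  by apply: deq_trans eg _; apply: deq_trans (deq_map gg) (deq_sym eg').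
have inv (c : dhom X Y) : deq c (DComp (DComp c (DMap e)) (DInv eq)).
  apply: deq_trans (deq_sym (deq_idr _)) _.
  apply: deq_trans (deq_congr (deq_refl _) (deq_sym (deq_invr eq))) _.
  exact: deq_assoc.
apply: deq_trans (inv a) _; apply: deq_trans _ (deq_sym (inv b)).
exact: deq_congr ae (deq_refl _).
Qed.

End Hereditary.

Section SourceForest.
Variables (m N : nat) (N_gt0 : (0 < N)%N).

Definition source_rank (v : source_shape m N) : nat :=
  match v with Some (inr j) => j | Some (inl _) => 1 | None => 0 end.
Definition source_prev (v : source_shape m N) : option (source_shape m N) :=
  match v with
  | Some (inr j) => if j == 0%N :> nat then None else
      Some (Some (inr (Ordinal (leq_ltn_trans (leq_pred j) (ltn_ord j)))))
  | Some (inl _) => Some (Some (inr (center N_gt0)))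
  | None => None
  end.

Lemma source_forest : forest source_rank source_prev.
Proof.
split.
- by move=> [[i|j]|] [[i'|j']|] //=.
- move=> [[i|j]|] [[i'|j']|] [[i''|j'']|] //=.
  + by move=> /eqP -> /eqP ->.
  + by move=> jj /eqP j'0; move: jj; rewrite j'0 leqn0.
  + exact: leq_trans.
- move=> [[i|j]|] [[i'|j']|] //=.
  + by move=> /eqP ->; rewrite eqxx.
  + by move=> /eqP ->.
  + move=> jj ne; rewrite ltn_neqAle jj andbT.
    by apply: contra ne => /eqP h; apply/eqP; do 2 f_equal; apply: val_inj.
move=> [[i|j]|] [[i'|j']|] //=.
- by move=> /eqP->; rewrite eqxx.
- by move=> j0 _; exists (Some (inr (center N_gt0))); split=> //=; lia.
move=> jj ne; have jj' : (j < j')%N.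
  rewrite ltn_neqAle jj andbT.
  by apply: contra ne => /eqP h; apply/eqP; do 2 f_equal; apply: val_inj.
exists (Some (inr (Ordinal (leq_ltn_trans (leq_pred j') (ltn_ord j'))))).
by split; rewrite /=; [case: eqP => //; lia|lia|lia|lia].
Qed.

End SourceForest.

(** * Modules over thin algebras *)

Section Thin.
Variables (k : fieldType) (A : algType k) (S : shape).

(** The elements tb u v, for u below v, form a basis of A, with coordinate
    functions tc u v; their products are those of a category with at most one
    nonzero morphism between two objects up to scalars. *)
Record thin := Thin {
  tb : S -> S -> A;
  tc : S -> S -> A -> k;
  thin_refl : forall u v : S, below u v -> below u u && below v v;
  tc_linear : forall u v c a b, tc u v (c *: a + b) = c * tc u v a + tc u v b;
  tb_out : forall u v, ~~ below u v -> tb u v = 0;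
  tbM : forall u v v' w, tb u v * tb v' w
    = if [&& v == v', below u v & below v w] then tb u w else 0;
  tb1 : 1 = \sum_v tb v v;
  tb_sum : forall a, a = \sum_u \sum_v tc u v a *: tb u v;
  tc_tb : forall u v u' v', tc u v (tb u' v')
    = [&& u == u', v == v' & below u v]%:R }.

Variable T : thin.
Local Notation b := (tb T).
Local Notation c := (tc T).

Lemma thin_finite_dim : finite_dim_alg A.
Proof.
pose s := [seq b p.1 p.2 | p <- enum {: S * S}].
exists s => x; exists (fun i => [seq c p.1 p.2 x | p <- enum {: S * S}]`_i).
rewrite {1}(tb_sum T x) pair_bigA /=.
rewrite -(big_enum _ _ _ (fun p : S * S => c p.1 p.2 x *: b p.1 p.2)) /=.
rewrite /s; elim: (enum _) => [|p e IH]; first by rewrite big_nil big_ord0.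
by rewrite big_cons big_ord_recl /= IH.
Qed.

Lemma tcD u v x y : c u v (x + y) = c u v x + c u v y.
Proof. by rewrite -[x]scale1r tc_linear mul1r scale1r. Qed.
Lemma tc0 u v : c u v 0 = 0.
Proof. by apply: (addrI (c u v 0)); rewrite -tcD !addr0. Qed.
Lemma tcZ u v a x : c u v (a *: x) = a * c u v x.
Proof. by rewrite -[a *: x]addr0 tc_linear tc0 addr0. Qed.
Lemma tc_sum u v (I : finType) (G : I -> A) :
  c u v (\sum_i G i) = \sum_i c u v (G i).
Proof. by apply: (big_morph (c u v)) => [x y|]; rewrite ?tcD ?tc0. Qed.

Lemma tc_one u v : c u v 1 = ((u == v) && below u v)%:R.
Proof.
rewrite (tb1 T) tc_sum (bigD1 u) //= big1 ?addr0 => [|w wu].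
  by rewrite tc_tb eqxx eq_sym.
by rewrite tc_tb eq_sym (negPf wu).
Qed.

Lemma tc_tb_mul u w u' v y : below u w -> c u w (b u' v * y)
  = if [&& u' == u, below u v & below v w] then c v w y else 0.
Proof.
move=> uw.
have -> : c u w (b u' v * y)
    = \sum_v' \sum_w' c v' w' y * c u w (b u' v * b v' w').
  rewrite {1}(tb_sum T y) mulr_sumr tc_sum; apply: eq_bigr => v' _.
  rewrite mulr_sumr tc_sum; apply: eq_bigr => w' _.
  by rewrite -scalerAr tcZ.
rewrite [LHS](bigD1 v) //= [X in _ + X]big1 => [|v' vv']; last first.
  by rewrite big1 // => w' _; rewrite tbM eq_sym (negPf vv') tc0 mulr0.
rewrite addr0 [LHS](bigD1 w) //= [X in _ + X]big1 => [|w' ww']; last first.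
  rewrite tbM; case: ifP => _; rewrite ?tc0 ?mulr0 // tc_tb.
  by rewrite [w == _]eq_sym (negPf ww') andbF mulr0.
rewrite addr0 tbM eqxx [u' == _]eq_sym /=.
case: (eqVneq u u') => [<-|uu'] /=.
  by case: ifP => _; rewrite ?tc0 ?mulr0 // tc_tb !eqxx uw mulr1.
by case: ifP => _; rewrite ?tc0 ?mulr0 // tc_tb (negPf uu') mulr0.
Qed.

Lemma tc_mul u w x y : below u w -> c u w (x * y)
  = \sum_v (if below u v && below v w then c u v x * c v w y else 0).
Proof.
move=> uw.
have -> : c u w (x * y) = \sum_u' \sum_v c u' v x * c u w (b u' v * y).
  rewrite {1}(tb_sum T x) mulr_suml tc_sum; apply: eq_bigr => u' _.
  rewrite mulr_suml tc_sum; apply: eq_bigr => v _.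
  by rewrite -scalerAl tcZ.
rewrite [LHS](bigD1 u) //= [X in _ + X]big1 => [|u' uu']; last first.
  by rewrite big1 // => v _; rewrite tc_tb_mul // (negPf uu') mulr0.
rewrite addr0; apply: eq_bigr => v _; rewrite tc_tb_mul // eqxx /=.
by case: ifP => _; rewrite ?mulr0.
Qed.

Section Module.
Variable M : rep k S.

Let dsum := constructive_indefinite_description (total_space M).
Definition th_space : vectType k := sval dsum.
Let dpr := constructive_indefinite_description (svalP dsum).
Definition th_pr : forall v, th_space -> M v := sval dpr.
Let dinj := constructive_indefinite_description (svalP dpr).
Definition th_inj : forall v, M v -> th_space := sval dinj.

Lemma th_pr_linear v : linear (th_pr v).
Proof. by case: (svalP dinj) => h _ _ _ _; apply: h. Qed.
Lemma th_inj_linear v : linear (@th_inj v).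
Proof. by case: (svalP dinj) => _ h _ _ _; apply: h. Qed.
HB.instance Definition _ v := GRing.isLinear.Build k th_space (M v) _ (th_pr v)
  (th_pr_linear v).
HB.instance Definition _ v := GRing.isLinear.Build k (M v) th_space _ (@th_inj v)
  (@th_inj_linear v).
Lemma th_prK v x : th_pr v (th_inj x) = x.
Proof. by case: (svalP dinj) => _ _ h _ _; apply: h. Qed.
Lemma th_pr0 u v (x : M u) : u != v -> th_pr v (th_inj x) = 0.
Proof. by case: (svalP dinj) => _ _ _ h _; apply: h. Qed.
Lemma th_sum d : d = \sum_v th_inj (th_pr v d).
Proof. by case: (svalP dinj) => _ _ _ _ h; apply: h. Qed.

Lemma th_ext d d' : (forall v, th_pr v d = th_pr v d') -> d = d'.
Proof.
by move=> e; rewrite (th_sum d) (th_sum d'); apply: eq_bigr => v _; rewrite e.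
Qed.

Lemma th_pr_sum v (G : forall u, M u) : th_pr v (\sum_u th_inj (G u)) = G v.
Proof.
rewrite raddf_sum (bigD1 v) //= th_prK big1 ?addr0 // => u uv; exact: th_pr0.
Qed.

(** The module of a representation is the direct sum of its spaces, on which the
    basis element tb u v acts through the structure map from u to v. *)
Definition th_act_fun a d : th_space :=
  \sum_v th_inj (\sum_u c u v a *: rmap M u v (th_pr u d)).

Lemma th_pr_act v a d :
  th_pr v (th_act_fun a d) = \sum_u c u v a *: rmap M u v (th_pr u d).
Proof. exact: th_pr_sum. Qed.

Fact th_act_linear a : linear (th_act_fun a).
Proof.
move=> x d d'; apply: th_ext => v; rewrite linearP /= !th_pr_act.
rewrite scaler_sumr -big_split; apply: eq_bigr => u _ /=.
by rewrite linearP rmap_linear scalerDr !scalerA mulrC.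
Qed.
Definition th_act a : 'End(th_space) := mklin (th_act_linear a).

Fact th_actP x a a' : th_act (x *: a + a') = x *: th_act a + th_act a'.
Proof.
apply/lfunP => d; rewrite add_lfunE scale_lfunE !mklinE; apply: th_ext => v.
rewrite linearP /= !th_pr_act scaler_sumr -big_split; apply: eq_bigr => u _.
by rewrite /= tc_linear scalerDl scalerA.
Qed.

Fact th_act1 : th_act 1 = \1%VF.
Proof.
apply/lfunP => d; rewrite mklinE id_lfunE; apply: th_ext => v.
rewrite th_pr_act (bigD1 v) //= big1 ?addr0 => [|u uv]; last first.
  by rewrite tc_one (negPf uv) scale0r.
rewrite tc_one eqxx rmap_id /=; case: (boolP (below v v)) => vv; first by rewrite scale1r.
by rewrite [RHS](rspace0 _ vv) scale0r.
Qed.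

Fact th_actM a a' : th_act (a * a') = (th_act a' \o th_act a)%VF.
Proof.
apply/lfunP => d; rewrite comp_lfunE !mklinE; apply: th_ext => w; rewrite !th_pr_act.
under [RHS]eq_bigr => v _ do rewrite th_pr_act raddf_sum scaler_sumr.
rewrite exchange_big; apply: eq_bigr => u _ /=.
case: (boolP (below u w)) => uw; last first.
  rewrite (rmap_out _ uw) scaler0 big1 // => v _.
  by rewrite linearZ /= rmapM (rmap_out _ uw) if_same !scaler0.
rewrite (tc_mul _ _ uw) scaler_suml; apply: eq_bigr => v _.
rewrite linearZ /= rmapM; case: ifP => _; last by rewrite !scaler0 scale0r.
by rewrite !scalerA mulrC.
Qed.

Definition th_module : rmodule A := RModule th_actP th_act1 th_actM.

Lemma th_act_tb u v d : th_act (b u v) d = th_inj (rmap M u v (th_pr u d)).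
Proof.
rewrite mklinE; apply: th_ext => w; rewrite th_pr_act.
rewrite (bigD1 u) //= big1 ?addr0 => [|u' uu']; last first.
  by rewrite tc_tb (negPf uu') scale0r.
rewrite tc_tb eqxx /=; case: (eqVneq w v) => [->|wv] /=; last first.
  by rewrite scale0r th_pr0 // eq_sym.
rewrite th_prK; case: (boolP (below u v)) => uv; first by rewrite scale1r.
by rewrite (rmap_out _ uv) scaler0.
Qed.

End Module.

Lemma mod_hom_ext (P Q : rmodule A) (f g : mod_hom P Q) :
  (forall x, mfun f x = mfun g x) -> f = g.
Proof. by move=> e; apply: val_inj; apply/lfunP. Qed.

Section Morphism.
Variables (M N : rep k S) (f : rep_hom M N).

Definition th_map_fun (d : th_space M) : th_space N :=
  \sum_v th_inj (f v (th_pr v d)).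
Fact th_map_linear : linear th_map_fun.
Proof.
move=> x d d'; apply: th_ext => v; rewrite linearP /= !th_pr_sum.
by rewrite linearP rfun_linear.
Qed.
Fact th_map_subproof : mklin th_map_linear \in @is_mod_hom k A (th_module M) (th_module N).
Proof.
apply/asboolP => a; apply/lfunP => d; rewrite !comp_lfunE !mklinE.
apply: th_ext => v; rewrite th_pr_sum !th_pr_act raddf_sum; apply: eq_bigr => u _ /=.
by rewrite th_pr_sum linearZ /= rfun_nat.
Qed.
Definition th_map : mod_hom (th_module M) (th_module N) := ModHom th_map_subproof.

Lemma th_mapE v d : th_pr v (mfun th_map d) = f v (th_pr v d).
Proof. by rewrite /= mklinE th_pr_sum. Qed.

End Morphism.

Fact th_map1 M : th_map (rep_id M) = mod_id (th_module M).
Proof. by apply: mod_hom_ext => d; apply: th_ext => v; rewrite th_mapE /= id_lfunE. Qed.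
Fact th_mapM M N P (g : rep_hom N P) (f : rep_hom M N) :
  th_map (rep_comp g f) = mod_comp (th_map g) (th_map f).
Proof.
apply: mod_hom_ext => d; apply: th_ext => v; rewrite th_mapE /= comp_lfunE.
by rewrite -[mklin _ (mklin _ d)]/(mfun (th_map g) (mfun (th_map f) d)) !th_mapE.
Qed.
Fact th_mapD M N (f g : rep_hom M N) : th_map (f + g) = th_map f + th_map g.
Proof.
apply: mod_hom_ext => d; apply: th_ext => v; rewrite th_mapE /= add_lfunE.
rewrite raddfD /= -[X in X + _](th_mapE f) -[X in _ + X](th_mapE g) //.
Qed.

Definition th_functor : additive_functor (rep_cat k S) (mod_cat A) :=
  @AdditiveFunctor (rep_cat k S) (mod_cat A) th_module th_map th_map1 th_mapM th_mapD.

Lemma mod_isom (P Q : rmodule A) (f : mod_hom P Q) (g : Q -> P) : linear g ->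
  (forall x, g (mfun f x) = x) -> (forall y, mfun f (g y) = y) ->
  @is_isom (mod_cat A) P Q f.
Proof.
move=> gl gf fg.
have gm : mklin gl \in @is_mod_hom k A Q P.
  apply/asboolP => a; apply/lfunP => y; rewrite !comp_lfunE !mklinE.
  have /asboolP/(_ a)/lfunP/(_ (g y)) := mfunP f.
  by rewrite !comp_lfunE fg => <-; rewrite gf.
exists (ModHom gm); split; apply: mod_hom_ext => x; rewrite /= comp_lfunE id_lfunE.
  by rewrite mklinE gf.
by rewrite mklinE fg.
Qed.

Lemma th_full M N (g : mod_hom (th_module M) (th_module N)) :
  exists f : rep_hom M N, th_map f = g.
Proof.
have gact a d : mfun g (th_act M a d) = th_act N a (mfun g d).
  have /asboolP/(_ a)/lfunP/(_ d) := mfunP g.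
  by rewrite !comp_lfunE.
pose f v (x : M v) : N v := th_pr v (mfun g (th_inj x)).
have fl v : linear (f v) by move=> a x y; rewrite /f !linearP.
have fn u v x : f v (rmap M u v x) = rmap N u v (f u x).
  rewrite /f -{1}(th_prK x) -th_act_tb gact th_act_tb.
  by rewrite th_prK.
exists (RepHom fl fn); apply: mod_hom_ext => d; apply: th_ext => v.
rewrite th_mapE /= /f -{1}[th_pr v d]rmap_id -th_act_tb gact th_act_tb th_prK.
exact: rmap_id.
Qed.

Lemma th_faithful M N (f g : rep_hom M N) : th_map f = th_map g -> f = g.
Proof.
move=> e; apply: rep_homP => v x.
by rewrite -[x]th_prK -!th_mapE e.
Qed.

Section VertexSpaces.
Variable P : rmodule A.

Lemma act0 x : mact P 0 x = 0.
Proof.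
have -> : mact P 0 = 0; last by rewrite zero_lfunE.
by have := mactP P (-1) 0 0; rewrite !scaleN1r !addNr.
Qed.

Lemma act_tbM u v v' w x : mact P (b v' w) (mact P (b u v) x)
  = if [&& v == v', below u v & below v w] then mact P (b u w) x else 0.
Proof.
by rewrite -comp_lfunE -mactM tbM; case: ifP; rewrite ?act0.
Qed.

Lemma actD a a' x : mact P (a + a') x = mact P a x + mact P a' x.
Proof. by rewrite -[a]scale1r mactP !scale1r add_lfunE. Qed.

Lemma actZ r a x : mact P (r *: a) x = r *: mact P a x.
Proof. by rewrite -[r *: a]addr0 mactP add_lfunE scale_lfunE act0 addr0. Qed.

Lemma act_sum (I : finType) (G : I -> A) x :
  mact P (\sum_i G i) x = \sum_i mact P (G i) x.
Proof. by apply: (big_morph (fun a => mact P a x)) => [a a'|]; rewrite ?actD ?act0. Qed.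

Let U v := limg (mact P (b v v)).

Let UE v x : x \in U v -> mact P (b v v) x = x.
Proof.
move=> /memv_imgP[y _ ->]; rewrite act_tbM eqxx andbb /=.
by case: ifPn => // /(tb_out T) ->; rewrite act0.
Qed.

Let Uact u v x : mact P (b u v) x \in U v.
Proof.
case: (boolP (below u v)) => [uv|/(tb_out T) ->]; last by rewrite act0 mem0v.
have /andP[uu vv] := thin_refl T uv.
have -> : mact P (b u v) x = mact P (b v v) (mact P (b u v) x).
  by rewrite act_tbM eqxx uv vv.
by rewrite memv_img // memvf.
Qed.

(** Conversely the space of a module P at v is the image of the idempotent
    tb v v. *)
Definition vs_map u v (x : subvs_of (U u)) : subvs_of (U v) :=
  vsproj (U v) (mact P (b u v) (vsval x)).
Let vs_mapE u v x : vsval (@vs_map u v x) = mact P (b u v) (vsval x).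
Proof. by rewrite /vs_map vsprojK. Qed.
Fact vs_linear u v : linear (@vs_map u v).
Proof. by move=> a x y; apply: subvs_inj; rewrite vs_mapE !linearP /= !vs_mapE. Qed.
Fact vs_id v x : @vs_map v v x = x.
Proof. by apply: subvs_inj; rewrite vs_mapE UE // subvsP. Qed.
Fact vs_out u v x : ~~ below u v -> @vs_map u v x = 0.
Proof. by move=> h; apply: subvs_inj; rewrite vs_mapE tb_out // act0 linear0. Qed.
Fact vs_comp u v w x : below u v -> below v w ->
  @vs_map v w (@vs_map u v x) = @vs_map u w x.
Proof. by move=> uv vw; apply: subvs_inj; rewrite !vs_mapE act_tbM eqxx uv vw. Qed.

Definition vertex_rep : rep k S := Rep vs_linear vs_id vs_out vs_comp.

Definition vertex_fun (d : th_space vertex_rep) : P :=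
  \sum_v vsval (th_pr v d : subvs_of (U v)).
Fact vertex_linear : linear vertex_fun.
Proof.
move=> a x y; rewrite /vertex_fun scaler_sumr -big_split; apply: eq_bigr => v _.
by rewrite !linearP.
Qed.
Fact vertex_subproof :
  mklin vertex_linear \in @is_mod_hom k A (th_module vertex_rep) P.
Proof.
apply/asboolP => a; apply/lfunP => d; rewrite !comp_lfunE !mklinE.
rewrite /vertex_fun raddf_sum /=.
have -> : \sum_v mact P a (vsval (th_pr v d : subvs_of (U v)))
    = \sum_u \sum_v c u v a *: mact P (b u v) (vsval (th_pr u d : subvs_of (U u))).
  apply: eq_bigr => u _; set y := vsval _.
  have yU : y \in U u by exact: subvsP.
  rewrite {1}(tb_sum T a) act_sum (bigD1 u) //= [X in _ + X]big1 => [|u' uu'].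
    by rewrite addr0 act_sum; apply: eq_bigr => v _; rewrite actZ.
  rewrite act_sum big1 // => v _; rewrite actZ -(UE yU) act_tbM eq_sym (negPf uu').
  by rewrite scaler0.
rewrite exchange_big; apply: eq_bigr => v _ /=.
rewrite th_pr_act raddf_sum; apply: eq_bigr => u _.
rewrite -vs_mapE; exact: linearZ_LR.
Qed.

Lemma vertex_isom : exists f : mod_hom (th_module vertex_rep) P,
  @is_isom (mod_cat A) (th_module vertex_rep) P f.
Proof.
exists (ModHom vertex_subproof).
pose g (y : P) : th_space vertex_rep :=
  \sum_v @th_inj vertex_rep v (vsproj (U v) (mact P (b v v) y)).
have gpr y v : vsval (th_pr v (g y) : subvs_of (U v)) = mact P (b v v) y.
  by rewrite /g th_pr_sum vsprojK.
have gl : linear g.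
  move=> a x y; apply: th_ext => v; rewrite linearP; apply: subvs_inj.
  by rewrite gpr !linearP /= !gpr.
apply: (@mod_isom (th_module vertex_rep) P (ModHom vertex_subproof) g gl) => [d|y].
  apply: th_ext => v; apply: subvs_inj; rewrite gpr /= mklinE /vertex_fun raddf_sum.
  rewrite (bigD1 v) //= [X in _ + X]big1 ?addr0 => [|u uv]; first by rewrite UE // subvsP.
  by rewrite -(UE (subvsP (th_pr u d : subvs_of (U u)))) act_tbM (negPf uv).
rewrite /= mklinE /vertex_fun.
under eq_bigr => v _ do rewrite gpr.
by rewrite -act_sum -(tb1 T) mact1 id_lfunE.
Qed.

End VertexSpaces.

Theorem th_equivalence : is_add_equivalence th_functor.
Proof.
split.
- by move=> M N g; apply: th_full.
- by move=> M N f g; apply: th_faithful.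
by move=> P; have [f fi] := vertex_isom P; exists (vertex_rep P), f.
Qed.

End Thin.

(** * Path algebras of trees *)

Section Graded.
Variables (Q : quiver) (depth : vertex Q -> nat).
Hypothesis depth_tgt : forall a : arrow Q, depth (tgt a) = (depth (src a)).+1.
Implicit Types p q : qpath Q.

Lemma plength_depth p : depth (pend p) = (depth (pstart p) + plength p)%N.
Proof.
case: p => [[v s] /=]; rewrite /pend /pstart /parrows /plength /parrows /=.
elim: s v => [|a s IH] v /=; first by rewrite addn0.
by case/andP=> /eqP <- /IH ->; rewrite depth_tgt addSnnS.
Qed.

Lemma qpath_eq p q : pstart p = pstart q -> parrows p = parrows q -> p = q.
Proof.
case: p => [[v s] hp]; case: q => [[w t] hq]; rewrite /pstart /parrows /= => e e'.
by apply: val_inj; rewrite /= e e'.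
Qed.

(** In a graded quiver a path is determined by its two ends as soon as arrows
    are determined by their source, or by their target. *)
Lemma qpath_uniq_src p q : injective (@src Q) ->
  pstart p = pstart q -> pend p = pend q -> p = q.
Proof.
move=> inj es ee.
have el : plength p = plength q.
  by have := plength_depth p; rewrite ee es plength_depth => /addnI.
apply: qpath_eq => //; move: el es {ee}.
case: p => [[v s] hp]; case: q => [[w t] hq]; rewrite /plength /pstart /parrows /=.
move=> el es; move: hp hq el; rewrite /= -es {w es}.
elim: s t v => [|a s IH] [|b t] v //= /andP[/eqP av hs] /andP[/eqP bv ht] [st].
have ab : a = b by apply: inj; rewrite av bv.
by congr (_ :: _) => //; apply: (IH t (tgt a)) => //; rewrite ab.
Qed.

Lemma qpath_uniq_tgt p q : injective (@tgt Q) ->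
  pstart p = pstart q -> pend p = pend q -> p = q.
Proof.
move=> inj es ee.
have el : plength p = plength q.
  by have := plength_depth p; rewrite ee es plength_depth => /addnI.
apply: qpath_eq => //; move: el ee.
case: p es => [[v s] hp]; case: q => [[w t] hq].
rewrite /plength /pend /pstart /parrows /= => es; move: hp hq; rewrite /= -{w}es.
elim/last_ind: s t => [|s a IH] t; first by case: t.
case/lastP: t => [|t b]; first by rewrite size_rcons.
rewrite !size_rcons !map_rcons !last_rcons -!cats1.
rewrite !walk_cat /= !andbT => /andP[hs /eqP ea] /andP[ht /eqP eb] [st] /inj ab.
by rewrite ab (IH t) // -ea ab.
Qed.

Variable reach : rel (vertex Q).
Hypotheses (reach_refl : forall v, reach v v)
  (reach_step : forall u a, reach u (src a) -> reach u (tgt a))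
  (reach_last : forall u v, reach u v -> u != v ->
     exists a, tgt a = v /\ reach u (src a)).

Lemma path_reach p : reach (pstart p) (pend p).
Proof.
case: p => [[v s] /=]; rewrite /pend /pstart /parrows /=.
suff h u : reach u v -> walk v s -> reach u (last v [seq tgt i | i <- s]) by exact: h.
by elim: s v => [|a s IH] v //= uv /andP[/eqP av]; apply: IH; rewrite -av in uv; apply: reach_step.
Qed.

Lemma reach_path u v : reach u v -> exists p, pstart p = u /\ pend p = v.
Proof.
have [n] := ubnP (depth v); elim: n v => // n IH v; rewrite ltnS => vn uv.
case: (eqVneq u v) => [<-|nuv]; first by exists (trivp u).
have [a [av ua]] := reach_last uv nuv.
have [|p [ps pe]] := IH (src a) _ ua; first by rewrite -av depth_tgt in vn.
have w : walk u (parrows p ++ [:: a]).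
  rewrite walk_cat -{1}ps (valP p) /= -{1}ps -/(pend p) pe eqxx //.
exists (exist _ (u, parrows p ++ [:: a]) w); split=> //.
by rewrite /pend /parrows /= map_cat last_cat /=.
Qed.

End Graded.

Lemma sum_option (V : nmodType) (I : finType) (G : option I -> V) :
  \sum_o G o = G None + \sum_i G (Some i).
Proof.
rewrite (bigD1 None) //=; congr (_ + _).
rewrite (reindex_omap Some id) => [|[i|]] //.
by apply: eq_bigl => i; rewrite eqxx.
Qed.

(** A quotient of a path algebra by paths of certain lengths is thin when paths
    are determined by their ends. The quotient is described by its projection
    pi, so that the path algebra itself and bound_algebra are both instances;
    the vertices of the shape are those of Q, renamed by phi, and None. *)
Section ThinQuiver.
Variables (k : fieldType) (Q : quiver) (depth : vertex Q -> nat) (reach : rel (vertex Q)).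
Hypothesis depth_tgt : forall a : arrow Q, depth (tgt a) = (depth (src a)).+1.
Hypotheses (reach_refl : forall v, reach v v)
  (reach_step : forall u a, reach u (src a) -> reach u (tgt a))
  (reach_last : forall u v, reach u v -> u != v ->
     exists a, tgt a = v /\ reach u (src a)).
Hypothesis path_uniq : forall p q : qpath Q,
  pstart p = pstart q -> pend p = pend q -> p = q.

Variables (A : algType k) (pi : path_algebra k Q -> A) (good : pred nat).
Hypotheses (piP : forall c x y, pi (c *: x + y) = c *: pi x + pi y)
  (piM : forall x y, pi (x * y) = pi x * pi y) (pi1 : pi 1 = 1)
  (pi_surj : forall a, exists x, a = pi x)
  (pi_bad : forall p, ~~ good (plength p) -> pi (path_elt k p) = 0)
  (pi_good : forall x p, good (plength p) -> pi x = 0 -> x@_p = 0)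
  (good0 : good 0%N).

Variables (I : finType) (le : rel (option I)) (phi : I -> vertex Q).
Hypotheses (phi_inj : injective phi) (phi_surj : forall v, exists i, v = phi i)
  (le_None1 : forall u, le None u = false) (le_None2 : forall u, le u None = false)
  (le_Some : forall i j, le (Some i) (Some j)
     = reach (phi i) (phi j) && good (depth (phi j) - depth (phi i))%N).

Lemma thin_quiver : inhabited (thin A (Shape le)).
Proof.
have piD x y : pi (x + y) = pi x + pi y by rewrite -[x]scale1r piP !scale1r.
have pi0 : pi 0 = 0 by apply: (addrI (pi 0)); rewrite -piD !addr0.
have piZ c x : pi (c *: x) = c *: pi x by rewrite -[c *: x]addr0 piP pi0 addr0.
have pathE i j : exists p : qpath Q,
    le (Some i) (Some j) -> pstart p = phi i /\ pend p = phi j.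
  case: (boolP (reach (phi i) (phi j))) => [/(reach_path depth_tgt reach_last)[p hp]|n].
    by exists p.
  by exists (trivp (phi i)); rewrite le_Some (negPf n).
have [pth pth0] : exists f : I -> I -> qpath Q, forall i j,
    le (Some i) (Some j) -> pstart (f i j) = phi i /\ pend (f i j) = phi j.
  by exists (fun i j => sval (constructive_indefinite_description (pathE i j))) => i j;
    case: constructive_indefinite_description.
have pthP i j : le (Some i) (Some j) ->
    [/\ pstart (pth i j) = phi i, pend (pth i j) = phi j & good (plength (pth i j))].
  move=> ij; have := ij; rewrite le_Some => /andP[_ g].
  have [e1 e2] := pth0 _ _ ij.
  by split=> //; move: g; rewrite -e1 -e2 (plength_depth depth_tgt) addKn.
have pth_uniq i j p : pstart p = phi i -> pend p = phi j -> good (plength p) ->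
    le (Some i) (Some j) /\ pth i j = p.
  move=> ep1 ep2 g; have ij : le (Some i) (Some j).
    rewrite le_Some -ep1 -ep2 (path_reach reach_refl reach_step).
    by rewrite (plength_depth depth_tgt) addKn.
  by split=> //; have [e1 e2 _] := pthP _ _ ij; apply: path_uniq; congruence.
pose b (u v : option I) : A := match u, v with
  | Some i, Some j => if le u v then pi (path_elt k (pth i j)) else 0
  | _, _ => 0 end.
have pi_inj x y p : pi x = pi y -> good (plength p) -> x@_p = y@_p.
  move=> e g; have h : (x - y)@_p = 0.
    by apply: pi_good => //; rewrite addrC -scaleN1r piP e scaleN1r addNr.
  by apply/eqP; rewrite -subr_eq0 -mcoeffB; apply/eqP.
pose rep a := sval (constructive_indefinite_description (pi_surj a)).
have repP a : pi (rep a) = a by rewrite /rep; case: constructive_indefinite_description.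
pose c (u v : option I) a : k := match u, v with
  | Some i, Some j => if le u v then (rep a)@_(pth i j) else 0
  | _, _ => 0 end.
have cE i j x : le (Some i) (Some j) -> c (Some i) (Some j) (pi x) = x@_(pth i j).
  move=> ij; rewrite /c ij; apply: pi_inj; first exact: repP.
  by have [] := pthP _ _ ij.
have b_out u v : ~~ le u v -> b u v = 0.
  by case: u v => [i|] [j|] //= /negPf ->.
have c_out u v a : ~~ le u v -> c u v a = 0.
  by case: u v => [i|] [j|] //= /negPf ->.
have refl u v : le u v -> le u u && le v v.
  case: u => [i|]; last by rewrite le_None1.
  case: v => [j|]; last by rewrite le_None2.
  by move=> _; rewrite !le_Some !reach_refl !subnn good0.
have cl u v x a a' : c u v (x *: a + a') = x * c u v a + c u v a'.
  case: (boolP (le u v)) => uv; last by rewrite !c_out // mulr0 addr0.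
  case: u v uv => [i|] [j|] uv; rewrite /c ?mulr0 ?addr0 // uv.
  rewrite -mcoeff_kQZ -mcoeffD; apply: pi_inj; first by rewrite piP !repP.
  by have [] := pthP _ _ uv.
have bE i j : le (Some i) (Some j) -> b (Some i) (Some j) = pi (path_elt k (pth i j)).
  by rewrite /b => ->.
clearbody c.
have bM u v v' w : b u v * b v' w = if [&& v == v', le u v & le v w] then b u w else 0.
  case: (boolP (le u v)) => uv; last by rewrite b_out // mul0r andbF.
  case: (eqVneq v v') => [<-|vv'] /=; last first.
    case: u uv => [i|]; rewrite ?le_None1 //; case: v vv' => [j|]; rewrite ?le_None2 //.
    case: v' => [j'|] jj' ij; last by rewrite /= mulr0.
    case: w => [l|]; last by rewrite /= mulr0.
    rewrite /b ij; case: (boolP (le (Some j') (Some l))) => jl; last by rewrite mulr0.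
    rewrite -piM path_eltM /path_mul /pcat.
    have [_ -> _] := pthP _ _ ij; have [-> _ _] := pthP _ _ jl.
    by case: eqP => [/phi_inj e|_ /=]; [rewrite e eqxx in jj'|exact: pi0].
  case: (boolP (le v w)) => vw; last by rewrite [b v w]b_out // mulr0.
  case: u uv => [i|]; rewrite ?le_None1 //; case: v vw => [j|]; rewrite ?le_None1 //.
  case: w => [l|]; rewrite ?le_None2 // => jl ij.
  rewrite /b ij jl -piM path_eltM /path_mul.
  have [e1 e2 _] := pthP _ _ ij; have [e3 e4 _] := pthP _ _ jl.
  case e: (pcat _ _) => [r|] /=; last by have := pcat_none e; rewrite e2 e3 eqxx.
  have [_ rs re _] := pcat_some e.
  case: (boolP (good (plength r))) => gr.
    by have [il ->] := pth_uniq i l r (etrans rs e1) (etrans re e4) gr; rewrite il.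
  rewrite pi_bad //; case: (boolP (le (Some i) (Some l))) => il //.
  have [f1 f2 f3] := pthP _ _ il.
  suff er : pth i l = r by rewrite er (negPf gr) in f3.
  by apply: path_uniq; congruence.
have b1 : 1 = \sum_v b v v.
  have e1 : (1 : path_algebra k Q) = \sum_v path_elt k (trivp v).
    by change (kQ_one k Q = \sum_v path_elt k (trivp v)); rewrite kQ_one.unlock.
  rewrite -pi1 e1.
  have -> : pi (\sum_v path_elt k (trivp v)) = \sum_v pi (path_elt k (trivp v)).
    exact: (big_morph pi piD pi0).
  rewrite sum_option add0r (reindex phi); last first.
    exists (fun v => sval (constructive_indefinite_description (phi_surj v))).
      by move=> i _; case: constructive_indefinite_description => j /= /phi_inj.
    by move=> v _; case: constructive_indefinite_description.
  apply: eq_bigr => i _ /=; have [ii ->] := pth_uniq i i (trivp (phi i)) erefl erefl good0.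
  by rewrite ii.
have b_c u v u' v' : c u v (b u' v') = [&& u == u', v == v' & le u v]%:R.
  case: (boolP (le u v)) => uv; last by rewrite c_out // !andbF.
  case: u uv => [i|]; rewrite ?le_None1 //; case: v => [j|]; rewrite ?le_None2 // => ij.
  have c0 : c (Some i) (Some j) 0 = 0 by rewrite -pi0 cE // mcoeff0.
  case: u' => [i'|] //; case: v' => [j'|]; rewrite ?andbF //.
  rewrite andbT /b; case: (boolP (le (Some i') (Some j'))) => ij'; last first.
    rewrite c0; case: eqP => //= -[e1]; case: eqP => //= -[e2].
    by rewrite -e1 -e2 ij in ij'.
  rewrite cE // mcoeff_path_elt; congr (nat_of_bool _)%:R.
  have [e1 e2 _] := pthP _ _ ij; have [e3 e4 _] := pthP _ _ ij'.
  apply/eqP/andP => [e|[/eqP[<-] /eqP[<-]]] //.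
  by rewrite -e in e1 e2; split; apply/eqP; congr Some; apply: phi_inj; congruence.
have bs a : a = \sum_u \sum_v c u v a *: b u v.
  have [x ->] := pi_surj a.
  elim/kQ_ind: x => [|x y IHx IHy|z p].
  - rewrite pi0 big1 // => u _; rewrite big1 // => v _.
    by have := cl u v (-1) 0 0; rewrite !scaleN1r !mulN1r !addNr => ->; rewrite scale0r.
  - rewrite piD {1}IHx {1}IHy -big_split; apply: eq_bigr => u _.
    rewrite -big_split; apply: eq_bigr => v _ /=.
    by rewrite -[pi x]scale1r cl mul1r scalerDl scale1r.
  rewrite piZ; case: (boolP (good (plength p))) => gp; last first.
    rewrite pi_bad // scaler0 big1 // => u _; rewrite big1 // => v _.
    by have := cl u v (-1) 0 0; rewrite !scaleN1r !mulN1r !addNr => ->; rewrite scale0r.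
  have [i ei] := phi_surj (pstart p); have [j ej] := phi_surj (pend p).
  have [ij ep] := pth_uniq i j p ei ej gp.
  have pb : pi (path_elt k p) = b (Some i) (Some j) by rewrite bE // ep.
  clearbody b.
  have cz u v y : c u v (z *: y) = z * c u v y.
    rewrite -[z *: y]addr0 cl.
    by have := cl u v (-1) 0 0; rewrite !scaleN1r !mulN1r !addNr => ->; rewrite addr0.
  rewrite (bigD1 (Some i)) //= [X in _ + X]big1 => [|u ui]; last first.
    by rewrite big1 // => v _; rewrite cz pb b_c (negPf ui) mulr0 scale0r.
  rewrite addr0 (bigD1 (Some j)) //= [X in _ + X]big1 => [|v vj]; last first.
    by rewrite cz pb b_c (negPf vj) andbF mulr0 scale0r.
  by rewrite addr0 cz pb b_c !eqxx ij mulr1.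
exact: inhabits (@Thin k A (Shape le) b c refl cl b_out bM b1 bs b_c).
Qed.

End ThinQuiver.

(** * Lambda' and the path algebra of the star *)

Section BoundPaths.
Variables (k : fieldType) (B : bound_quiver).
Implicit Types x y z : path_algebra k B.

Lemma mcoeff_path_mul_long (p q r : qpath B) :
  (plength r < plength p)%N || (plength r < plength q)%N -> (path_mul k p q)@_r = 0.
Proof.
rewrite /path_mul; case e: (pcat p q) => [s|] h /=; last exact: mcoeff0.
have [_ _ _ sa] := pcat_some e.
rewrite mcoeff_path_elt; case: eqP => // sr; move: h.
by rewrite -sr /plength sa size_cat; lia.
Qed.

(** Multiplication of paths does not decrease lengths, so an element of an ideal
    generated by paths of length at least l has no coordinates at shorter
    paths. *)
Lemma mcoeff_ideal_short (l : nat) (x : path_algebra k B) (p : qpath B) :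
  (forall q : qpath B, bq_rel q -> (l <= plength q)%N) -> (plength p < l)%N ->
  x \in @bq_ideal k B -> x@_p = 0.
Proof.
move=> rel_l pl /bq_idealP[s [hs ->]]; rewrite raddf_sum big1_seq // => t /andP[_ ts].
have {hs ts} /rel_l tl := allP hs _ ts.
have right (y : path_algebra k B) (q : qpath B) : (l <= plength q)%N ->
    forall r : qpath B, (plength r < l)%N -> (y * path_elt k q)@_r = 0.
  move=> ql r rl; elim/kQ_ind: y => [|y1 y2 IH1 IH2|a u].
  - by rewrite mul0r mcoeff0.
  - by rewrite mulrDl mcoeffD IH1 IH2 addr0.
  rewrite -scalerAl mcoeff_kQZ path_eltM mcoeff_path_mul_long ?mulr0 //.
  by rewrite (leq_trans rl ql) orbT.
have left (y z : path_algebra k B) :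
    (forall r : qpath B, (plength r < l)%N -> y@_r = 0) ->
    forall r : qpath B, (plength r < l)%N -> (y * z)@_r = 0.
  move=> yl r rl; rewrite (kQ_basis y) mulr_suml raddf_sum big1 // => q _.
  rewrite -scalerAl /= mcoeff_kQZ.
  case: (ltnP (plength q) l) => ql; first by rewrite yl // mul0r.
  elim/kQ_ind: z => [|z1 z2 IH1 IH2|a u].
  - by rewrite mulr0 mcoeff0 mulr0.
  - by rewrite mulrDr mcoeffD mulrDr IH1 IH2 addr0.
  rewrite -scalerAr mcoeff_kQZ path_eltM mcoeff_path_mul_long ?mulr0 //.
  by rewrite (leq_trans rl ql).
by apply: left => // r rl; apply: right.
Qed.

End BoundPaths.

Section LambdaThin.
Variables (k : fieldType) (m n : nat) (hn : (3 <= n)%N).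
Local Notation Q := (Lambda'_quiver m n).

Definition lambda_depth (v : vertex Q) : nat :=
  match v with inl _ => 0 | inr j => (nat_of_ord j).+1 end.
Definition lambda_reach (u v : vertex Q) : bool :=
  match u, v with
  | inl i, inl i' => i == i'
  | inl _, inr _ => true
  | inr j, inr j' => (j <= j')%N
  | inr _, inl _ => false
  end.
Definition lambda_vertex (i : ('I_m + option 'I_(n - 2))%type) : vertex Q :=
  match i with
  | inl i => inl i
  | inr (Some j) => inr (widen_ord (leqnSn (n - 2)) j)
  | inr None => inr ord_max
  end.

Lemma lambda_vertex_inj : injective lambda_vertex.
Proof.
move=> [i|[j|]] [i'|[j'|]] //=.
- by case=> ->.
- by case=> e; do 2 f_equal; apply: val_inj.
- by case=> e; have := ltn_ord j; rewrite e ltnn.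
- by case=> e; have := ltn_ord j'; rewrite -e ltnn.
Qed.

Lemma lambda_vertex_surj v : exists i, v = lambda_vertex i.
Proof.
case: v => [i|j]; first by exists (inl i).
case: (ltnP j (n - 2)) => h.
  by exists (inr (Some (Ordinal h))); congr inr; apply: val_inj.
exists (inr None); congr inr; apply: val_inj => /=.
by have := ltn_ord j; lia.
Qed.

(** Depths range from 0 at the vertices i' to n - 1 at the vertex n, so no path
    is longer than n - 1. Those of length n - 1 are the relations, and modulo
    them the shorter paths form a basis. *)
Lemma lambda_thin : inhabited (thin (Lambda' k m n (n - 1)) (line_shape m (n - 2))).
Proof.
pose B := Lambda'_bound m n (n - 1).
have depth_tgt (a : arrow Q) : lambda_depth (tgt a) = (lambda_depth (src a)).+1.
  by case: a.
have depth_le (v : vertex Q) : (lambda_depth v <= n - 1)%N.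
  by case: v => //= j; have := ltn_ord j; lia.
have reach_refl v : lambda_reach v v by case: v => /=.
have reach_step u (a : arrow Q) : lambda_reach u (src a) -> lambda_reach u (tgt a).
  by case: u => [i|j]; case: a => [i'|j'] //=; rewrite /bump; lia.
have reach_last u v : lambda_reach u v -> u != v ->
    exists a : arrow Q, tgt a = v /\ lambda_reach u (src a).
  case: v => [i'|[[|j'] hj']].
  - by case: u => //= i /eqP ->; rewrite eqxx.
  - case: u => [i _ _|j /= j0 ne]; last first.
      by case/eqP: ne; congr inr; apply: val_inj => /=; lia.
    by exists (inl i); split => /=; [congr inr; apply: val_inj|].
  - move=> uv ne; have h : (j' < n - 2)%N by [].
    exists (inr (Ordinal h)); split; first by congr inr; apply: val_inj.
    case: u uv ne => //= j jj ne; rewrite leqNgt; apply/negP => jj'.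
    by case/eqP: ne; congr inr; apply: val_inj => /=; lia.
have src_inj : injective (@src Q).
  move=> [i|j] [i'|j'] //= [e]; first by rewrite e.
  by congr inr; apply: val_inj.
apply: (@thin_quiver k Q lambda_depth lambda_reach depth_tgt reach_refl reach_step
  reach_last (fun p q => qpath_uniq_src depth_tgt src_inj) (Lambda' k m n (n - 1))
  (@bq_pi k B) (fun l => (l < n - 1)%N) _ _ _ _ _ _ _ _ (@line_below m (n - 2))
  lambda_vertex lambda_vertex_inj lambda_vertex_surj).
- move=> c x y; rewrite bq_piD; congr (_ + _).
  exact: esym (bq_piZ (B := B) c x).
- by move=> x y; exact: esym (bq_piM (B := B) x y).
- by [].
- by move=> a; exists (bq_repr a); rewrite bq_reprK.
- move=> p; rewrite -leqNgt => lp.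
  have el : plength p = (n - 1)%N.
    apply/eqP; rewrite eqn_leq lp andbT.
    by have := depth_le (pend p); rewrite (plength_depth depth_tgt); lia.
  have <- : bq_pi (0 : path_algebra k B) = 0.
    by apply: (addrI (bq_pi (0 : path_algebra k B))); rewrite -bq_piD !addr0.
  apply/bq_piP; rewrite subr0; apply/bq_idealP.
  exists [:: (1, p, 1)]; rewrite big_seq1 /= mul1r mulr1 andbT; split=> //.
  by rewrite /Lambda'_rel el; lia.
- move=> x p lp; have <- : bq_pi (0 : path_algebra k B) = 0.
    by apply: (addrI (bq_pi (0 : path_algebra k B))); rewrite -bq_piD !addr0.
  move=> /bq_piP; rewrite subr0; apply: (@mcoeff_ideal_short k B (n - 1)%N x p _ lp).
  by move=> q /andP[_ /eqP ->].
- by lia.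
- by [].
- by case=> [[i|[j|]]|].
- move=> [i|[j|]] [i'|[j'|]] //=.
  + by rewrite (_ : (0 - 0 < n - 1)%N) ?andbT //; lia.
  + by have := ltn_ord j'; lia.
  + by lia.
  + by have := ltn_ord j; have := ltn_ord j'; lia.
  + by have := ltn_ord j; lia.
  + by have := ltn_ord j'; lia.
  + by lia.
Qed.

End LambdaThin.

Section StarThin.
Variables (k : fieldType) (m N : nat) (N_gt0 : (0 < N)%N).
Local Notation arms := (nseq m.+1 2%N ++ [:: N]).
Local Notation Q := (star arms).

Lemma size_arms : size arms = m.+2.
Proof. by rewrite size_cat size_nseq addn1. Qed.

Lemma nth_arms (a : nat) : nth 0%N arms a
  = if (a < m.+1)%N then 2%N else if a == m.+1 then N else 0%N.
Proof.
rewrite nth_cat size_nseq; case: ltnP => h; first by rewrite nth_nseq h.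
case: eqP => [->|ne]; first by rewrite subnn.
by rewrite nth_default //=; lia.
Qed.

(** The position of a vertex has a type depending on its arm; the code replaces
    equality of such dependent pairs by equality of numbers. *)
Definition star_code (v : vertex Q) : option (nat * nat) :=
  if v is Some a then Some (nat_of_ord (tag a), nat_of_ord (tagged a)) else None.

Lemma star_arrow_eq (a b : star_arrow arms) :
  nat_of_ord (tag a) = tag b -> nat_of_ord (tagged a) = tagged b -> a = b.
Proof.
case: a b => [i x] [j y] /= /val_inj e; case: j / e y => y e.
by congr existT; apply: val_inj.
Qed.

Lemma star_code_inj : injective star_code.
Proof.
by move=> [a|] [b|] //= [e1 e2]; congr Some; apply: star_arrow_eq.
Qed.

Lemma star_code_surj (a c : nat) : (a < m.+2)%N -> (c < (nth 0%N arms a).-1)%N ->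
  exists x : star_arrow arms, star_code (Some x) = Some (a, c).
Proof.
move=> ha hc; have ha' : (a < size arms)%N by rewrite size_arms.
by exists (existT (fun i : 'I_(size arms) => 'I_(nth 0%N arms i).-1) (Ordinal ha')
  (Ordinal hc)).
Qed.

Definition vertex_code (i : (option 'I_m + 'I_N)%type) : option (nat * nat) :=
  match i with
  | inl None => Some (0%N, 0%N)
  | inl (Some i) => Some (i.+1, 0%N)
  | inr j => if j == 0%N :> nat then None else Some (m.+1, j.-1)
  end.

Lemma vertex_code_star i : exists v, star_code v = vertex_code i.
Proof.
case: i => [[i|]|j] /=.
- have [||x ex] := @star_code_surj i.+1 0; first by have := ltn_ord i; lia.
    by rewrite nth_arms; have := ltn_ord i; case: ifP => //; lia.
  by exists (Some x).
- have [||x ex] := @star_code_surj 0 0; [by lia|by rewrite nth_arms|].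
  by exists (Some x).
case: eqP => j0; first by exists None.
have [||x ex] := @star_code_surj m.+1 j.-1; first by lia.
  by rewrite nth_arms ltnn eqxx; have := ltn_ord j; lia.
by exists (Some x).
Qed.

Definition star_vertex i : vertex Q :=
  sval (constructive_indefinite_description (vertex_code_star i)).
Lemma star_vertexE i : star_code (star_vertex i) = vertex_code i.
Proof. by rewrite /star_vertex; case: constructive_indefinite_description. Qed.

Lemma star_vertex_inj : injective star_vertex.
Proof.
move=> i j /(congr1 star_code); rewrite !star_vertexE.
case: i j => [[i|]|i] [[j|]|j] //=.
- by case=> /val_inj ->.
- by case: ifP => // _ [h]; have := ltn_ord i; rewrite h ltnn.
- by case: ifP.
- by case: ifP => // _ [h]; have := ltn_ord j; rewrite -h ltnn.
- by case: ifP.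
by case: eqP => hi; case: eqP => hj //; [move=> _|case=> h]; congr inr;
  apply: val_inj => /=; lia.
Qed.

Lemma star_vertex_surj v : exists i, v = star_vertex i.
Proof.
suff [i ei] : exists i, vertex_code i = star_code v.
  by exists i; apply: star_code_inj; rewrite star_vertexE.
case: v => [[i x]|]; last by exists (inr (Ordinal N_gt0)).
suff h (a c : nat) : (a < m.+2)%N -> (c < (nth 0%N arms a).-1)%N ->
    exists i, vertex_code i = Some (a, c).
  by apply: h (ltn_ord x); have := ltn_ord i; rewrite [X in (_ < X)%N]size_arms.
rewrite nth_arms => ha; case: (ltnP a m.+1) => am hc.
  have -> : c = 0%N by case: c hc.
  case: (posnP a) => [->|a0]; first by exists (inl None).
  have h : (a.-1 < m)%N by lia.
  by exists (inl (Some (Ordinal h))); rewrite /= prednK.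
have am' : a = m.+1 by lia.
move: hc; rewrite am' eqxx => hc; have h : (c.+1 < N)%N by lia.
by exists (inr (Ordinal h)).
Qed.

Definition star_depth (v : vertex Q) : nat :=
  if star_code v is Some (_, c) then c.+1 else 0.
Definition star_reach (u v : vertex Q) : bool :=
  match star_code u, star_code v with
  | None, _ => true
  | Some (a, c), Some (a', c') => (a == a') && (c <= c')%N
  | Some _, None => false
  end.

Lemma star_code_src (a : arrow Q) : star_code (src a)
  = if tagged a == 0%N :> nat then None
    else Some (nat_of_ord (tag a), (nat_of_ord (tagged a)).-1).
Proof. by case: a => i j /=; case: eqP. Qed.

Lemma star_thin : inhabited (thin (path_algebra k Q) (source_shape m N)).
Proof.
have depth_tgt (a : arrow Q) : star_depth (tgt a) = (star_depth (src a)).+1.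
  by rewrite /star_depth star_code_src /=; case: eqP => [->|/eqP] //=; case: (nat_of_ord _).
have reach_refl v : star_reach v v.
  by rewrite /star_reach; case: star_code => // -[a c]; rewrite eqxx leqnn.
have reach_step u (a : arrow Q) : star_reach u (src a) -> star_reach u (tgt a).
  rewrite /star_reach star_code_src /=; case: (star_code u) => // -[b c].
  by case: eqP => // _ /andP[-> h] /=; lia.
have reach_last u v : star_reach u v -> u != v ->
    exists a : arrow Q, tgt a = v /\ star_reach u (src a).
  case: v => [[i x]|]; last first.
    rewrite /star_reach /=; case e: (star_code u) => [[b c]|] // _ /eqP[].
    exact: star_code_inj.
  move=> ua ne; exists (existT _ i x); split=> //; move: ua ne.
  rewrite /star_reach star_code_src /=; case e: (star_code u) => [[b c]|] //.
  move=> /andP[/eqP eb ec] ne.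
  have nc : c <> x.
    move=> ec'; case/eqP: ne; apply: star_code_inj.
    by rewrite e /= eb ec'.
  rewrite /= in eb ec *; move: (nat_of_ord x) ec nc => c' ec nc.
  by case: eqP => h; [lia|rewrite eb eqxx /=; lia].
have tgt_inj : injective (@tgt Q) by move=> a b [].
apply: (@thin_quiver k Q star_depth star_reach depth_tgt reach_refl reach_step
  reach_last (fun p q => qpath_uniq_tgt depth_tgt tgt_inj) (path_algebra k Q)
  id predT _ _ _ _ _ _ _ _ (@source_below m N) star_vertex star_vertex_inj
  star_vertex_surj) => //.
- by move=> a; exists a.
- by move=> x p _ ->; exact: mcoeff0.
- by case=> [[[i|]|j]|].
move=> i j; rewrite andbT /star_reach !star_vertexE.
case: i j => [[i|]|i] [[j|]|j] //=.
- by rewrite andbT eqSS; exact: esym (inj_eq val_inj i j).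
- by case: ifP => // _; have := ltn_ord i; case: eqP => //; lia.
- by case: ifP.
- by case: eqP => //= _; have := ltn_ord j; case: eqP => //; lia.
- by case: eqP.
by case: eqP => hi; [rewrite hi|case: eqP => hj; rewrite ?eqxx /=; lia].
Qed.

End StarThin.

Close Scope cat_scope.
Close Scope ring_scope.

Theorem proposition3p1 (k : fieldType) (m n : nat) (hm : 2 <= m) (hn : 3 <= n) :
  piecewise_hereditary_of_type (Lambda' k m n (n - 1))
    (star (nseq m.+1 2 ++ [:: n - 2])).
Proof.
have N_gt0 : 0 < n - 2 by lia.
have [T] := lambda_thin k m hn; have [T'] := star_thin k m N_gt0.
split; [exact: thin_finite_dim T|exact: thin_finite_dim T'|split].
- exact: abelian_transfer (th_equivalence T') (rep_abelian _ _).
- apply: hereditary_transfer (th_equivalence T') _.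
  exact: forest_hereditary (source_forest m N_gt0).
have [_ e1] := add_equivalence_triangle (th_equivalence T).
have e2 := line_source_equivalence k m N_gt0.
have [e3 _] := add_equivalence_triangle (th_equivalence T').
exact: triangle_equivalent_trans e1 (triangle_equivalent_trans e2 e3).
Qed.
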